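(* Let $\mathbb{F}$ be a field (with involution) with $\operatorname{char}(\mathbb{F})=0$, let $\mathcal{A}$ be a noncommutative prime PI algebra over $\mathbb{F}$ with involution $*$ of the second kind, let $f\in\mathbb{F}\langle\bar X,\bar X^*\rangle$, and let $\mathcal{L}:=\operatorname{span} f(\mathcal{A})$. Then exactly one of the following four possibilities holds: (i) $f$ is an identity of $\mathcal{A}$; in this case $\widetilde{\mathcal{L}}=0$; (ii) $f$ is a central polynomial of $\mathcal{A}$; in this case $\widetilde{\mathcal{L}}=\widetilde{\mathcal{Z}}$; (iii) $f$ is not an identity of $\mathcal{A}$, but is cyclically equivalent to an identity of $\mathcal{A}$; in this case $\widetilde{\mathcal{L}}=[\widetilde{\mathcal{A}},\widetilde{\mathcal{A}}]$; (iv) $f$ is not a central polynomial of $\mathcal{A}$ and is not cyclically equivalent to an identity of $\mathcal{A}$; in this case $\widetilde{\mathcal{L}}=\widetilde{\mathcal{A}}$.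
   Context: $\mathbb{F}$ carries an involution $*$ (a field automorphism of order at most $2$, possibly trivial). An involution on an $\mathbb{F}$-algebra $\mathcal{A}$ is an additive map $*$ with $(ab)^*=b^*a^*$, $a^{**}=a$, $(\lambda a)^*=\lambda^*a^*$; it is of the second kind if it does not fix the center $\mathcal{Z}$ of $\mathcal{A}$ pointwise. $\mathbb{F}\langle\bar X,\bar X^*\rangle$ is the free $*$-algebra over $\mathbb{F}$ on $\bar X=\{X_1,X_2,\ldots\}$, i.e. all polynomials in noncommuting variables $X_i,X_j^*$. For $f=f(X_1,\ldots,X_n,X_1^*,\ldots,X_n^* )$, $f(\mathcal{A})=\{f(a_1,\ldots,a_n,a_1^*,\ldots,a_n^* ):a_i\in\mathcal{A}\}$ and $\operatorname{span}$ is the $\mathbb{F}$-linear span. $f$ is an identity of $\mathcal{A}$ if $f(\mathcal{A})=\{0\}$; $f$ is a central polynomial of $\mathcal{A}$ if it is not an identity of $\mathcal{A}$ but $f(\mathcal{A})\subseteq\mathcal{Z}$. Polynomials $f,g\in\mathbb{F}\langle\bar X,\bar X^*\rangle$ are cyclically equivalent if $f-g$ is a sum of commutators $pq-qp$ with $p,q\in\mathbb{F}\langle\bar X,\bar X^*\rangle$. Algebras are associative and not necessarily unital; if $\mathcal{A}$ has no identity element, $f$ is understood to have zero constant term. An algebra is prime if the product of any two of its nonzero ideals is nonzero; it is PI if it satisfies a nonzero polynomial identity from the free algebra $\mathbb{F}\langle X_1,X_2,\ldots\rangle$. For a prime PI algebra $\mathcal{A}$ the center $\mathcal{Z}$ is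 nonzero; $\widetilde{\mathcal{Z}}$ denotes its field of fractions, and the central closure $\widetilde{\mathcal{A}}$ is the central localization consisting of elements $z^{-1}a$ ($a\in\mathcal{A}$, $0\neq z\in\mathcal{Z}$), a finite dimensional central simple algebra over $\widetilde{\mathcal{Z}}$. For $\mathcal{V}\subseteq\mathcal{A}$, $\widetilde{\mathcal{V}}$ denotes the $\widetilde{\mathcal{Z}}$-linear span of $\mathcal{V}$ in $\widetilde{\mathcal{A}}$. $[\widetilde{\mathcal{A}},\widetilde{\mathcal{A}}]$ is the linear span of all commutators in $\widetilde{\mathcal{A}}$. *)

(* Defs.v *)
From HB Require Import structures.
From mathcomp Require Import all_boot all_order all_algebra.
From mathcomp Require Import finmap boolp classical_sets.
From mathcomp Require Export monalg.
Set Implicit Arguments.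
Unset Strict Implicit.
Unset Printing Implicit Defensive.
Import GRing.Theory.
Local Open Scope classical_set_scope.
Local Open Scope ring_scope.

(* MathComp algebras are unital; the algebras considered here need not be. *)
HB.mixin Record isAssocAlg (F : fieldType) A of GRing.Lmodule F A := {
  amul : A -> A -> A;
  amulA : associative amul;
  amulDl : left_distributive amul +%R;
  amulDr : right_distributive amul +%R;
  amulZl : forall (c : F) (a b : A), amul (c *: a) b = c *: amul a b;
  amulZr : forall (c : F) (a b : A), amul a (c *: b) = c *: amul a b
}.

#[short(type="assocAlgType")]
HB.structure Definition AssocAlg (F : fieldType) :=
  {A of isAssocAlg F A & GRing.Lmodule F A}.

Definition lin_span (K : fieldType) (V : lmodType K) (S : set V) : set V :=
  [set x | exists (n : nat) (c : 'I_n -> K) (v : 'I_n -> V),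
     (forall i, S (v i)) /\ x = \sum_(i < n) c i *: v i].

Section Algebra.
Variables (F : fieldType) (A : assocAlgType F).

Definition is_one (e : A) : Prop := forall a : A, amul e a = a /\ amul a e = a.

Definition unital : Prop := exists e : A, is_one e.

Definition center : set A := [set z | forall a : A, amul z a = amul a z].

Definition noncommutative : Prop := exists a b : A, amul a b <> amul b a.

Definition ideal (I : set A) : Prop :=
  [/\ I 0,
      forall x y : A, I x -> I y -> I (x + y),
      forall (c : F) (x : A), I x -> I (c *: x)
    & forall a x : A, I x -> I (amul a x) /\ I (amul x a)].

Definition ideal_mul (I J : set A) : set A :=
  lin_span [set z | exists x y : A, [/\ I x, J y & z = amul x y]].

Definition prime_alg : Prop :=
  forall I J : set A, ideal I -> ideal J ->
    I <> [set 0] -> J <> [set 0] -> ideal_mul I J <> [set 0].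

(* The free unital algebra on a set I is {malg F[{fmonom I}]}, the algebra of
   the free monoid on I.  In a nonunital algebra the empty word is given the
   junk value 0, which is harmless because there only polynomials without
   constant term are considered (see [evaluable]). *)
Definition word_value (I : choiceType) (v : I -> A) (w : {fmonom I}) : A :=
  match (w : seq I) with
  | [::] => xget 0 [set e | is_one e]
  | i :: s => foldl (fun b k => amul b (v k)) (v i) s
  end.

Definition alg_eval (I : choiceType) (v : I -> A) (f : {malg F[{fmonom I}]}) : A :=
  \sum_(w <- msupp f) f@_w *: word_value v w.

Definition evaluable (I : choiceType) (f : {malg F[{fmonom I}]}) : Prop :=
  unital \/ f@_(mone : {fmonom I}) = 0.

Definition PI_alg : Prop :=
  exists f : {malg F[{fmonom nat}]},
    [/\ f != 0, evaluable f & forall v : nat -> A, alg_eval v f = 0].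

Definition involution_on (cj : F -> F) (star : A -> A) : Prop :=
  [/\ forall a b : A, star (a + b) = star a + star b,
      forall a b : A, star (amul a b) = amul (star b) (star a),
      forall a : A, star (star a) = a
    & forall (c : F) (a : A), star (c *: a) = cj c *: star a].

Definition second_kind (star : A -> A) : Prop :=
  exists z : A, center z /\ star z <> z.

End Algebra.

Arguments center {F} A _.

(* Free *-algebra: inl i stands for X_i and inr i for X_i^*. *)
Definition star_poly (F : fieldType) := {malg F[{fmonom (nat + nat)%type}]}.

Section StarPolynomials.
Variables (F : fieldType) (A : assocAlgType F) (star : A -> A).

Definition star_eval (a : nat -> A) (f : star_poly F) : A :=
  alg_eval (fun x : nat + nat => match x with inl i => a i | inr i => star (a i) end) f.

Definition image_of (f : star_poly F) : set A := range (fun a => star_eval a f).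

Definition star_identity (f : star_poly F) : Prop :=
  evaluable A f /\ image_of f = [set 0].

Definition central_poly (f : star_poly F) : Prop :=
  ~ star_identity f /\ image_of f `<=` center A.

End StarPolynomials.

Definition cyc_equiv (F : fieldType) (f g : star_poly F) : Prop :=
  exists s : seq (star_poly F * star_poly F),
    f - g = \sum_(pq <- s) (pq.1 * pq.2 - pq.2 * pq.1).

(* K is the field of fractions of the center Z of A, and B, with the embedding
   j : A -> B, is the localization of A at the nonzero elements of Z; K acts
   on B as the set of all fractions z^-1 z', and the elements of B are the
   fractions z^-1 a.  This determines (K, B, j) up to unique isomorphism. *)
Definition central_closure (F : fieldType) (A : assocAlgType F)
    (K : fieldType) (B : algType K) (j : A -> B) : Prop :=
  [/\ injective j,
      (forall a b : A, j (a + b) = j a + j b) /\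
      (forall a b : A, j (amul a b) = j a * j b),
      forall z : A, center A z -> exists k : K, j z = k%:A,
      forall k : K, exists z z' : A,
        [/\ center A z, z <> 0, center A z' & j z * k%:A = j z']
    & forall b : B, exists z a : A, [/\ center A z, z <> 0 & j z * b = j a]].

Definition tilde (F : fieldType) (A : assocAlgType F)
    (K : fieldType) (B : algType K) (j : A -> B) (V : set A) : set B :=
  lin_span (j @` V).

Definition commutator_space (K : fieldType) (B : algType K) : set B :=
  lin_span [set c | exists x y : B, c = x * y - y * x].

Arguments commutator_space {K} B _.

Definition scalars (K : fieldType) (B : algType K) : set B :=
  range (fun k : K => k%:A).

Arguments scalars {K} B _.

Definition exactly_one4 (P Q R S : Prop) : Prop :=
  [\/ [/\ P, ~ Q, ~ R & ~ S],
      [/\ ~ P, Q, ~ R & ~ S],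
      [/\ ~ P, ~ Q, R & ~ S]
    | [/\ ~ P, ~ Q, ~ R & S]].

(* Main.v *)
From HB Require Import structures.
Require Import Defs.
From mathcomp Require Import all_boot all_order all_algebra generic_quotient.
From mathcomp Require Import finmap boolp classical_sets functions ring.
Set Implicit Arguments.
Unset Strict Implicit.
Unset Printing Implicit Defensive.
Import GRing.Theory.
Local Open Scope classical_set_scope.
Local Open Scope ring_scope.

(** Write [B] for the central closure of [A] and [K] for its field of scalars, and
    let [L~] be the [K]-span of the values of [f] in [B].

    The span [L~] is a Lie ideal of [B].  If [u] is skew, moving all variables
    along [[u, -]] is compatible with the involution and moves the value of [f]
    along [[u, -]]; since [L~] contains the coefficients of polynomial paths in
    it ([coefs_in_subspace]), it is stable under [[u, -]].  As the involution is
    of the second kind there is a nonzero skew central element, which turns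
    symmetric elements into skew ones, so skew elements span [B] over [K]
    ([skew_span], [value_span_lie]).  Herstein's theorem on Lie ideals of simple
    algebras ([herstein_lie_ideal]) then says that either [L~] is central or
    it contains [[B, B]], and [B] is the sum of [K] and [[B, B]]
    ([commutator_codim1]) while [1] is not in [[B, B]].  Hence [L~] is one of [0],
    [K], [[B, B]] and [B].

    It remains to see that [L~] lies in [[B, B]] exactly when [f] is cyclically
    equivalent to an identity.  One direction is evaluation.  For the other
    one, a homogeneous [f] of degree [d > 0] is cyclically equivalent to [1 / d] times
    the sum over the letters [x] of [G_x x], where [G_x] is the cyclic derivative
    of [f], by Euler's formula.  If the values of [f] lie in [[B, B]], so do its
    derivatives, which are the sums of the [G_x h_x] modulo [[B, B]].  Moving one
    variable at a time, and multiplying it by a central element that the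
    involution does not fix in order to separate [X_i] from [X_i^*], one gets
    that [G_x B] is inside [[B, B]]; this forces [G_x] to vanish at all points
    ([cyclic_coef_eq0], [traceless_cyclic_identity]).

    All this needs that [B] is simple, that some nonzero operator of the form
    [b |-> sum of a_i b b_i] has scalar values, and that [1] is not a sum of
    commutators.  These facts come from a form of Posner's theorem, obtained by
    the method of Amitsur and Martindale.  The Martindale closure [R] of [A]
    is the algebra that [A] and its extended centroid [C] generate inside the
    ring of germs of right linear maps on nonzero ideals.  It is centrally
    closed, so the tensor product of [R] with its opposite acts faithfully on
    [R] ([mult_op_eq0]).  Comparing coefficients in a multilinear identity gives
    a nonzero multiplication operator of finite rank, then an element [c] with
    [c R c] finite dimensional, and a staircase of elements multiplying like the
    matrix units [E_{i,i+1}] would violate the identity unless [R] itself is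
    finite dimensional ([PI_fin_dim]).  Then every linear endomorphism of [R] is
    a multiplication operator ([scalar_valued_op]) and the regular trace shows that
    [1] is not a sum of commutators ([one_not_commutators]).  Clearing
    denominators brings both facts back to [A], where every nonzero ideal turns
    out to contain nonzero central elements, and from there to [B]. *)

(** * Spans and finite dimension *)

Section Span.
Variables (C : fieldType) (V : lmodType C).
Implicit Types (s u : seq V) (q : V).

(** Spans of lists are defined by recursion, so that relations can be treated by
    removing one vector at a time. *)
Fixpoint in_span s q : Prop :=
  if s is t :: s' then exists c : C, in_span s' (q - c *: t) else q = 0.

Fixpoint free_seq s : Prop :=
  if s is t :: s' then ~ in_span s' t /\ free_seq s' else True.

Lemma in_span0 s : in_span s 0.
Proof. by elim: s => //= t s IH; exists 0; rewrite scale0r subr0. Qed.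

Lemma in_spanD s p q : in_span s p -> in_span s q -> in_span s (p + q).
Proof.
elim: s p q => [|t s IH] p q /=; first by move=> -> ->; rewrite addr0.
by move=> [c /IH hp] [d /hp hq]; exists (c + d); rewrite scalerDl opprD addrACA.
Qed.

Lemma in_spanZ s c q : in_span s q -> in_span s (c *: q).
Proof.
elim: s q => [|t s IH] q /=; first by move=> ->; rewrite scaler0.
by move=> [d /IH h]; exists (c * d); rewrite -scalerA -scalerBr.
Qed.

Lemma in_spanN s q : in_span s q -> in_span s (- q).
Proof. by move=> h; rewrite -scaleN1r; apply: in_spanZ. Qed.

Lemma in_spanB s p q : in_span s p -> in_span s q -> in_span s (p - q).
Proof. by move=> hp hq; apply/in_spanD/in_spanN. Qed.

Lemma in_span_cons s t q : in_span s q -> in_span (t :: s) q.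
Proof. by move=> h; exists 0; rewrite scale0r subr0. Qed.

Lemma in_span_head s t : in_span (t :: s) t.
Proof. by exists 1; rewrite scale1r subrr; apply: in_span0. Qed.

Lemma in_span_mem s q : q \in s -> in_span s q.
Proof.
elim: s => //= t s IH; rewrite inE => /predU1P[->|/IH]; last exact: in_span_cons.
exact: in_span_head.
Qed.

Lemma in_span_trans s u q :
  (forall t, t \in s -> in_span u t) -> in_span s q -> in_span u q.
Proof.
elim: s q => [|t s IH] q hs /=; first by move=> ->; apply: in_span0.
move=> [c /IH h]; rewrite -(subrK (c *: t) q); apply: in_spanD.
  by apply: h => x xs; apply: hs; rewrite inE xs orbT.
by apply/in_spanZ/hs; rewrite inE eqxx.
Qed.

Lemma in_span_catl s u q : in_span s q -> in_span (s ++ u) q.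
Proof.
by apply: in_span_trans => t ts; apply: in_span_mem; rewrite mem_cat ts.
Qed.

Lemma in_span_catr s u q : in_span u q -> in_span (s ++ u) q.
Proof.
by apply: in_span_trans => t ts; apply: in_span_mem; rewrite mem_cat ts orbT.
Qed.

Lemma in_span_nth s q : in_span s q ->
  exists c : nat -> C, q = \sum_(i < size s) c i *: s`_i.
Proof.
elim: s q => [|t s IH] q /=; first by move=> ->; exists (fun=> 0); rewrite big_ord0.
move=> [c /IH[d hd]]; exists (fun i => if i is i'.+1 then d i' else c).
by rewrite big_ord_recl /= -hd addrC subrK.
Qed.

Lemma in_span_sum s (c : nat -> C) : in_span s (\sum_(i < size s) c i *: s`_i).
Proof.
elim: s c => [|t s IH] c /=; first by rewrite big_ord0.
by exists (c 0%N); rewrite big_ord_recl /= addrC addKr; apply: IH (fun i => c i.+1).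
Qed.

Lemma free_seqP s (c : nat -> C) : free_seq s ->
  \sum_(i < size s) c i *: s`_i = 0 -> forall i, (i < size s)%N -> c i = 0.
Proof.
elim: s c => //= t s IH c [ts fs]; rewrite big_ord_recl /= => h.
have c0 : c 0%N = 0.
  case: (eqVneq (c 0%N) 0) => // nz; case: ts.
  move/eqP: h; rewrite addr_eq0 => /eqP h.
  rewrite -[t](scalerK nz) h; apply/in_spanZ/in_spanN.
  exact: in_span_sum (fun i => c i.+1).
move: h; rewrite c0 scale0r add0r => /(IH (fun i => c i.+1) fs) h [|i] //.
exact: h.
Qed.

(** Discarding dependent vectors one at a time leaves a basis of the span. *)
Lemma free_subseq s : exists u, free_seq u /\ forall q, in_span s q -> in_span u q.
Proof.
elim: s => [|t s [u [fu su]]]; first by exists [::].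
have [tu|tu] := pselect (in_span u t); last first.
  by exists (t :: u); split=> // q /= [c /su h]; exists c.
exists u; split=> // q /= [c /su h].
by rewrite -(subrK (c *: t) q); apply/in_spanD/in_spanZ.
Qed.

Definition fin_dim (X : set V) := exists s, forall q, X q -> in_span s q.

Definition subspace (X : set V) :=
  X 0 /\ forall c x y, X x -> X y -> X (c *: x + y).

Section Subspace.
Variables (X : set V) (sX : subspace X).
Lemma subspaceD x y : X x -> X y -> X (x + y).
Proof. by move=> hx hy; rewrite -[x]scale1r; apply: sX.2. Qed.
Lemma subspaceZ c x : X x -> X (c *: x).
Proof. by move=> hx; rewrite -[_ *: _]addr0; apply: sX.2 => //; apply: sX.1. Qed.
Lemma subspaceN x : X x -> X (- x).
Proof. by move=> hx; rewrite -scaleN1r; apply: subspaceZ. Qed.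
Lemma subspaceB x y : X x -> X y -> X (x - y).
Proof. by move=> hx hy; apply/subspaceD/subspaceN. Qed.
Lemma subspace_sum (I : Type) (r : seq I) (P : pred I) (f : I -> V) :
  (forall i, P i -> X (f i)) -> X (\sum_(i <- r | P i) f i).
Proof. by move=> h; apply: (big_ind X) => //; [exact: sX.1|exact: subspaceD]. Qed.
End Subspace.

Lemma fin_dim_add (X Y : set V) (x0 : V) : fin_dim Y ->
  (forall x, X x -> exists c, Y (x - c *: x0)) -> fin_dim X.
Proof.
move=> [s hs] h; exists (x0 :: s) => q /h[c hc].
by exists c; apply: hs.
Qed.

End Span.

Lemma linear_at0 (C : fieldType) (V W : lmodType C) (f : V -> W) :
  linear f -> f 0 = 0.
Proof. by move=> lf; have := lf (-1) 0 0; rewrite scaler0 addr0 scaleN1r addNr. Qed.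

Lemma in_span_map (C : fieldType) (V W : lmodType C) (f : V -> W) s q :
  linear f -> in_span s q -> in_span (map f s) (f q).
Proof.
move=> lf; elim: s q => [|t s IH] q /=.
  by move=> ->; apply: linear_at0.
move=> [c /IH h]; exists c.
by have := lf c t (q - c *: t); rewrite addrCA subrr addr0 => ->; rewrite /= addrAC subrr add0r.
Qed.

(** One vector of [u] at a time: the elements of [X] whose image avoids the head
    of [u] have codimension at most one in [X]. *)
Lemma inf_dim_ker (C : fieldType) (V W : lmodType C) (X : set V) (f : V -> W)
    (u : seq W) :
  subspace X -> ~ fin_dim X -> linear f -> (forall x, X x -> in_span u (f x)) ->
  subspace [set x | X x /\ f x = 0] /\ ~ fin_dim [set x | X x /\ f x = 0].
Proof.
move=> sX nX lf; elim: u X sX nX => [|t u IH] X sX nX hX.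
  have -> : [set x | X x /\ f x = 0] = X.
    apply/seteqP; split=> x; first by case.
    by move=> Xx; split=> //; apply: hX.
  by [].
pose X' := [set x | X x /\ in_span u (f x)].
have f0 := linear_at0 lf.
have sX' : subspace X'.
  split; first by split; [exact: sX.1|rewrite f0; apply: in_span0].
  move=> c x y [Xx fx] [Xy fy]; split; first exact: sX.2.
  by rewrite lf; apply/in_spanD/fy/in_spanZ.
have nX' : ~ fin_dim X'.
  move=> fX'; apply: nX.
  have [[x0 [Xx0 nx0]]|no] := pselect (exists x0, X x0 /\ ~ in_span u (f x0)).
    apply: (fin_dim_add (x0 := x0) fX') => x Xx.
    have [c hc] := hX _ Xx0; have [d hd] := hX _ Xx.
    have nc : c != 0.
      by apply/eqP => c0; apply: nx0; rewrite c0 scale0r subr0 in hc.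
    exists (d / c); split.
      by rewrite addrC -scaleNr; apply: sX.2.
    rewrite -scaleNr addrC lf.
    have -> : (- (d / c)) *: f x0 + f x =
      (f x - d *: t) - (d / c) *: (f x0 - c *: t).
      by rewrite scalerBr scalerA divfK // opprB addrA subrK scaleNr addrC.
    by apply: in_spanB => //; apply: in_spanZ.
  have [s hs] := fX'; exists s => q Xq; apply: hs; split=> //.
  by apply: contrapT => nq; apply: no; exists q.
have [sY nY] := IH X' sX' nX' (fun x h => h.2).
have -> // : [set x | X x /\ f x = 0] = [set x | X' x /\ f x = 0].
apply/seteqP; split=> x [].
  by move=> Xx fx; split=> //; split=> //; rewrite fx; apply: in_span0.
by move=> [Xx _].
Qed.

(** The same induction chooses the spanning vectors inside [X]. *)
Lemma fin_dim_gen (C : fieldType) (V : lmodType C) (X : set V) :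
  subspace X -> fin_dim X ->
  exists s, (forall t, t \in s -> X t) /\ forall q, X q -> in_span s q.
Proof.
move=> sX [u]; elim: u X sX => [|t u IH] X sX hX; first by exists [::].
pose X' := [set x | X x /\ in_span u x].
have sX' : subspace X'.
  split; first by split; [exact: sX.1|apply: in_span0].
  move=> c x y [Xx fx] [Xy fy]; split; first exact: sX.2.
  by apply/in_spanD/fy/in_spanZ.
have [s [sub gen]] := IH X' sX' (fun x h => h.2).
have [[x0 [Xx0 nx0]]|no] := pselect (exists x0, X x0 /\ ~ in_span u x0); last first.
  exists s; split=> [y /sub[]//|q Xq]; apply: gen; split=> //.
  by apply: contrapT => nq; apply: no; exists q.
exists (x0 :: s); split=> [y|q Xq].
  by rewrite inE => /predU1P[->//|/sub[]].
have [c hc] := hX _ Xx0; have [d hd] := hX _ Xq.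
have nc : c != 0.
  by apply/eqP => c0; apply: nx0; rewrite c0 scale0r subr0 in hc.
exists (d / c); apply: gen; split.
  by rewrite addrC -scaleNr; apply: sX.2.
have -> : q - (d / c) *: x0 = (q - d *: t) - (d / c) *: (x0 - c *: t).
  by rewrite scalerBr scalerA divfK // opprB addrA subrK.
by apply: in_spanB => //; apply: in_spanZ.
Qed.

(** * Multiplication operators on centrally closed prime algebras *)

Definition prime_ring (R : nzRingType) :=
  forall a b : R, (forall x, a * x * b = 0) -> a = 0 \/ b = 0.

(** An elementwise form of the condition that the extended centroid of [R] is
    [C]. *)
Definition centrally_closed (C : fieldType) (R : algType C) :=
  forall b b' : R, b <> 0 -> (forall y, b * y * b' = b' * y * b) ->
  exists c : C, b' = c *: b.

Definition mult_op (R : nzRingType) (s : seq (R * R)) (x : R) : R :=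
  \sum_(z <- s) z.1 * x * z.2.

Section MultOp.
Variables (C : fieldType) (R : algType C).
Implicit Types s : seq (R * R).

Lemma mult_op_nil (x : R) : mult_op [::] x = 0.
Proof. exact: big_nil. Qed.

Lemma mult_op_cons z s x : mult_op (z :: s) x = z.1 * x * z.2 + mult_op s x.
Proof. exact: big_cons. Qed.

Lemma mult_op_cat s u x : mult_op (s ++ u) x = mult_op s x + mult_op u x.
Proof. exact: big_cat. Qed.

Lemma mult_op_linear s : linear (mult_op s).
Proof.
move=> c x y; rewrite /mult_op scaler_sumr -big_split; apply: eq_bigr => z _ /=.
by rewrite mulrDr mulrDl -scalerAr -scalerAl.
Qed.

Lemma mult_op_propl p s : (forall z, z \in s -> exists c : C, z.1 = c *: p) ->
  exists q, in_span (map snd s) q /\ forall y, mult_op s y = p * y * q.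
Proof.
elim: s => [|[a b] s IH] h.
  by exists 0; split=> // y; rewrite mult_op_nil mulr0.
have [|q [hq eq]] := IH; first by move=> z zs; apply: h; rewrite inE zs orbT.
have [c /= ac] : exists c : C, (a, b).1 = c *: p by apply: h; rewrite inE eqxx.
exists (q + c *: b); split; first by exists c; rewrite addrK.
by move=> y; rewrite mult_op_cons eq /= ac addrC mulrDr -scalerAr -!scalerAl.
Qed.

End MultOp.

Section Tensor.
Variables (C : fieldType) (M V : lmodType C).
Implicit Types s : seq (M * V).

Definition bilinear_map (W : lmodType C) (b : M -> V -> W) :=
  (forall v, linear (b^~ v)) /\ (forall m, linear (b m)).

(** Lists of pairs stand for tensors, on which bilinear maps are evaluated.  A pair
    [(a, r)] whose right component is a combination of those present is absorbed
    by adding multiples of [a] to the left components. *)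
Lemma tensor_absorb s a r : in_span (map snd s) r ->
  exists s', [/\ map snd s' = map snd s,
    forall (W : lmodType C) (b : M -> V -> W), bilinear_map b ->
      \sum_(z <- s') b z.1 z.2 = \sum_(z <- s) b z.1 z.2 + b a r,
    forall z, z \in s -> exists2 z', z' \in s' & exists c : C, z'.1 = c *: a + z.1
    & forall z', z' \in s' -> exists2 z, z \in s & exists c : C, z'.1 = c *: a + z.1].
Proof.
elim: s r => [|[p t] s IH] r /=.
  move=> ->; exists [::]; split=> // W b [_ bl].
  by rewrite !big_nil add0r (linear_at0 (bl a)).
move=> [c /IH[s' [eqs sum mem mem']]]; exists ((c *: a + p, t) :: s'); split.
- by rewrite /= eqs.
- move=> W b bb; rewrite !big_cons sum //= (bb.1 t).
  have -> : b a r = c *: b a t + b a (r - c *: t).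
    by rewrite -(bb.2 a) addrC subrK.
  by rewrite [RHS]addrACA (addrC (b p t)).
- move=> z; rewrite inE => /predU1P[->|/mem[z' z's' hz]].
    by exists (c *: a + p, t); rewrite ?inE ?eqxx //; exists c.
  by exists z' => //; rewrite inE z's' orbT.
- move=> z; rewrite inE => /predU1P[->|/mem'[z' z's' hz]].
    by exists (p, t); rewrite ?inE ?eqxx //; exists c.
  by exists z' => //; rewrite inE z's' orbT.
Qed.

(** The last clause makes it possible to keep track of the form of the left
    components. *)
Lemma tensor_free s : exists s', [/\ free_seq (map snd s'),
    forall (W : lmodType C) (b : M -> V -> W), bilinear_map b ->
      \sum_(z <- s') b z.1 z.2 = \sum_(z <- s) b z.1 z.2
    & forall P : set M, subspace P -> (forall z, z \in s -> P z.1) ->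
      forall z, z \in s' -> P z.1].
Proof.
elim: s => [|[a r] s [s' [fs' sum sub]]]; first by exists [::].
have [hr|hr] := pselect (in_span (map snd s') r).
  have [u [equ sumu _ mem]] := tensor_absorb a hr; exists u; split.
  - by rewrite equ.
  - by move=> W b bb; rewrite sumu // big_cons sum // addrC.
  - move=> P sP hP z /mem[z' z's' [c ->]]; apply: sP.2.
      by apply: (hP (a, r)); rewrite inE eqxx.
    by apply: (sub P) => // x xs; apply: hP; rewrite inE xs orbT.
exists ((a, r) :: s'); split=> //.
- by move=> W b bb; rewrite !big_cons sum.
- move=> P sP hP z; rewrite inE => /predU1P[->|zs'].
    by apply: (hP (a, r)); rewrite inE eqxx.
  by apply: (sub P) => // x xs; apply: hP; rewrite inE xs orbT.
Qed.

End Tensor.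

Lemma mult_op_bilinear (C : fieldType) (R : algType C) (y : R) :
  bilinear_map (fun a b : R => a * y * b).
Proof.
split=> [v c a b|m c a b]; first by rewrite !mulrDl -!scalerAl.
by rewrite mulrDr -scalerAr.
Qed.

Section Closed.
Variables (C : fieldType) (R : algType C).
Hypotheses (Rprime : prime_ring R) (Rclosed : centrally_closed R).
Implicit Types s : seq (R * R).

(** The step on which the arguments below run: multiplying an operator by the
    left coefficient [a] of one of its terms in two ways and subtracting cancels
    that term. *)
Lemma mult_op_cancel a b s w y :
  mult_op [seq (a * w * z.1 - z.1 * w * a, z.2) | z <- s] y =
  a * w * mult_op ((a, b) :: s) y - mult_op ((a, b) :: s) (w * a * y).
Proof.
rewrite !mult_op_cons /= mulrDr !mulrA [_ + a * w * _]addrC opprD addrA addrK.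
rewrite /mult_op big_map !mulr_sumr -sumrB; apply: eq_bigr => x _ /=.
by rewrite 2!mulrBl !mulrA.
Qed.

(** The fundamental fact on centrally closed prime algebras: [R] tensored with
    its opposite acts faithfully on [R].  By induction, cancelling a term with
    nonzero left coefficient [a] shows that every other left coefficient [p]
    satisfies [a w p = p w a], hence is a multiple of [a]; this contradicts
    freeness of the right coefficients. *)
Lemma mult_op_eq0 s : free_seq (map snd s) -> (forall y, mult_op s y = 0) ->
  forall z, z \in s -> z.1 = 0.
Proof.
move: {2}(size s) (leqnn (size s)) => n; elim: n s => [|n IH] [|[a b] s] //= sz.
move=> [bn fs] h.
have a0 : a = 0.
  apply: contrapT => an0.
  have [z zs|q [qs eqs]] := @mult_op_propl C R a s.
    apply: (Rclosed an0) => w; apply/eqP; rewrite -subr_eq0; apply/eqP.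
    pose s' := [seq (a * w * z.1 - z.1 * w * a, z.2) | z <- s].
    apply: (IH s' _ _ _ (a * w * z.1 - z.1 * w * a, z.2)).
    - by rewrite size_map.
    - by rewrite -map_comp.
    - by move=> y; rewrite (mult_op_cancel a b) !h mulr0 subr0.
    - exact: map_f.
  have ptq : forall y, a * y * (b + q) = 0.
    by move=> y; rewrite mulrDr -eqs -(h y) mult_op_cons.
  have [//|bq] := Rprime ptq.
  by apply: bn; move/eqP: bq; rewrite addr_eq0 => /eqP ->; apply: in_spanN.
move=> z; rewrite inE => /predU1P[->//|zs].
apply: (IH s) => // y; have := h y.
by rewrite mult_op_cons /= a0 !mul0r add0r.
Qed.

(** Comparison of coefficients.  A term of [u] whose right coefficient depends on
    those of [s] is absorbed in [s], at the cost of multiples of its left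
    coefficient; otherwise it is moved to the side of [s]. *)
Lemma mult_op_in_span u s : free_seq (map snd s) ->
  (forall y, mult_op s y = mult_op u y) ->
  forall z, z \in s -> in_span (map fst u) z.1.
Proof.
elim: u s => [|[a r] u IH] s fs h z zs /=.
  by apply: mult_op_eq0 zs => // y; rewrite h mult_op_nil.
have [hr|hr] := pselect (in_span (map snd s) r); last first.
  exists 0; rewrite scale0r subr0.
  apply: (IH ((- a, r) :: s)); last by rewrite inE zs orbT.
    by split.
  by move=> y; rewrite mult_op_cons h mult_op_cons /= !mulNr addKr.
have [s' [eqs sum mem _]] := tensor_absorb (- a) hr.
have [z' z's' [c hz]] := mem z zs.
exists c; have -> : z.1 - c *: a = z'.1 by rewrite hz scalerN addrC.
apply: (IH s') => //; first by rewrite eqs.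
move=> y; have := sum R (fun a b => a * y * b) (mult_op_bilinear y).
rewrite -!/(mult_op _ y) => ->.
by rewrite h mult_op_cons /= !mulNr addrC addKr.
Qed.

Definition finite_rank (f : R -> R) := exists u, forall x, in_span u (f x).

(** Cancelling a term of an operator of finite rank leaves an operator of finite
    rank with fewer terms.  If all the operators obtained in this way vanish, the
    left coefficients are proportional. *)
Lemma finite_rank_elementary s : free_seq (map snd s) ->
  finite_rank (mult_op s) -> (exists x, mult_op s x <> 0) ->
  exists a b, [/\ a <> 0, b <> 0 & finite_rank (fun x => a * x * b)].
Proof.
move: {2}(size s) (leqnn (size s)) => n; elim: n s => [|n IH] [|[a b] s] //= sz.
- by move=> _ _ [x]; rewrite mult_op_nil.
- by move=> _ _ [x]; rewrite mult_op_nil.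
move=> [bn fs] [u hu] [x0 hx0].
have [a0|an0] := pselect (a = 0).
  have eqs x : mult_op ((a, b) :: s) x = mult_op s x.
    by rewrite mult_op_cons /= a0 !mul0r add0r.
  apply: (IH s) => //; last by exists x0; rewrite -eqs.
  by exists u => x; rewrite -eqs.
pose s' w := [seq (a * w * z.1 - z.1 * w * a, z.2) | z <- s].
have [[w [y hy]]|no] := pselect (exists w y, mult_op (s' w) y <> 0).
  apply: (IH (s' w)); [by rewrite size_map|by rewrite -map_comp| |by exists y].
  exists (map (fun x => a * w * x) u ++ u) => x.
  rewrite (mult_op_cancel a b); apply: in_spanB; last exact: in_span_catr.
  apply/in_span_catl/in_span_map => // c p q.
  by rewrite mulrDr -scalerAr.
have [z zs|q [qs eqs]] := @mult_op_propl C R a s.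
  apply: (Rclosed an0) => w; apply/eqP; rewrite -subr_eq0; apply/eqP.
  apply: (@mult_op_eq0 (s' w) _ _ (a * w * z.1 - z.1 * w * a, z.2)).
  - by rewrite -map_comp.
  - by move=> y; apply: contrapT => hy; apply: no; exists w, y.
  - exact: map_f.
have eq x : mult_op ((a, b) :: s) x = a * x * (b + q).
  by rewrite mult_op_cons eqs mulrDr.
exists a, (b + q); split=> //; last by exists u => x; rewrite -eq.
by move=> bq0; apply: hx0; rewrite eq bq0 mulr0.
Qed.

End Closed.

(** * From a polynomial identity to an operator of finite rank *)

Definition word_val (R : nzRingType) (I : Type) (X : I -> R) (w : seq I) : R :=
  \prod_(k <- w) X k.

Definition poly_val (C : fieldType) (R : algType C) (I : Type) (X : I -> R)
    (f : seq (C * seq I)) : R :=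
  \sum_(m <- f) m.1 *: word_val X m.2.

Definition multilinear (C : fieldType) (n : nat) (f : seq (C * seq nat)) :=
  [/\ forall m, m \in f -> perm_eq m.2 (iota 0 n),
      forall m, m \in f -> m.1 != 0 & uniq (map snd f)].

Lemma eq_word_val (R : nzRingType) (I : eqType) (X Y : I -> R) w :
  {in w, X =1 Y} -> word_val X w = word_val Y w.
Proof. by move=> h; apply: eq_big_seq. Qed.

Lemma index_sorted_eq (w1 w2 : seq nat) : perm_eq w1 w2 -> uniq w2 ->
  (forall i j, i \in w1 -> j \in w1 -> (index i w1 < index j w1)%N ->
    (index i w2 <= index j w2)%N) -> w1 = w2.
Proof.
move=> p12 u2 h.
have u1 : uniq w1 by rewrite (perm_uniq p12).
have mem12 := perm_mem p12.
pose r := map (fun i => index i w2).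
have e2 : sorted leq (r w2).
  apply/(sortedP 0%N) => i; rewrite size_map => lt.
  by rewrite !(nth_map 0%N) ?(ltnW lt) // !index_uniq // (ltnW lt).
have e1 : sorted leq (r w1).
  apply/(sortedP 0%N) => i; rewrite size_map => lt.
  rewrite !(nth_map 0%N) ?(ltnW lt) //; apply: h.
  - by rewrite mem_nth // ltnW.
  - exact: mem_nth.
  - by rewrite !index_uniq // (ltnW lt).
have er : r w1 = r w2.
  by apply: (sorted_eq leq_trans anti_leq e1 e2); apply: perm_map.
have rK (w : seq nat) : {subset w <= w2} -> map (nth 0%N w2) (r w) = w.
  move=> sw; rewrite -map_comp -[RHS]map_id; apply/eq_in_map => i iw /=.
  by rewrite nth_index // sw.
by rewrite -(rK w1) ?er ?rK // => i; rewrite mem12.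
Qed.

Lemma index_split (w : seq nat) i j : uniq w -> i \in w -> j \in w ->
  (index i w < index j w)%N -> exists u v t, w = u ++ i :: v ++ j :: t.
Proof.
move=> uw iw; case/splitPr: iw uw => u v uw jw lt.
have jv : j \in v.
  move: jw; rewrite mem_cat inE => /or3P[ju|/eqP e|//]; move: lt.
    rewrite !index_cat ju; have -> : i \in u = false.
      by move: uw; rewrite cat_uniq /= => /and3P[_ /norP[/negPf-> _] _].
    by rewrite /= eqxx addn0 ltnNge index_size.
  by rewrite e ltnn.
by case/splitPr: jv => v' t; exists u, v', t.
Qed.

Section PolyVal.
Variables (C : fieldType) (R : algType C).
Implicit Types (f : seq (C * seq nat)) (X Y : nat -> R).

Lemma poly_val_cons (I : Type) (Z : I -> R) m (f : seq (C * seq I)) :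
  poly_val Z (m :: f) = m.1 *: word_val Z m.2 + poly_val Z f.
Proof. exact: big_cons. Qed.

Lemma poly_val_filter (I : Type) (Z : I -> R) (b : pred (C * seq I)) g :
  poly_val Z g = poly_val Z (filter b g) + poly_val Z (filter (predC b) g).
Proof.
by rewrite /poly_val !big_filter (bigID b).
Qed.

Lemma multilinear_filter n f (b : pred (C * seq nat)) :
  multilinear n f -> multilinear n (filter b f).
Proof.
move=> [h1 h2 h3]; split=> [m|m|].
- by rewrite mem_filter => /andP[_ /h1].
- by rewrite mem_filter => /andP[_ /h2].
- apply: subseq_uniq h3; apply: map_subseq; exact: filter_subseq.
Qed.

(** A word containing [i] before [j] once each is of the form
    [a x b y c] in the values [x], [y] of these two letters. *)
Lemma poly_val_two_letters f X i j :
  (forall m, m \in f -> [/\ uniq m.2, i \in m.2, j \in m.2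
    & (index i m.2 < index j m.2)%N]) ->
  exists L : seq (R * R * R), forall Y,
    (forall k, k != i -> k != j -> Y k = X k) ->
    poly_val Y f = \sum_(l <- L) l.1.1 * Y i * l.1.2 * Y j * l.2.
Proof.
elim: f => [|[c w] f IH] hf; first by exists [::] => Y _; rewrite /poly_val !big_nil.
have [|L hL] := IH; first by move=> m mf; apply: hf; rewrite inE mf orbT.
have [/= uw iw jw lt] := hf (c, w) (mem_head _ _).
have [u [v [t ew]]] := index_split uw iw jw lt.
exists ((c *: word_val X u, word_val X v, word_val X t) :: L) => Y hY.
rewrite poly_val_cons big_cons hL //=; congr (_ + _).
have out (s : seq nat) : i \notin s -> j \notin s -> word_val X s = word_val Y s.
  move=> si sj; apply: eq_word_val => k ks; rewrite hY //.
    by apply: contraNneq si => <-.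
  by apply: contraNneq sj => <-.
move: uw; rewrite ew cat_uniq /= cat_uniq /= has_cat /= !mem_cat !inE !negb_or.
move=> /and5P[_ /and4P[iu vu ju tu] /and3P[iv ij it] _ /andP[jvt /andP[jt _]]].
move: jvt => /andP[jv _].
rewrite !out // /word_val !big_cat /= !big_cons !big_cat /= !big_cons.
by rewrite -!scalerAl !mulrA.
Qed.

End PolyVal.

Section PIFiniteRank.
Variables (C : fieldType) (R : algType C).
Hypotheses (Rprime : prime_ring R) (Rclosed : centrally_closed R).

(** Amitsur's and Martindale's method: in a multilinear identity with a minimal
    number of monomials, the part [G(x, y)] in which a letter [x] precedes a
    letter [y] is not an identity.  Since it equals the opposite of the part
    where [y] precedes [x], comparing the coefficients to the left of [y] shows
    that the operators of [x] occurring in [G] have finite rank. *)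
Lemma PI_finite_rank n (f : seq (C * seq nat)) : f != [::] -> multilinear n f ->
  (forall X : nat -> R, poly_val X f = 0) ->
  exists s : seq (R * R), [/\ free_seq (map snd s), finite_rank (mult_op s)
    & exists x, mult_op s x <> 0].
Proof.
move: {2}(size f) (leqnn (size f)) => N; elim: N f => [|N IH] [|m1 f] //= sz _ mf fid.
case: f => [|m2 f] in sz mf fid *.
  have [_ /(_ m1 (mem_head _ _)) c0 _] := mf.
  have := fid (fun=> 1); rewrite poly_val_cons /poly_val big_nil addr0.
  rewrite /word_val big1 // => /eqP; rewrite scaler_eq0 (negPf c0) /=.
  by rewrite oner_eq0.
have [perm coef uniqf] := mf.
set F := [:: m1, m2 & f] in perm coef mf fid uniqf *.
have m1F : m1 \in F by rewrite inE eqxx.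
have m2F : m2 \in F by rewrite !inE eqxx orbT.
have uF m : m \in F -> uniq m.2 by move=> /perm /perm_uniq ->; apply: iota_uniq.
have [i [j [[iF jF] lt1 lt2]]] : exists i j, [/\ i \in m1.2 /\ j \in m1.2,
    (index i m1.2 < index j m1.2)%N & (index j m2.2 < index i m2.2)%N].
  apply: contrapT => no; move: uniqf => /= /and3P[+ _ _].
  rewrite inE negb_or => /andP[/eqP neq _]; apply: neq.
  apply: index_sorted_eq; [|exact: uF|].
    by rewrite (perm_trans (perm _ m1F)) // perm_sym perm.
  move=> i j im jm lt; rewrite leqNgt; apply/negP => lt2; apply: no.
  by exists i, j.
have nij : i != j by apply: contraTneq lt1 => ->; rewrite ltnn.
have inF k : k \in m1.2 -> forall m, m \in F -> k \in m.2.
  move=> km m mF; move: km; rewrite (perm_mem (perm _ m1F)).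
  by rewrite (perm_mem (perm _ mF)).
pose b (m : C * seq nat) := (index i m.2 < index j m.2)%N.
have [f1id|nid] := pselect (forall X : nat -> R, poly_val X (filter b F) = 0).
  apply: (IH (filter b F)) => //; last exact: multilinear_filter.
    rewrite -ltnS (leq_trans _ sz) // ltnS /F /= {1}/b lt1 {1}/b.
    by rewrite ltnNge (ltnW lt2) /= ltnS size_filter count_size.
  by rewrite /F /= {1}/b lt1.
have [X hX] : exists X : nat -> R, poly_val X (filter b F) <> 0.
  by apply: contrapT => no; apply: nid => X; apply: contrapT => h; apply: no; exists X.
have [|L1 hL1] := @poly_val_two_letters C R (filter b F) X i j.
  move=> m; rewrite mem_filter => /andP[lt mF].
  by split=> //; [exact: uF|exact: inF mF|exact: inF mF].
have [|L2 hL2] := @poly_val_two_letters C R (filter (predC b) F) X j i.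
  move=> m; rewrite mem_filter /= -leqNgt => /andP[le mF]; split.
  - exact: uF.
  - exact: inF mF.
  - exact: inF mF.
  - rewrite ltn_neqAle le andbT; apply: contraNneq nij => e.
    by rewrite -(nth_index 0%N (inF _ iF _ mF)) -e nth_index // inF.
have swap x y : \sum_(l <- L1) l.1.1 * x * l.1.2 * y * l.2 =
    mult_op [seq (- l.1.1, l.1.2 * x * l.2) | l <- L2] y.
  pose Y k := if k == i then x else if k == j then y else X k.
  have Yi : Y i = x by rewrite /Y eqxx.
  have Yj : Y j = y by rewrite /Y (negPf (_ : j != i)) ?eqxx // eq_sym.
  have hY k : k != i -> k != j -> Y k = X k by rewrite /Y => /negPf-> /negPf->.
  have := fid Y; rewrite (poly_val_filter Y b) (hL1 Y hY).
  rewrite (hL2 Y (fun k kj ki => hY k ki kj)) Yi Yj => /eqP.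
  rewrite addr_eq0 => /eqP ->; rewrite /mult_op big_map -sumrN.
  by apply: eq_bigr => l _ /=; rewrite !mulNr !mulrA.
pose G (x y : R) (p : R -> R) (t : R) : R := p x * y * t.
have bG x y : bilinear_map (G x y).
  by have [h1 h2] := mult_op_bilinear y; split=> [v c p q|p]; [exact: h1|exact: h2].
pose S1 : seq ((R -> R) * R) := [seq (fun x => l.1.1 * x * l.1.2, l.2) | l <- L1].
have [S [fS eS opS]] := tensor_free S1.
have eqS x y : \sum_(z <- S) z.1 x * y * z.2 =
    \sum_(l <- L1) l.1.1 * x * l.1.2 * y * l.2.
  by rewrite (eS R (G x y) (bG x y)) big_map.
have {}opS z : z \in S -> exists o, forall x, z.1 x = mult_op o x.
  apply: (opS [set p : R -> R | exists o, forall x, p x = mult_op o x]).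
    split; first by exists [::] => x; rewrite mult_op_nil.
    move=> c p q [o ho] [o' ho']; exists ([seq (c *: z.1, z.2) | z <- o] ++ o') => x.
    rewrite mult_op_cat -ho' /mult_op big_map; congr (_ + _).
    rewrite [LHS](_ : _ = c *: p x) // ho /mult_op scaler_sumr.
    by apply: eq_bigr => u _ /=; rewrite !scalerAl.
  move=> _ /mapP[l _ ->] /=; exists [:: (l.1.1, l.1.2)] => x.
  by rewrite mult_op_cons mult_op_nil addr0.
have [[[p t] zS [x0 nz]]|no] := pselect (exists2 z, z \in S & exists x, z.1 x <> 0); last first.
  case: hX; rewrite (hL1 X) // -eqS big_seq big1 // => z zS.
  rewrite [z.1 _](_ : _ = 0) ?mul0r //.
  by apply: contrapT => h; apply: no; exists z => //; exists (X i).
have [o /= ho] := opS _ zS.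
have [o' [fo' eo' _]] := tensor_free o.
have {}eo' x : mult_op o' x = p x.
  by rewrite ho; apply: (eo' R (fun a b => a * x * b) (mult_op_bilinear x)).
exists o'; split=> //; last by exists x0; rewrite eo'.
exists (map fst [seq (- l.1.1, 0 : R) | l <- L2]) => x; rewrite eo'.
pose Sx : seq (R * R) := [seq (z.1 x, z.2) | z <- S].
have -> : map fst [seq (- l.1.1, 0 : R) | l <- L2] =
    map fst [seq (- l.1.1, l.1.2 * x * l.2) | l <- L2].
  by rewrite -!map_comp.
apply: (mult_op_in_span Rprime Rclosed (s := Sx) _ _ (z := (p x, t))).
- by rewrite -map_comp.
- by move=> y; rewrite -swap -eqS /mult_op big_map.
- exact: (map_f (fun z : (R -> R) * R => (z.1 x, z.2)) zS).
Qed.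
End PIFiniteRank.

(** * Centrally closed prime PI algebras are finite dimensional *)

Section FinDim.
Variables (C : fieldType) (R : algType C).
Hypothesis Rprime : prime_ring R.

Lemma prime_neq0 (a b : R) : a <> 0 -> b <> 0 -> exists x, a * x * b <> 0.
Proof.
move=> an0 bn0; apply: contrapT => no; have [x|//|//] := Rprime (a := a) (b := b).
by apply: contrapT => h; apply: no; exists x.
Qed.

(** [c R c] is finite dimensional but [c R] is not, so the elements of [c R]
    killing finitely many given elements of [R c] on their left never run out.
    This produces long sequences in which no order of multiplication other than
    the increasing one survives, as for the matrix units [E_{i,i+1}]. *)
Lemma staircase (c : R) : c <> 0 -> finite_rank (fun x => c * x * c) ->
  ~ fin_dim [set c * x | x in [set: R]] ->
  forall m, exists l : seq R, [/\ size l = m, \prod_(x <- l) x <> 0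
    & forall i k, (i < k)%N -> l`_k * l`_i = 0].
Proof.
move=> c0 [u hu] nfd m.
pose X := [set c * x | x in [set: R]].
have sX : subspace X.
  split; first by exists 0; rewrite ?mulr0.
  by move=> a _ _ [x _ <-] [y _ <-]; exists (a *: x + y); rewrite // mulrDr scalerAr.
have kill (ys : seq R) : (forall y, y \in ys -> exists s, y = s * c) ->
    exists2 x, c * x <> 0 & forall y, y \in ys -> c * x * y = 0.
  move=> hys; pose Y := [set q | X q /\ forall y, y \in ys -> q * y = 0].
  suff [_ nY] : subspace Y /\ ~ fin_dim Y.
    have [q [[x _ <-] hq] q0] : exists2 q, Y q & q <> 0.
      apply: contrapT => no; apply: nY; exists [::] => q Yq /=.
      by apply: contrapT => q0; apply: no; exists q.
    by exists x.
  elim: ys hys @Y => [|y ys IH] hys Y.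
    by rewrite (_ : Y = X) //; apply/seteqP; split=> [q []//|q Xq]; split.
  have [|sY' nY'] := IH; first by move=> z zs; apply: hys; rewrite inE zs orbT.
  have [s ey] := hys y (mem_head _ _).
  have := @inf_dim_ker C R R _ (fun q => q * y) u sY' nY'.
  rewrite (_ : [set q | _ /\ q * y = 0] = Y).
    move=> h; refine (h _ _); first by move=> a p q; rewrite mulrDl scalerAl.
    by move=> q [[x _ <-] _]; rewrite ey mulrA -(mulrA c); apply: hu.
  apply/seteqP; split=> q [].
    by move=> [Xq hq] qy; split=> // z; rewrite inE => /predU1P[->//|/hq].
  move=> Xq hq; split; last by apply: hq; rewrite inE eqxx.
  by split=> // z zs; apply: hq; rewrite inE zs orbT.
have : exists l ys : seq R, [/\ size l = m,
    forall y, y \in ys -> exists s, y = s * c,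
    exists2 y, y \in ys & \prod_(x <- l) x * y <> 0,
    forall E, E \in l -> exists2 y, y \in ys & exists r, E = y * r
    & forall i k, (i < k)%N -> l`_k * l`_i = 0]; last first.
  move=> [l [ys [sl _ [y _ py] _ hl]]]; exists l; split=> // p0; apply: py.
  by rewrite p0 mul0r.
elim: m => [|m [l [ys [sl hys [y yys py] hE hl]]]].
  exists [::], [:: c]; split=> //.
  - by move=> y; rewrite inE => /eqP ->; exists 1; rewrite mul1r.
  - by exists c; rewrite ?mem_head // big_nil mul1r.
  - by move=> i k _; rewrite nth_nil mul0r.
have [x cx kx] := kill ys hys.
have [r pr] := prime_neq0 py cx.
have [s ps] := prime_neq0 pr c0.
exists (rcons l (y * r * (c * x))), (s * c :: ys); split.
- by rewrite size_rcons sl.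
- by move=> z; rewrite inE => /predU1P[->|/hys//]; exists s.
- exists (s * c); rewrite ?mem_head // -cats1 big_cat big_seq1 /=.
  by move: ps; rewrite !mulrA.
- move=> E; rewrite mem_rcons inE => /predU1P[->|/hE[z zys hz]].
    by exists y; rewrite ?inE ?yys ?orbT //; exists (r * (c * x)); rewrite !mulrA.
  by exists z => //; rewrite inE zys orbT.
move=> i k ik; rewrite !nth_rcons.
have [km|mk|ek] := ltngtP k (size l).
- by rewrite (ltn_trans ik km) hl.
- by rewrite mul0r.
have im : (i < size l)%N by rewrite -ek.
rewrite im.
have [z zys [r' ->]] := hE _ (mem_nth 0 im).
by rewrite mulrA -(mulrA _ _ z) kx // mulr0 mul0r.
Qed.

(** A descent, that is [k] followed by a smaller [i], kills the product. *)
Lemma prod_sorted (l : seq R) : (forall i k, (i < k)%N -> l`_k * l`_i = 0) ->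
  forall v : seq nat, \prod_(k <- v) l`_k <> 0 -> sorted leq v.
Proof.
move=> hl; elim=> //= a [|b v] IH //= h.
have [le|lt] := leqP a b; last first.
  by case: h; rewrite !big_cons mulrA hl // mul0r.
by apply: IH => h0; apply: h; rewrite big_cons h0 mulr0.
Qed.

(** On a staircase a multilinear polynomial takes the value of the single
    monomial in which the letters come in increasing order. *)
Lemma multilinear_not_staircase n (f : seq (C * seq nat)) (l : seq R) :
  f != [::] -> multilinear n f -> (forall X : nat -> R, poly_val X f = 0) ->
  size l = n -> \prod_(x <- l) x <> 0 ->
  ~ forall i k, (i < k)%N -> l`_k * l`_i = 0.
Proof.
case: f => [|[a w] f] //= _ [perm coef uniqf] fid sl pl hl.
have pw := perm (a, w) (mem_head _ _); rewrite /= in pw.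
have uw : uniq w by rewrite (perm_uniq pw) iota_uniq.
have sw : size w = n by rewrite (perm_size pw) size_iota.
pose X k := l`_(index k w).
have valE (v : seq nat) : word_val X v = \prod_(k <- map (index^~ w) v) l`_k.
  by rewrite big_map.
have := fid X; rewrite poly_val_cons [poly_val _ _]big_seq big1 ?addr0 => [|[b v] vf].
  move/eqP; rewrite scaler_eq0 (negPf (coef (a, w) (mem_head _ _))) /= => /eqP.
  rewrite valE; have -> : map (index^~ w) w = iota 0 n.
    apply: (@eq_from_nth _ 0%N); rewrite ?size_map ?size_iota // sw => i lt.
    by rewrite (nth_map 0%N) ?sw // nth_iota // index_uniq // sw.
  by move=> h; apply: pl; rewrite (big_nth 0) sl /index_iota subn0.
rewrite /= [word_val _ _](_ : _ = 0) ?scaler0 //; rewrite valE.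
apply: contrapT => /(prod_sorted hl) sv.
have pv := perm (b, v); rewrite inE vf orbT /= in pv.
have ev : v = w.
  apply: index_sorted_eq => // [|i j iv jv lt].
    by rewrite (perm_trans (pv isT)) // perm_sym.
  have := sorted_leq_nth leq_trans leqnn 0%N sv.
  move=> /(_ (index i v) (index j v)); rewrite !inE !size_map !index_mem.
  move=> /(_ iv jv (ltnW lt)); rewrite !(nth_map 0%N) ?index_mem //.
  by rewrite !nth_index.
move: uniqf => /= /andP[+ _]; rewrite -ev => /mapP; apply.
by exists (b, v).
Qed.
End FinDim.

Section FinDimClosed.
Variables (C : fieldType) (R : algType C).
Hypotheses (Rprime : prime_ring R) (Rclosed : centrally_closed R).

(** An operator [x |-> a x b] of finite rank yields [c] with [c R c] finite
    dimensional.  Staircases being excluded by the identity, [c R] is then finite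
    dimensional, and [R] acts faithfully on it by right multiplication. *)
Theorem PI_fin_dim n (f : seq (C * seq nat)) : f != [::] -> multilinear n f ->
  (forall X : nat -> R, poly_val X f = 0) -> fin_dim [set: R].
Proof.
move=> fn0 mf fid.
have [s [fs rs ns]] := PI_finite_rank Rprime Rclosed fn0 mf fid.
have [a [b [a0 b0 [u hu]]]] := finite_rank_elementary Rprime Rclosed fs rs ns.
have [r c0] := prime_neq0 Rprime b0 a0.
set c := b * r * a in c0.
have cRc : finite_rank (fun x => c * x * c).
  exists (map (fun z => b * r * z * (r * a)) u) => x.
  have -> : c * x * c = b * r * (a * x * b) * (r * a) by rewrite /c !mulrA.
  apply: (@in_span_map _ _ _ (fun z => b * r * z * (r * a))) => //.
  by move=> k p q; rewrite mulrDr mulrDl -scalerAr -scalerAl.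
have [cR|ncR] := pselect (fin_dim [set c * x | x in [set: R]]); last first.
  have [l [sl pl hl]] := staircase Rprime c0 cRc ncR n.
  by case: (multilinear_not_staircase fn0 mf fid sl pl).
have scR : subspace [set c * x | x in [set: R]].
  split; first by exists 0; rewrite ?mulr0.
  by move=> k _ _ [x _ <-] [y _ <-]; exists (k *: x + y); rewrite // mulrDr scalerAr.
have [v [vX gv]] := fin_dim_gen scR cR.
apply: contrapT => nR.
(* An element of [R] is determined by its action on the finitely many
   generators [v] of [c R]. *)
have [_ nK] : let K := [set q : R | forall x, x \in v -> x * q = 0] in
    subspace K /\ ~ fin_dim K.
  elim: v vX {gv} => [|x v IH] vX K.
    rewrite (_ : K = [set: R]); first by split.
    by apply/seteqP; split.
  have [|sK nK] := IH; first by move=> z zv; apply: vX; rewrite inE zv orbT.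
  have [w hw] := cR.
  have [y _ ey] := vX x (mem_head _ _).
  have := @inf_dim_ker C R R _ (fun q => x * q) w sK nK.
  rewrite (_ : [set q | _ /\ x * q = 0] = K).
    move=> h; refine (h _ _); first by move=> k p q; rewrite mulrDr scalerAr.
    by move=> q _; apply: hw; exists (y * q); rewrite // mulrA ey.
  apply/seteqP; split=> q.
    by move=> [hq xq] z; rewrite inE => /predU1P[->//|/hq].
  move=> hq; split=> [z zv|]; apply: hq; rewrite inE ?zv ?orbT ?eqxx //.
apply: nK; exists [::] => q hq /=; have [x|//|//] := Rprime (a := c) (b := q).
have [k ->] := in_span_nth (gv (c * x) (ex_intro2 _ _ x I erefl)).
rewrite mulr_suml big1 // => i _; rewrite -scalerAl hq ?scaler0 //.
exact: mem_nth.
Qed.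
End FinDimClosed.

(** * Multiplication operators and traces in finite dimension *)

Lemma fin_dim_basis (C : fieldType) (V : lmodType C) : fin_dim [set: V] ->
  exists (u : seq V) (co : V -> 'rV[C]_(size u)), [/\ free_seq u,
    forall q, q = \sum_i co q 0 i *: u`_i
    & forall c : 'rV_(size u), co (\sum_i c 0 i *: u`_i) = c].
Proof.
move=> [s hs]; have [u [fu su]] := free_subseq s.
have /choice[co hco] : forall q, exists c : 'rV[C]_(size u),
    q = \sum_i c 0 i *: u`_i.
  move=> q; have [c ->] := in_span_nth (su _ (hs q I)).
  by exists (\row_i c i); apply: eq_bigr => i _; rewrite mxE.
exists u, co; split=> // c; apply/rowP => i.
set q := \sum_i c 0 i *: u`_i.
pose d (k : nat) := if insub k is Some j then co q 0 j - c 0 j else 0.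
have dE (j : 'I_(size u)) : d j = co q 0 j - c 0 j by rewrite /d valK.
have : d i = 0.
  apply: (free_seqP fu) => //; under eq_bigr do rewrite dE scalerBl.
  by rewrite sumrB -hco subrr.
by rewrite dE => /eqP; rewrite subr_eq0 => /eqP.
Qed.

Section RankOne.
Variables (C : fieldType) (R : algType C).
Hypotheses (Rprime : prime_ring R) (Rclosed : centrally_closed R).
Hypothesis Rfd : fin_dim [set: R].

Lemma basis_coord_linear (V : lmodType C) (u : seq V)
    (co : V -> 'rV[C]_(size u)) :
  (forall q, q = \sum_i co q 0 i *: u`_i) ->
  (forall c : 'rV_(size u), co (\sum_i c 0 i *: u`_i) = c) -> linear co.
Proof.
move=> coK Kco a x y; rewrite {1}(coK x) {1}(coK y) scaler_sumr -big_split /=.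
rewrite -[RHS]Kco; congr co; apply: eq_bigr => i _.
by rewrite !mxE scalerDl scalerA.
Qed.

(** The multiplication operators [x |-> e_i x e_j] attached to a basis are
    linearly independent and there are as many of them as the dimension of the
    space of linear endomorphisms; so every endomorphism is a multiplication
    operator, in particular any one of the form [x |-> l(x) 1]. *)
Lemma scalar_valued_op (r : R) : r <> 0 ->
  exists s : seq (R * R), (forall x, exists c : C, mult_op s x = c%:A) /\
    mult_op s r = 1.
Proof.
move=> rn0; have [u [co [fu coK Kco]]] := fin_dim_basis Rfd.
have co_lin := basis_coord_linear coK Kco.
set d := size u in co coK Kco co_lin.
pose S (g : 'M[C]_d) : seq (R * R) :=
  [seq (\sum_i g i j *: u`_i, u`_j) | j <- enum 'I_d].
have S_lin x : linear (fun g => mult_op (S g) x).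
  move=> a g h; rewrite /mult_op !big_map scaler_sumr -big_split /=.
  apply: eq_bigr => j _; rewrite !scalerAl -!mulrDl scaler_sumr -big_split /=.
  by congr (_ * _ * _); apply: eq_bigr => i _; rewrite !mxE scalerDl scalerA.
pose Phi g : 'M[C]_d := \matrix_(i, j) co (mult_op (S g) u`_i) 0 j.
have Phi_lin : linear Phi.
  by move=> a g h; apply/matrixP => i j; rewrite !mxE S_lin co_lin !mxE.
have opE (g h : 'M[C]_d) (o : R -> R) : linear o ->
    (forall i : 'I_d, mult_op (S g) u`_i = o u`_i) -> forall x, mult_op (S g) x = o x.
  move=> lo eg x; rewrite (coK x).
  have lin_sum (f : R -> R) : linear f -> f (\sum_i co x 0 i *: u`_i) =
      \sum_i co x 0 i *: f u`_i.
    move=> lf; pose F := GRing.isLinear.Build _ _ _ _ f lf.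
    pose f' : {linear R -> R} := HB.pack f F.
    by rewrite -[f]/(f' : R -> R) linear_sum; apply: eq_bigr => i _; rewrite linearZ.
  rewrite !lin_sum //; last exact: mult_op_linear.
  by apply: eq_bigr => i _; rewrite eg.
have Phi_inj : injective Phi.
  move=> g h eqPhi; apply/eqP; rewrite -subr_eq0; apply/eqP.
  set k := g - h; have Phik : Phi k = 0.
    by rewrite /k addrC -scaleN1r Phi_lin eqPhi scaleN1r addNr.
  have opk0 x : mult_op (S k) x = 0.
    apply: (opE k 0 (fun=> 0)) => [a p q|i]; first by rewrite scaler0 addr0.
    rewrite (coK (mult_op _ _)) big1 // => j _.
    by have /matrixP/(_ i j) := Phik; rewrite !mxE => ->; rewrite scale0r.
  have fS : free_seq (map snd (S k)).
    rewrite -map_comp (_ : map _ _ = u) //.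
    rewrite -[RHS](mkseq_nth 0) /mkseq -(val_enum_ord d) -map_comp.
    exact: eq_map.
  have mem j : j \in enum 'I_d -> \sum_i k i j *: u`_i = 0.
    move=> jd; apply: (mult_op_eq0 Rprime Rclosed fS opk0 (z := (_, u`_j))).
    exact: (map_f (fun j : 'I_d => (\sum_i k i j *: u`_i, u`_j))).
  apply/matrixP => i j; rewrite mxE.
  have := Kco (\row_i k i j); under eq_bigr do rewrite mxE.
  rewrite mem ?mem_enum // (linear_at0 co_lin) => /rowP/(_ i).
  by rewrite !mxE.
have Phi_surj M : exists g, Phi g = M.
  pose F := GRing.isLinear.Build _ _ _ _ Phi Phi_lin.
  pose P : {linear 'M[C]_d -> 'M[C]_d} := HB.pack Phi F.
  pose L := linfun P.
  have LE g : L g = Phi g by rewrite lfunE.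
  have /lker0_compfV/lfunP/(_ M) : lker L == 0%VS.
    by apply/lker0P => g h; rewrite !LE; apply: Phi_inj.
  by rewrite comp_lfunE id_lfunE LE => h; exists ((L^-1)%VF M).
have [i0 ri0] : exists i, co r 0 i != 0.
  apply: contrapT => no; apply: rn0; rewrite (coK r) big1 // => i _.
  have [->|h] := eqVneq (co r 0 i) 0; first by rewrite scale0r.
  by case: no; exists i.
pose o x := (co x 0 i0 / co r 0 i0) *: (1 : R).
have o_lin : linear o.
  by move=> a x y; rewrite /o co_lin !mxE scalerA mulrDl mulrA scalerDl.
have [g hg] := Phi_surj (\matrix_(i, j) co (o u`_i) 0 j).
have SgE : forall x, mult_op (S g) x = o x.
  apply: (opE g 0 o o_lin) => i; rewrite (coK (mult_op _ _)) (coK (o _)).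
  apply: eq_bigr => j _; congr (_ *: _).
  by move/matrixP/(_ i j): hg; rewrite !mxE.
exists (S g); split; first by move=> x; rewrite SgE; eexists.
by rewrite SgE /o divff // scale1r.
Qed.

(** The trace of the regular representation vanishes on commutators, and takes
    the nonzero value [dim R] at [1]. *)
Lemma one_not_commutators (s : seq (R * R)) : [pchar C] =i pred0 ->
  1 <> \sum_(z <- s) (z.1 * z.2 - z.2 * z.1).
Proof.
move=> /pcharf0P charC one; have [u [co [fu coK Kco]]] := fin_dim_basis Rfd.
have co_lin := basis_coord_linear coK Kco.
set d := size u in co coK Kco co_lin.
pose cF := GRing.isLinear.Build _ _ _ _ co co_lin.
pose co' : {linear R -> 'rV[C]_d} := HB.pack co cF.
have co'E x : co x = co' x by [].
pose rho x : 'M[C]_d := \matrix_(i, j) co (u`_i * x) 0 j.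
have rhoM x y : rho (x * y) = rho x *m rho y.
  apply/matrixP => i j; rewrite !mxE mulrA {1}(coK (u`_i * x)) mulr_suml.
  rewrite co'E linear_sum summxE; apply: eq_bigr => k _.
  by rewrite -scalerAl linearZ !mxE.
have rhoB x y : rho (x - y) = rho x - rho y.
  by apply/matrixP => i j; rewrite !mxE mulrBr !co'E linearB !mxE.
have rhoD x y : rho (x + y) = rho x + rho y.
  by apply/matrixP => i j; rewrite !mxE mulrDr !co'E linearD !mxE.
have rho0 : rho 0 = 0 by rewrite -(subrr 0) rhoB subrr.
have rho1 : rho 1 = 1%:M.
  apply/matrixP => i j; rewrite !mxE mulr1.
  have := Kco (delta_mx 0 i); rewrite (bigD1 i) //= !mxE !eqxx scale1r.
  rewrite big1 ?addr0 => [->|k /negPf ki]; last by rewrite !mxE ki andbF scale0r.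
  by rewrite !mxE eq_sym.
have tr_comm : \tr (rho (\sum_(z <- s) (z.1 * z.2 - z.2 * z.1))) = 0.
  elim: s {one} => [|z s IH]; first by rewrite big_nil rho0 mxtrace0.
  by rewrite big_cons rhoD mxtraceD IH addr0 rhoB !rhoM raddfB /= mxtrace_mulC subrr.
move: tr_comm; rewrite -one rho1 mxtrace1 => /eqP; rewrite charC => /eqP d0.
have : (1 : R) = 0.
  by rewrite (coK 1) big1 // => i _; have := ltn_ord i; rewrite [X in (_ < X)%N]d0.
by move/eqP; rewrite oner_eq0.
Qed.

End RankOne.

(** * Ideals of a prime algebra without identity *)

Section LinSpan.
Variables (K : fieldType) (V : lmodType K).

Lemma lin_span_gen (S : set V) x : S x -> lin_span S x.
Proof.
move=> Sx; exists 1%N, (fun=> 1), (fun=> x); split=> //.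
by rewrite big_ord1 scale1r.
Qed.

Lemma lin_span_subspace (S : set V) : subspace (lin_span S).
Proof.
split; first by exists 0%N, (fun=> 0), (fun=> 0); split=> [[]//|]; rewrite big_ord0.
move=> a _ _ [n [c [v [hv ->]]]] [m [d [w [hw ->]]]].
exists (n + m)%N, (fun i => match fintype.split i with inl i => a * c i | inr i => d i end),
  (fun i => match fintype.split i with inl i => v i | inr i => w i end); split.
  by move=> i; case: fintype.split.
rewrite big_split_ord scaler_sumr; congr (_ + _); apply: eq_bigr => i _.
  by rewrite (unsplitK (inl i)) scalerA.
by rewrite (unsplitK (inr i)).
Qed.

Lemma lin_span_min (S P : set V) : subspace P -> S `<=` P -> lin_span S `<=` P.
Proof.
move=> sP SP _ [n [c [v [hv ->]]]]; apply: (subspace_sum sP) => i _.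
exact/(subspaceZ sP)/SP/hv.
Qed.

End LinSpan.

Section AssocAlg.
Variables (F : fieldType) (A : assocAlgType F).
Implicit Types (a b c x y : A) (I J : set A).

Lemma amul0l a : amul 0 a = 0 :> A.
Proof. by apply: (addrI (amul 0 a)); rewrite -amulDl !addr0. Qed.

Lemma amul0r a : amul a 0 = 0 :> A.
Proof. by apply: (addrI (amul a 0)); rewrite -amulDr !addr0. Qed.

Lemma amulNl a b : amul (- a) b = - amul a b :> A.
Proof. by apply: (addrI (amul a b)); rewrite -amulDl !subrr amul0l. Qed.

Lemma amulNr a b : amul a (- b) = - amul a b :> A.
Proof. by apply: (addrI (amul a b)); rewrite -amulDr !subrr amul0r. Qed.

Lemma amulBl a b c : amul (a - b) c = amul a c - amul b c :> A.
Proof. by rewrite amulDl amulNl. Qed.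

Lemma amulBr a b c : amul a (b - c) = amul a b - amul a c :> A.
Proof. by rewrite amulDr amulNr. Qed.

Definition nz_ideal I := ideal I /\ exists2 x, I x & x <> 0.

Lemma ideal_subspace I : ideal I -> subspace I.
Proof. by move=> [I0 ID IZ _]; split=> // c x y Ix Iy; apply: ID => //; apply: IZ. Qed.

Lemma ideal_lin_span (S : set A) :
  (forall a x, S x -> S (amul a x) /\ S (amul x a)) -> ideal (lin_span S).
Proof.
move=> h; have sS := lin_span_subspace S; split.
- exact: sS.1.
- exact: subspaceD.
- exact: subspaceZ.
move=> a; apply: lin_span_min.
  split; first by rewrite amul0l amul0r; split; exact: sS.1.
  move=> c x y [ax xa] [ay ya]; rewrite amulDl amulDr amulZl amulZr.
  by split; apply: sS.2.
by move=> x /(h a)[? ?]; split; apply: lin_span_gen.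
Qed.

Lemma ideal_mul_ideal I J : ideal I -> ideal J -> ideal (ideal_mul I J).
Proof.
move=> [_ _ _ iI] [_ _ _ iJ]; apply: ideal_lin_span => a _ [x [y [Ix Jy ->]]].
split; [exists (amul a x), y|exists x, (amul y a)]; rewrite amulA; split=> //.
  by have [] := iI a x Ix.
by have [] := iJ a y Jy.
Qed.

Lemma ideal_mul_subl I J : ideal I -> ideal_mul I J `<=` I.
Proof.
move=> iI; apply: (lin_span_min (ideal_subspace iI)) => _ [x [y [Ix _ ->]]].
by case: iI => _ _ _ /(_ y x Ix)[].
Qed.

Lemma ideal_mul_subr I J : ideal J -> ideal_mul I J `<=` J.
Proof.
move=> iJ; apply: (lin_span_min (ideal_subspace iJ)) => _ [x [y [_ Jy ->]]].
by case: iJ => _ _ _ /(_ x y Jy)[].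
Qed.

Lemma ideal_neq0 I : I 0 -> I <> [set 0] -> exists2 x, I x & x <> 0.
Proof.
move=> I0 In0; apply: contrapT => no; apply: In0; apply/seteqP; split=> [x Ix|_ ->//].
by apply: contrapT => x0; apply: no; exists x.
Qed.

Hypothesis pA : prime_alg A.

Lemma ideal_eq0P I : nz_ideal I -> I <> [set 0].
Proof. by move=> [_ [x Ix x0]] I0; apply: x0; rewrite I0 in Ix. Qed.

Lemma nz_ideal_mul I J : nz_ideal I -> nz_ideal J -> nz_ideal (ideal_mul I J).
Proof.
move=> nI nJ; have iIJ := ideal_mul_ideal nI.1 nJ.1; split=> //.
have := pA nI.1 nJ.1 (ideal_eq0P nI) (ideal_eq0P nJ).
by apply: ideal_neq0; case: iIJ.
Qed.

Lemma nz_idealI I J : nz_ideal I -> nz_ideal J -> nz_ideal (I `&` J).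
Proof.
move=> nI nJ; have [_ [x xIJ x0]] := nz_ideal_mul nI nJ; split; last first.
  by exists x => //; split; [exact: ideal_mul_subl nI.1 _ xIJ|exact: ideal_mul_subr nJ.1 _ xIJ].
have [I0 ID IZ IM] := nI.1; have [J0 JD JZ JM] := nJ.1; split=> //.
- by move=> a b [Ia Ja] [Ib Jb]; split; [apply: ID|apply: JD].
- by move=> c a [Ia Ja]; split; [apply: IZ|apply: JZ].
- move=> a b [/(IM a)[? ?] /(JM a)[? ?]]; by split; split.
Qed.

(** The annihilator of [A] is an ideal of square zero. *)
Lemma annihilator_l a : (forall x, amul a x = 0) -> a = 0.
Proof.
move=> ha; apply: contrapT => a0.
pose N := [set a | forall x : A, amul a x = 0].
have iN : ideal N.
  split.
  - by move=> x; rewrite amul0l.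
  - by move=> x y hx hy z; rewrite amulDl hx hy addr0.
  - by move=> c x hx z; rewrite amulZl hx scaler0.
  - by move=> c x hx; split=> z; rewrite -amulA hx ?amul0r.
have nN : nz_ideal N by split=> //; exists a.
have [_ [x xNN x0]] := nz_ideal_mul nN nN; apply: x0.
have s0 : subspace [set (0 : A)] by split=> // c y z -> ->; rewrite scaler0 addr0.
by apply: (lin_span_min s0 _ xNN) => _ [y [z [hy _ ->]]]; apply: hy.
Qed.

Lemma annihilator_r a : (forall x, amul x a = 0) -> a = 0.
Proof.
move=> ha; apply: contrapT => a0.
pose N := [set a | forall x : A, amul x a = 0].
have iN : ideal N.
  split.
  - by move=> x; rewrite amul0r.
  - by move=> x y hx hy z; rewrite amulDr hx hy addr0.
  - by move=> c x hx z; rewrite amulZr hx scaler0.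
  - by move=> c x hx; split=> z; rewrite amulA hx ?amul0l.
have nN : nz_ideal N by split=> //; exists a.
have [_ [x xNN x0]] := nz_ideal_mul nN nN; apply: x0.
have s0 : subspace [set (0 : A)] by split=> // c y z -> ->; rewrite scaler0 addr0.
by apply: (lin_span_min s0 _ xNN) => _ [y [z [_ hz ->]]]; apply: hz.
Qed.

Definition principal_ideal a : set A :=
  lin_span [set z | exists x y : A, z = amul (amul x a) y].

Lemma principal_ideal_ideal a : ideal (principal_ideal a).
Proof.
apply: ideal_lin_span => b _ [x [y ->]]; split.
  by exists (amul b x), y; rewrite !amulA.
by exists x, (amul y b); rewrite !amulA.
Qed.

Lemma nz_principal_ideal a : a <> 0 -> nz_ideal (principal_ideal a).
Proof.
move=> a0; split; first exact: principal_ideal_ideal.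
apply: contrapT => no; apply: a0; apply: annihilator_r => x; apply: annihilator_l => y.
apply: contrapT => h; apply: no; exists (amul (amul x a) y) => //.
by apply: lin_span_gen; exists x, y.
Qed.

(** The usual test for primeness on elements; in the absence of an identity it
    is obtained from the ideals [A a A] and [A b A]. *)
Lemma prime_amul a b : (forall x, amul (amul a x) b = 0) -> a = 0 \/ b = 0.
Proof.
move=> h; apply: contrapT => /not_orP[a0 b0].
have [_ [x + x0]] := nz_ideal_mul (nz_principal_ideal a0) (nz_principal_ideal b0).
have s0 : subspace [set (0 : A)] by split=> // c y z -> ->; rewrite scaler0 addr0.
move=> hx; apply: x0; apply: (lin_span_min s0 _ hx) => _ [y [z [ay bz ->]]].
have sr : subspace [set z | amul y z = 0].
  split; first by rewrite /= amul0r.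
  by move=> c p q /= hp hq; rewrite amulDr amulZr hp hq scaler0 addr0.
apply: (lin_span_min sr _ bz) => _ [p [q ->]].
have sl : subspace [set y | amul y (amul (amul p b) q) = 0].
  split; first by rewrite /= amul0l.
  by move=> c u v /= hu hv; rewrite amulDl amulZl hu hv scaler0 addr0.
apply: (lin_span_min sl _ ay) => _ [r [s ->]] /=.
have -> : amul (amul (amul r a) s) (amul (amul p b) q) =
    amul (amul r (amul (amul a (amul s p)) b)) q by rewrite !amulA.
by rewrite h amul0r amul0l.
Qed.

Lemma prime_amul_ideal I a b : nz_ideal I ->
  (forall x, I x -> amul (amul a x) b = 0) -> a = 0 \/ b = 0.
Proof.
move=> [[_ _ _ iI] [u Iu u0]] h; apply: contrapT => /not_orP[a0 b0].
have [x hx] : exists x, amul (amul a x) u <> 0.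
  apply: contrapT => no; have [x|//|//] := prime_amul (a := a) (b := u).
  by apply: contrapT => hx; apply: no; exists x.
have [y|//|//] := prime_amul (a := amul (amul a x) u) (b := b).
rewrite -(amulA _ u) -(amulA a x) h //.
by have [] := iI x (amul u y) (proj2 (iI y u Iu)).
Qed.

End AssocAlg.

(** * The Martindale closure of a prime algebra *)

(** The common interface of the embeddings into the Martindale closure and into
    a given central closure. *)
Definition alg_embedding (F : fieldType) (A : assocAlgType F) (C : fieldType)
    (R : algType C) (k : F -> C) (i : A -> R) :=
  [/\ injective i, forall a b, i (a + b) = i a + i b,
      forall a b, i (amul a b) = i a * i b,
      forall c a, i (c *: a) = k c *: i a
    & forall e : A, is_one e -> i e = 1].

Section Germs.
Local Open Scope quotient_scope.
Variables (F : fieldType) (A : assocAlgType F).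
Hypotheses (pA : prime_alg A) (nzA : exists a : A, a <> 0).

Definition right_linear (I : set A) (g : A -> A) :=
  (forall c x y, I x -> I y -> g (c *: x + y) = c *: g x + g y) /\
  (forall x a, I x -> g (amul x a) = amul (g x) a).

(** A germ is given by a function on all of [A], of which only the values on some
    nonzero ideal matter; addition and composition are then the pointwise
    ones. *)
Record germ := Germ {
  germ_fun :> A -> A;
  germ_dom : exists I, nz_ideal I /\ right_linear I germ_fun
}.

HB.instance Definition _ := gen_eqMixin germ.
HB.instance Definition _ := gen_choiceMixin germ.

Lemma nz_idealT : nz_ideal [set: A].
Proof. by split; [split|have [a a0] := nzA; exists a]. Qed.

Lemma right_linear0 I g : ideal I -> right_linear I g -> g 0 = 0.
Proof.
move=> [I0 _ _ _] [lg _]; have := lg (-1) 0 0 I0 I0.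
by rewrite scaler0 addr0 scaleN1r addNr.
Qed.

(** A right linear map sends the ideal [I J] into [J], so germs compose. *)
Lemma right_linear_mul I J g : ideal I -> ideal J -> right_linear I g ->
  forall x, ideal_mul I J x -> I x /\ J (g x).
Proof.
move=> iI iJ rg; have sI := ideal_subspace iI; have sJ := ideal_subspace iJ.
have sP : subspace [set x | I x /\ J (g x)].
  split; first by split; [exact: sI.1|rewrite (right_linear0 iI rg); exact: sJ.1].
  move=> c x y [Ix Jx] [Iy Jy]; split; first exact: sI.2.
  by rewrite rg.1 //; apply: sJ.2.
apply: (lin_span_min sP) => _ [x [y [Ix Jy ->]]]; split.
  by case: iI => _ _ _ /(_ y x Ix)[].
by rewrite rg.2 //; case: iJ => _ _ _ /(_ (g x) y Jy)[].
Qed.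

Definition germ_eq (g h : germ) : bool :=
  `[< exists I, nz_ideal I /\ forall x, I x -> g x = h x >].

Lemma germ_eqP (g h : germ) :
  reflect (exists I, nz_ideal I /\ forall x, I x -> g x = h x) (germ_eq g h).
Proof. exact: asboolP. Qed.

Lemma germ_eq_refl : reflexive germ_eq.
Proof. by move=> g; apply/germ_eqP; exists setT; split=> //; apply: nz_idealT. Qed.

Lemma germ_eq_sym : symmetric germ_eq.
Proof.
suff h g k : germ_eq g k -> germ_eq k g by move=> g k; apply/idP/idP; apply: h.
by move=> /germ_eqP[I [nI e]]; apply/germ_eqP; exists I; split=> // x /e.
Qed.

Lemma germ_eq_trans : transitive germ_eq.
Proof.
move=> g h k /germ_eqP[I [nI e]] /germ_eqP[J [nJ e']]; apply/germ_eqP.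
by exists (I `&` J); split; [exact: nz_idealI|move=> x [Ix Jx]; rewrite e // e'].
Qed.

Canonical germ_equiv := EquivRel germ_eq germ_eq_refl germ_eq_sym germ_eq_trans.

Definition germ_quot := {eq_quot germ_eq}.
HB.instance Definition _ : EqQuotient _ germ_eq germ_quot := EqQuotient.on germ_quot.
HB.instance Definition _ := Choice.on germ_quot.

Local Notation Q := germ_quot.
Local Notation pi := (\pi_Q : germ -> Q).

Lemma pi_eqP (g h : germ) : pi g = pi h <->
  exists I, nz_ideal I /\ forall x, I x -> g x = h x.
Proof. by split=> [/eqmodP/germ_eqP|/germ_eqP/eqmodP]. Qed.

Lemma pi_ext (g h : germ) : g =1 h -> pi g = pi h.
Proof. by move=> e; apply/pi_eqP; exists setT; split; [exact: nz_idealT|]. Qed.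

Fact germ_add_dom (g h : germ) :
  exists I, nz_ideal I /\ right_linear I (fun x => g x + h x).
Proof.
have [I [nI rg]] := germ_dom g; have [J [nJ rh]] := germ_dom h.
exists (I `&` J); split; first exact: nz_idealI.
split=> [c x y [Ix Jx] [Iy Jy]|x a [Ix Jx]].
  by rewrite rg.1 // rh.1 // scalerDr addrACA.
by rewrite rg.2 // rh.2 // amulDl.
Qed.
Definition germ_add g h := Germ (germ_add_dom g h).

Fact germ_opp_dom (g : germ) :
  exists I, nz_ideal I /\ right_linear I (fun x => - g x).
Proof.
have [I [nI rg]] := germ_dom g; exists I; split=> //.
split=> [c x y Ix Iy|x a Ix]; first by rewrite rg.1 // opprD scalerN.
by rewrite rg.2 // amulNl.
Qed.
Definition germ_opp g := Germ (germ_opp_dom g).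

Fact germ_mul_dom (g h : germ) :
  exists I, nz_ideal I /\ right_linear I (fun x => g (h x)).
Proof.
have [I [nI rg]] := germ_dom g; have [J [nJ rh]] := germ_dom h.
exists (ideal_mul J I); split; first exact: nz_ideal_mul.
have dom := right_linear_mul nJ.1 nI.1 rh.
split=> [c x y /dom[Jx Ix] /dom[Jy Iy]|x a /dom[Jx Ix]].
  by rewrite rh.1 // rg.1.
by rewrite rh.2 // rg.2.
Qed.
Definition germ_mul g h := Germ (germ_mul_dom g h).

Fact germ_left_dom (a : A) :
  exists I, nz_ideal I /\ right_linear I (fun x => amul a x).
Proof.
exists setT; split; first exact: nz_idealT.
by split=> [c x y _ _|x b _]; rewrite ?amulDr ?amulZr ?amulA.
Qed.
Definition germ_left a := Germ (germ_left_dom a).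

Fact germ_scale_dom (c : F) :
  exists I, nz_ideal I /\ right_linear I (fun x => c *: x).
Proof.
exists setT; split; first exact: nz_idealT.
by split=> [d x y _ _|x b _]; rewrite ?amulZl // scalerDr !scalerA mulrC.
Qed.
Definition germ_scale c := Germ (germ_scale_dom c).

Definition quot_add := lift_op2 Q germ_add.
Definition quot_opp := lift_op1 Q germ_opp.
Definition quot_mul := lift_op2 Q germ_mul.

Lemma repr_pi (g : germ) : exists I, nz_ideal I /\ forall x, I x -> repr (pi g) x = g x.
Proof. by apply/pi_eqP; rewrite reprK. Qed.

Lemma pi_add g h : quot_add (pi g) (pi h) = pi (germ_add g h).
Proof.
unlock quot_add; have [I [nI eg]] := repr_pi g; have [J [nJ eh]] := repr_pi h.
apply/pi_eqP; exists (I `&` J); split; first exact: nz_idealI.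
by move=> x [Ix Jx] /=; rewrite eg // eh.
Qed.

Lemma pi_opp g : quot_opp (pi g) = pi (germ_opp g).
Proof.
unlock quot_opp; have [I [nI eg]] := repr_pi g.
by apply/pi_eqP; exists I; split=> // x Ix /=; rewrite eg.
Qed.

Lemma pi_mul g h : quot_mul (pi g) (pi h) = pi (germ_mul g h).
Proof.
unlock quot_mul; have [I [nI eg]] := repr_pi g; have [J [nJ eh]] := repr_pi h.
have [H [nH rh]] := germ_dom h.
apply/pi_eqP; exists (J `&` ideal_mul H I); split.
  by apply: nz_idealI => //; apply: nz_ideal_mul.
move=> x [Jx HIx] /=; rewrite eh // eg //.
by have [] := right_linear_mul nH.1 nI.1 rh HIx.
Qed.

Fact quot_addA : associative quot_add.
Proof.
elim/quotW=> g; elim/quotW=> h; elim/quotW=> k; rewrite !pi_add.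
by apply: pi_ext => x /=; rewrite addrA.
Qed.

Fact quot_addC : commutative quot_add.
Proof.
elim/quotW=> g; elim/quotW=> h; rewrite !pi_add.
by apply: pi_ext => x /=; rewrite addrC.
Qed.

Fact quot_add0 : left_id (pi (germ_scale 0)) quot_add.
Proof.
elim/quotW=> g; rewrite !pi_add.
by apply: pi_ext => x /=; rewrite scale0r add0r.
Qed.

Fact quot_addN : left_inverse (pi (germ_scale 0)) quot_opp quot_add.
Proof.
elim/quotW=> g; rewrite !pi_opp !pi_add.
by apply: pi_ext => x /=; rewrite addNr scale0r.
Qed.

HB.instance Definition _ :=
  GRing.isZmodule.Build germ_quot quot_addA quot_addC quot_add0 quot_addN.

Fact quot_mulA : associative quot_mul.
Proof.
by elim/quotW=> g; elim/quotW=> h; elim/quotW=> k; rewrite !pi_mul; apply: pi_ext.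
Qed.

Fact quot_mul1l : left_id (pi (germ_scale 1)) quot_mul.
Proof.
elim/quotW=> g; rewrite !pi_mul.
by apply: pi_ext => x /=; rewrite scale1r.
Qed.

Fact germ_scaleZ c (g : germ) : exists I, nz_ideal I /\ forall x, I x -> g (c *: x) = c *: g x.
Proof.
have [I [nI rg]] := germ_dom g; exists I; split=> // x Ix.
have I0 : I 0 by case: nI.1.
by have := rg.1 c x 0 Ix I0; rewrite (right_linear0 nI.1 rg) !addr0.
Qed.

Fact quot_mul1r : right_id (pi (germ_scale 1)) quot_mul.
Proof.
elim/quotW=> g; rewrite !pi_mul; apply/pi_eqP.
by have [I [nI e]] := germ_scaleZ 1 g; exists I; split=> // x Ix /=; rewrite scale1r.
Qed.

Fact quot_mulDl : left_distributive quot_mul quot_add.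
Proof.
elim/quotW=> g; elim/quotW=> h; elim/quotW=> k.
by rewrite !(pi_add, pi_mul); apply: pi_ext.
Qed.

Fact quot_mulDr : right_distributive quot_mul quot_add.
Proof.
elim/quotW=> g; elim/quotW=> h; elim/quotW=> k.
rewrite !(pi_add, pi_mul); apply/pi_eqP.
have [I [nI rg]] := germ_dom g; have [H [nH rh]] := germ_dom h.
have [K [nK rk]] := germ_dom k.
exists (ideal_mul H I `&` ideal_mul K I); split.
  by apply: nz_idealI => //; apply: nz_ideal_mul.
move=> x [/(right_linear_mul nH.1 nI.1 rh)[_ hx] /(right_linear_mul nK.1 nI.1 rk)[_ kx]] /=.
by rewrite -[h x]scale1r rg.1 // !scale1r.
Qed.

Fact quot_1neq0 : pi (germ_scale 1) != pi (germ_scale 0).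
Proof.
apply/eqP => /pi_eqP[I [[_ [x Ix x0]] e]]; apply: x0.
by have := e x Ix; rewrite /= scale1r scale0r.
Qed.

HB.instance Definition _ := GRing.Zmodule_isNzRing.Build germ_quot
  quot_mulA quot_mul1l quot_mul1r quot_mulDl quot_mulDr quot_1neq0.

Definition emb (a : A) : Q := pi (germ_left a).

Lemma emb_add a b : emb (a + b) = emb a + emb b.
Proof. by rewrite [RHS]pi_add; apply: pi_ext => x /=; rewrite amulDl. Qed.

Lemma emb_mul a b : emb (amul a b) = emb a * emb b.
Proof. by rewrite [RHS]pi_mul; apply: pi_ext => x /=; rewrite amulA. Qed.

Lemma emb_scale c a : emb (c *: a) = pi (germ_scale c) * emb a.
Proof. by rewrite [RHS]pi_mul; apply: pi_ext => x /=; rewrite amulZl. Qed.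

Lemma emb_inj : injective emb.
Proof.
move=> a b /pi_eqP[I [nI e]]; apply/eqP; rewrite -subr_eq0; apply/eqP.
have [u Iu u0] := nI.2.
have [x Ix|//|//] := prime_amul_ideal pA (a := a - b) (b := u) nI.
by have /= ex := e x Ix; rewrite amulBl ex subrr amul0l.
Qed.

Lemma emb0 : emb 0 = 0.
Proof. by apply: (addrI (emb 0)); rewrite -emb_add !addr0. Qed.

(** Multiplication by an element of [Q] on the part of [A] where it is defined:
    the computations in [Q] are all reduced to this rule. *)
Lemma pi_emb (g : germ) I x : nz_ideal I -> right_linear I g -> I x ->
  pi g * emb x = emb (g x).
Proof.
move=> nI rg Ix; rewrite [LHS]pi_mul; apply: pi_ext => y /=.
by rewrite rg.2.
Qed.

Lemma quot_denom (q : Q) : exists I, nz_ideal I /\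
  forall x, I x -> exists y, q * emb x = emb y.
Proof.
elim/quotW: q => g; have [I [nI rg]] := germ_dom g; exists I; split=> // x Ix.
by exists (g x); apply: pi_emb Ix.
Qed.

Lemma quot_eq0 (q : Q) I : nz_ideal I -> (forall x, I x -> q * emb x = 0) -> q = 0.
Proof.
elim/quotW: q => g nI h; have [J [nJ rg]] := germ_dom g.
apply/pi_eqP; exists (I `&` J); split; first exact: nz_idealI.
move=> x [Ix Jx]; rewrite /= scale0r; apply: emb_inj.
by rewrite -(pi_emb nJ rg Jx) h // emb0.
Qed.

Lemma quot_ext I (g : A -> A) : nz_ideal I -> right_linear I g ->
  exists q : Q, forall x, I x -> q * emb x = emb (g x).
Proof.
move=> nI rg; pose G := @Germ g (ex_intro _ I (conj nI rg)).
by exists (pi G) => x Ix; apply: (pi_emb (g := G) nI rg Ix).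
Qed.

(** [Q] inherits primeness because a nonzero element of [Q] sends some element
    of [A] to a nonzero element of [A]. *)
Lemma quot_prime (p q : Q) : (forall a, p * emb a * q = 0) -> p = 0 \/ q = 0.
Proof.
move=> h; apply: contrapT => /not_orP[p0 q0].
have [I [nI dI]] := quot_denom q; have [J [nJ dJ]] := quot_denom p.
have [x [Ix qx]] : exists x, I x /\ q * emb x <> 0.
  apply: contrapT => no; apply: q0; apply: (quot_eq0 nI) => x Ix.
  by apply: contrapT => hx; apply: no; exists x.
have [y ey] := dI x Ix.
apply: p0; apply: (quot_eq0 nJ) => a Ja; have [z ez] := dJ a Ja; rewrite ez.
have [b|->|y0] := prime_amul pA (a := z) (b := y); last 2 first.
- exact: emb0.
- by case: qx; rewrite ey y0 emb0.
apply: emb_inj; rewrite !emb_mul -ez -ey emb0 -(mulrA p) -emb_mul.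
by rewrite mulrA h mul0r.
Qed.

Lemma quot_cancell (q : Q) : (forall a, emb a * q = 0) -> q = 0.
Proof.
move=> h; have [|/eqP|//] := @quot_prime 1 q; last by rewrite oner_eq0.
by move=> a; rewrite mul1r.
Qed.

Lemma quot_central (q : Q) : (forall a, q * emb a = emb a * q) ->
  forall p, q * p = p * q.
Proof.
move=> h p; apply/eqP; rewrite -subr_eq0; apply/eqP.
have [I [nI dI]] := quot_denom p; apply: (quot_eq0 nI) => x /dI[y ey].
by rewrite mulrBl -!mulrA ey !h mulrA ey subrr.
Qed.

Definition central_pred : pred Q := fun q => `[< forall p, q * p = p * q >].

Lemma central_predP (q : Q) : reflect (forall p, q * p = p * q) (q \in central_pred).
Proof. exact: asboolP. Qed.

Fact central_subring : subring_closed central_pred.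
Proof.
split=> [|p q|p q].
- by apply/central_predP => p; rewrite mul1r mulr1.
- move=> /central_predP hp /central_predP hq; apply/central_predP => r.
  by rewrite mulrBl mulrBr hp hq.
- move=> /central_predP hp /central_predP hq; apply/central_predP => r.
  by rewrite -mulrA hq mulrA hp mulrA.
Qed.
HB.instance Definition _ := GRing.isSubringClosed.Build Q central_pred central_subring.

(** The extended centroid of [A]. *)
Record centroid := Centroid { centroid_val : Q; _ : centroid_val \in central_pred }.
HB.instance Definition _ := [isSub for centroid_val].
HB.instance Definition _ := [Choice of centroid by <:].
HB.instance Definition _ := [SubChoice_isSubNzRing of centroid by <:].

Lemma centroidC (c : centroid) (q : Q) : val c * q = q * val c.
Proof. by case: c => c /= hc; move: hc => /central_predP. Qed.

Fact centroid_mulC : commutative ( *%R : centroid -> centroid -> centroid).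
Proof. by move=> c d; apply: val_inj; rewrite !rmorphM /= centroidC. Qed.
HB.instance Definition _ :=
  GRing.PzRing_hasCommutativeMul.Build centroid centroid_mulC.

(** A nonzero central germ is injective on its domain, and its inverse is right
    linear on the image, which is again an ideal. *)
Lemma centroid_inv (c : Q) : c \in central_pred -> c <> 0 ->
  exists2 d : Q, d \in central_pred & d * c = 1.
Proof.
move=> /central_predP cC c0; elim/quotW: c => g in cC c0 *.
have [I [nI rg]] := germ_dom g.
have gE x : I x -> pi g * emb x = emb (g x) by apply: pi_emb.
have [I0 ID IZ IM] := nI.1.
have gl a x : I x -> g (amul a x) = amul a (g x).
  move=> Ix; apply: emb_inj; rewrite emb_mul -!gE //; last by have [] := IM a x Ix.
  by rewrite emb_mul mulrA cC mulrA.
have ginj x y : I x -> I y -> g x = g y -> x = y.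
  move=> Ix Iy e; apply/eqP; rewrite -subr_eq0; apply/eqP.
  have Ixy : I (x - y) := subspaceB (ideal_subspace nI.1) Ix Iy.
  have [a|//|xy0] := @quot_prime (pi g) (emb (x - y)).
    rewrite cC -mulrA gE // addrC -scaleN1r rg.1 // e scaleN1r addNr.
    by rewrite emb0 mulr0.
  by apply: emb_inj; rewrite xy0 emb0.
pose J := [set g x | x in I].
have nJ : nz_ideal J.
  split; last first.
    have [x Ix x0] := nI.2; exists (g x); first by exists x.
    move=> gx0; apply: x0; apply: (ginj x 0) => //.
    by rewrite gx0 (right_linear0 nI.1 rg).
  split.
  - by exists 0 => //; apply: right_linear0 nI.1 rg.
  - move=> _ _ [x Ix <-] [y Iy <-]; exists (x + y); first exact: ID.
    by rewrite -[x]scale1r rg.1 // !scale1r.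
  - move=> k _ [x Ix <-]; exists (k *: x); first exact: IZ.
    by have := rg.1 k x 0 Ix I0; rewrite (right_linear0 nI.1 rg) !addr0.
  - move=> a _ [x Ix <-]; have [ax xa] := IM a x Ix.
    by split; [exists (amul a x); rewrite ?gl|exists (amul x a); rewrite ?rg.2].
pose h y := xget 0 [set x | I x /\ g x = y].
have hP y : J y -> I (h y) /\ g (h y) = y.
  move=> [x Ix <-]; rewrite /h; case: xgetP => [z _ []//|/(_ x)]; by case.
have rh : right_linear J h.
  split=> [k x y /hP[hx ex] /hP[hy ey]|x a /[dup] Jx /hP[hx ex]].
    apply: ginj; [apply: (hP _ _).1| |].
    - by rewrite -ex -ey -rg.1 //; exists (k *: h x + h y) => //; apply: ID => //; apply: IZ.
    - by apply: ID => //; apply: IZ.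
    - rewrite rg.1 // ex ey; apply: (hP _ _).2.
      by rewrite -ex -ey -rg.1 //; exists (k *: h x + h y) => //; apply: ID => //; apply: IZ.
  have Jxa : J (amul x a) by case: nJ.1 => _ _ _ /(_ a x Jx)[].
  have [hxa exa] := hP _ Jxa.
  apply: ginj => //; first by have [] := IM a (h x) hx.
  by rewrite exa rg.2 // ex.
have [d hd] := quot_ext nJ rh.
have dc1 : d * pi g = 1.
  apply/eqP; rewrite -subr_eq0; apply/eqP; apply: (quot_eq0 nI) => x Ix.
  have Jgx : J (g x) by exists x.
  rewrite mulrBl -mulrA gE // hd // mul1r.
  have [hgx egx] := hP _ Jgx.
  by rewrite (ginj _ _ hgx Ix egx) subrr.
exists d => //; apply/central_predP => p.
by rewrite -[LHS]mulr1 -{1}dc1 -{1}cC !mulrA -(mulrA d p) -cC mulrA dc1 mul1r.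
Qed.

Definition centroid_invr (c : centroid) : centroid :=
  xget 0 [set d | d * c = 1].

Fact centroid_mulV (c : centroid) : c != 0 -> centroid_invr c * c = 1.
Proof.
move=> c0; have [d dC dc] : exists2 d : Q, d \in central_pred & d * val c = 1.
  by apply: centroid_inv (valP c) _ => e; move/eqP: c0; apply; apply: val_inj.
rewrite /centroid_invr; case: xgetP => [x _ //|/(_ (Centroid dC))[]].
exact: val_inj.
Qed.

Fact centroid_inv0 : centroid_invr 0 = 0.
Proof.
rewrite /centroid_invr; case: xgetP => // x _ /eqP.
by rewrite mulr0 eq_sym oner_eq0.
Qed.

HB.instance Definition _ :=
  GRing.ComNzRing_isField.Build centroid centroid_mulV centroid_inv0.

(** If [u r v = v r u] for all [r], then [x u y |-> x v y] defines a bimodule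
    map on the ideal generated by [u]; it is multiplication by an element of
    the extended centroid, which is the quotient of [v] by [u]. *)
Lemma centroid_quotient (u v : A) : u <> 0 ->
  (forall r, amul (amul u r) v = amul (amul v r) u) ->
  exists c : centroid, val c * emb u = emb v.
Proof.
move=> u0 uv; pose I := principal_ideal u.
have nI : nz_ideal I := nz_principal_ideal pA u0.
pose rel w w' := forall r, amul (amul u r) w' = amul (amul v r) w.
have ex w : I w -> exists w', rel w w'.
  have sP : subspace [set w | exists w', rel w w'].
    split; first by exists 0 => r; rewrite !amul0r.
    move=> c x y [x' hx] [y' hy]; exists (c *: x' + y') => r.
    by rewrite !amulDr !amulZr hx hy.
  apply: (lin_span_min sP) => _ [x [y ->]]; exists (amul (amul x v) y) => r.
  have := uv (amul r x); rewrite !amulA => e.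
  by rewrite e.
have un w x y : rel w x -> rel w y -> x = y.
  move=> hx hy; apply/eqP; rewrite -subr_eq0; apply/eqP.
  have [r|//|//] := prime_amul pA (a := u) (b := x - y).
  by rewrite amulBr hx hy subrr.
pose g w := xget 0 [set w' | rel w w'].
have gP w : I w -> rel w (g w).
  by move=> /ex[w' hw]; rewrite /g; case: xgetP => [//|/(_ w')[]].
have [I0 ID IZ IM] := nI.1.
have rg : right_linear I g.
  split=> [c x y Ix Iy|x a Ix].
    apply: (un (c *: x + y)); first by apply: gP; apply: ID => //; apply: IZ.
    by move=> r; rewrite !amulDr !amulZr !gP.
  apply: (un (amul x a)); first by apply: gP; have [] := IM a x Ix.
  by move=> r; rewrite !amulA gP.
have gl a x : I x -> g (amul a x) = amul a (g x).
  move=> Ix; apply: (un (amul a x)); first by apply: gP; have [] := IM a x Ix.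
  by move=> r; rewrite !amulA -(amulA u) -(amulA v) gP.
have [q hq] := quot_ext nI rg.
have qC : q \in central_pred.
  apply/central_predP; apply: quot_central => a.
  apply/eqP; rewrite -subr_eq0; apply/eqP; apply: (quot_eq0 nI) => x Ix.
  have [Iax _] := IM a x Ix.
  by rewrite mulrBl -mulrA -emb_mul hq // gl // -mulrA hq // emb_mul subrr.
exists (Centroid qC) => /=; apply/eqP; rewrite -subr_eq0; apply/eqP.
apply: quot_cancell => x; apply: (quot_eq0 nz_idealT) => y _.
have Iw : I (amul (amul x u) y) by apply: lin_span_gen; exists x, y.
have e : g (amul (amul x u) y) = amul (amul x v) y.
  apply: (un (amul (amul x u) y)) => [|r]; first exact: gP.
  by have := uv (amul r x); rewrite !amulA => ->.
move: qC => /central_predP qC.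
have := hq _ Iw; rewrite e !emb_mul !mulrA => e'.
by rewrite mulrBr mulrBl !mulrA -(qC (emb x)) e' subrr.
Qed.

(** Multiplying [b] and [b'] on the right by a common denominator brings the
    relation back to elements of [A]. *)
Lemma quot_closed (b b' : Q) : b <> 0 ->
  (forall a, b * emb a * b' = b' * emb a * b) ->
  exists c : centroid, b' = val c * b.
Proof.
move=> b0 h; have [I [nI dI]] := quot_denom b; have [J [nJ dJ]] := quot_denom b'.
have nIJ := nz_idealI pA nI nJ.
have [x0 [[Ix0 Jx0] bx0]] : exists x, (I `&` J) x /\ b * emb x <> 0.
  apply: contrapT => no; apply: b0; apply: (quot_eq0 nIJ) => x Ix.
  by apply: contrapT => hx; apply: no; exists x.
have [u eu] := dI _ Ix0; have [v ev] := dJ _ Jx0.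
have u0 : u <> 0 by move=> e; apply: bx0; rewrite eu e emb0.
have swap x p p' r : b * emb x = emb p -> b' * emb x = emb p' ->
    emb u * emb r * emb p' = emb v * emb r * emb p.
  move=> ep ep'; rewrite -eu -ev -ep -ep' !mulrA -!(mulrA _ (emb x0)) -!emb_mul.
  by rewrite h.
have [r|c hc] := centroid_quotient (v := v) u0.
  by apply: emb_inj; rewrite !emb_mul; apply: (swap x0).
exists c; apply/eqP; rewrite -subr_eq0; apply/eqP.
apply: (quot_eq0 nIJ) => x [/dI[p ep] /dJ[p' ep']].
have [r|e|//] := @quot_prime (emb u) ((b' - val c * b) * emb x); last first.
  by case: u0; apply: emb_inj; rewrite e emb0.
have -> : (b' - val c * b) * emb x = emb p' - val c * emb p.
  by rewrite mulrBl -mulrA ep ep'.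
rewrite mulrBr (swap x p p' r) // -hc (mulrA _ (val c)) -centroidC !mulrA.
by rewrite subrr.
Qed.

Definition quot_scale (c : centroid) (q : Q) : Q := val c * q.

Fact quot_scaleA c d q : quot_scale c (quot_scale d q) = quot_scale (c * d) q.
Proof. by rewrite /quot_scale rmorphM /= mulrA. Qed.
Fact quot_scale1 : left_id 1 quot_scale.
Proof. by move=> q; rewrite /quot_scale rmorph1 mul1r. Qed.
Fact quot_scaleDr : right_distributive quot_scale +%R.
Proof. by move=> c p q; rewrite /quot_scale mulrDr. Qed.
Fact quot_scaleDl q : {morph quot_scale^~ q : c d / c + d}.
Proof. by move=> c d; rewrite /quot_scale rmorphD /= mulrDl. Qed.

HB.instance Definition _ := GRing.Zmodule_isLmodule.Build centroid germ_quot
  quot_scaleA quot_scale1 quot_scaleDr quot_scaleDl.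

Fact quot_scaleAl (c : centroid) (p q : Q) : c *: (p * q) = (c *: p) * q.
Proof. exact: mulrA. Qed.
HB.instance Definition _ :=
  GRing.Lmodule_isLalgebra.Build centroid germ_quot quot_scaleAl.

Fact quot_scaleAr (c : centroid) (p q : Q) : c *: (p * q) = p * (c *: q).
Proof. by rewrite /GRing.scale /= /quot_scale mulrA centroidC mulrA. Qed.
HB.instance Definition _ :=
  GRing.Lalgebra_isAlgebra.Build centroid germ_quot quot_scaleAr.

Fact germ_scale_central c : pi (germ_scale c) \in central_pred.
Proof.
apply/central_predP; elim/quotW => g; rewrite [LHS]pi_mul [RHS]pi_mul.
apply/pi_eqP; have [I [nI e]] := germ_scaleZ c g; exists I; split=> // x Ix /=.
by rewrite e.
Qed.

Definition scalar_germ (c : F) : centroid := Centroid (germ_scale_central c).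

Fact scalar_germ_zmod : zmod_morphism scalar_germ.
Proof.
move=> c d; apply: val_inj; rewrite rmorphB /= [X in _ = _ + X]pi_opp [RHS]pi_add.
by apply: pi_ext => x /=; rewrite scalerBl.
Qed.
HB.instance Definition _ :=
  GRing.isZmodMorphism.Build F centroid scalar_germ scalar_germ_zmod.

Fact scalar_germ_monoid : monoid_morphism scalar_germ.
Proof.
split; first exact: val_inj.
move=> c d; apply: val_inj; rewrite rmorphM /= [RHS]pi_mul.
by apply: pi_ext => x /=; rewrite scalerA.
Qed.
HB.instance Definition _ :=
  GRing.isMonoidMorphism.Build F centroid scalar_germ scalar_germ_monoid.

Hypothesis centerA : exists2 z : A, center A z & z <> 0.

(** The central closure of [A] in the sense of Martindale: the subalgebra of [Q]
    generated by [A] and the extended centroid.  A nonzero central element of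
    [A] becomes invertible in the extended centroid, so it contains [1]. *)
Definition closure_pred : pred Q :=
  fun q => `[< lin_span [set emb a | a in [set: A]] q >].

Lemma closure_predP (q : Q) :
  reflect (lin_span [set emb a | a in [set: A]] q) (q \in closure_pred).
Proof. exact: asboolP. Qed.

Lemma emb_closure a : emb a \in closure_pred.
Proof. by apply/closure_predP/lin_span_gen; exists a. Qed.

Fact closure_subalg : subalg_closed closure_pred.
Proof.
have sS := @lin_span_subspace centroid germ_quot [set emb a | a in [set: A]].
split=> [|c p q|p q].
- have [z zC z0] := centerA; apply/closure_predP.
  have cz : emb z \in central_pred.
    apply/central_predP; apply: quot_central => a.
    by rewrite -!emb_mul zC.
  have [|d dC dz] := centroid_inv cz.
    by move=> e; apply: z0; apply: emb_inj; rewrite e emb0.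
  rewrite -dz -[d * _]/((Centroid dC) *: emb z); apply: subspaceZ => //.
  by apply: lin_span_gen; exists z.
- by move=> /closure_predP hp /closure_predP hq; apply/closure_predP/sS.2.
- move=> /closure_predP hp /closure_predP hq; apply/closure_predP.
  have sl : subspace [set p | lin_span [set emb a | a in [set: A]] (p * q)].
    split; first by rewrite /= mul0r; apply: sS.1.
    by move=> c x y /= hx hy; rewrite mulrDl -scalerAl; apply: sS.2.
  apply: (lin_span_min sl _ hp) => _ [a _ <-] /=.
  have sr : subspace [set q | lin_span [set emb a | a in [set: A]] (emb a * q)].
    split; first by rewrite /= mulr0; apply: sS.1.
    by move=> c x y /= hx hy; rewrite mulrDr -scalerAr; apply: sS.2.
  apply: (lin_span_min sr _ hq) => _ [b _ <-] /=.
  by apply: lin_span_gen; exists (amul a b) => //; rewrite emb_mul.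
Qed.
HB.instance Definition _ :=
  GRing.isSubalgClosed.Build centroid germ_quot closure_pred closure_subalg.

Record closure := Closure { closure_val : Q; _ : closure_val \in closure_pred }.
HB.instance Definition _ := [isSub for closure_val].
HB.instance Definition _ := [Choice of closure by <:].
HB.instance Definition _ := [SubChoice_isSubAlgebra of closure by <:].

Definition closure_emb (a : A) : closure := Closure (emb_closure a).

Lemma closure_prime : prime_ring closure.
Proof.
move=> p q h; have [a|e|e] := @quot_prime (val p) (val q).
- have := congr1 val (h (closure_emb a)).
  by rewrite !rmorphM rmorph0.
- by left; apply: val_inj.
- by right; apply: val_inj.
Qed.

Lemma closure_closed : centrally_closed closure.
Proof.
move=> b b' b0 h; have [||c hc] := @quot_closed (val b) (val b').
- by move=> e; apply: b0; apply: val_inj.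
- by move=> a; have := congr1 val (h (closure_emb a)); rewrite !rmorphM.
by exists c; apply: val_inj; rewrite linearZ.
Qed.

Lemma closure_span (r : closure) : lin_span [set closure_emb a | a in [set: A]] r.
Proof.
case: r => q hq; have /closure_predP[n [c [v [hv e]]]] := hq.
have /choice[w hw] : forall i, exists a, emb a = v i by move=> i; have [a _] := hv i; exists a.
exists n, c, (fun i => closure_emb (w i)); split; first by move=> i; exists (w i).
apply: val_inj; rewrite raddf_sum [LHS]e; apply: eq_bigr => i _.
transitivity (val (c i *: closure_emb (w i))); last by [].
by rewrite linearZ /= hw.
Qed.

Lemma central_closure_section :
  exists (C : fieldType) (R : algType C) (k : {rmorphism F -> C}) (i : A -> R),
    [/\ alg_embedding k i, prime_ring R, centrally_closed R,
      forall r, lin_span [set i a | a in [set: A]] r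
    & forall c : C, exists I : set A, nz_ideal I /\
        forall x, I x -> exists y, c *: i x = i y].
Proof.
exists centroid, closure, scalar_germ, closure_emb; split.
- split.
  + by move=> a b /(congr1 val) /= e; apply: emb_inj.
  + by move=> a b; apply: val_inj; rewrite rmorphD /= emb_add.
  + by move=> a b; apply: val_inj; rewrite rmorphM /= emb_mul.
  + by move=> c a; apply: val_inj; rewrite linearZ /= emb_scale.
  + move=> e eone; apply: val_inj; rewrite rmorph1 /=.
    apply/eqP; rewrite -subr_eq0; apply/eqP.
    apply: (quot_eq0 nz_idealT) => x _.
    by rewrite mulrBl mul1r -emb_mul (eone x).1 subrr.
- exact: closure_prime.
- exact: closure_closed.
- exact: closure_span.
- move=> c; have [I [nI dI]] := quot_denom (val c); exists I; split=> // x Ix.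
  by have [y ey] := dI x Ix; exists y; apply: val_inj; rewrite linearZ /= -ey.
Qed.

End Germs.

(** All that is used of the construction by germs. *)
Theorem martindale_closure (F : fieldType) (A : assocAlgType F) :
  prime_alg A -> (exists2 z : A, center A z & z <> 0) ->
  exists (C : fieldType) (R : algType C) (k : {rmorphism F -> C}) (i : A -> R),
    [/\ alg_embedding k i, prime_ring R, centrally_closed R,
      forall r, lin_span [set i a | a in [set: A]] r
    & forall c : C, exists I : set A, nz_ideal I /\
        forall x, I x -> exists y, c *: i x = i y].
Proof.
move=> pA zA; have nzA : exists a : A, a <> 0 by case: zA => z _ z0; exists z.
exact: central_closure_section pA nzA zA.
Qed.

(** * Multilinear identities of the closure *)

Definition malg_val (F C : fieldType) (R : algType C) (I : choiceType)
    (k : F -> C) (V : I -> R) (f : {malg F[{fmonom I}]}) : R :=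
  \sum_(w <- msupp f) k f@_w *: word_val V w.

Section Embedding.
Variables (F : fieldType) (A : assocAlgType F) (C : fieldType) (R : algType C).
Variables (k : {rmorphism F -> C}) (i : A -> R).
Hypothesis emb_i : alg_embedding k i.

Lemma embD a b : i (a + b) = i a + i b. Proof. by case: emb_i. Qed.
Lemma embM a b : i (amul a b) = i a * i b. Proof. by case: emb_i. Qed.
Lemma embZ c a : i (c *: a) = k c *: i a. Proof. by case: emb_i. Qed.
Lemma embI : injective i. Proof. by case: emb_i. Qed.
Lemma emb_zero : i 0 = 0.
Proof. by apply: (addrI (i 0)); rewrite -embD !addr0. Qed.
Lemma embN a : i (- a) = - i a.
Proof. by apply: (addrI (i a)); rewrite -embD !subrr emb_zero. Qed.
Lemma embB a b : i (a - b) = i a - i b.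
Proof. by rewrite embD embN. Qed.
Lemma emb_sum (T : Type) (r : seq T) (P : pred T) (f : T -> A) :
  i (\sum_(x <- r | P x) f x) = \sum_(x <- r | P x) i (f x).
Proof. exact: (big_morph i embD emb_zero). Qed.

Lemma emb_word (I : choiceType) (v : I -> A) (w : {fmonom I}) :
  (w : seq I) <> [::] -> i (word_value v w) = word_val (i \o v) w.
Proof.
rewrite /word_value /word_val; case: (w : seq I) => // x s _.
rewrite big_cons; elim/last_ind: s => [|s y IH]; first by rewrite big_nil mulr1.
by rewrite -cats1 foldl_cat big_cat big_seq1 /= embM IH mulrA.
Qed.

Lemma emb_eval (I : choiceType) (v : I -> A) (f : {malg F[{fmonom I}]}) :
  evaluable A f -> i (alg_eval v f) = malg_val k (i \o v) f.
Proof.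
move=> ev; rewrite /alg_eval emb_sum; apply: eq_big_seq => w wf; rewrite embZ.
have [w1|/eqP w1] := eqVneq (w : seq I) [::]; last by rewrite emb_word.
have -> : w = mone by apply: val_inj; rewrite /= -fm1 in w1 *.
have [[e he]|->] := ev; last by rewrite rmorph0 !scale0r.
congr (_ *: _); rewrite /word_value fm1 /word_val big_nil.
case: emb_i => _ _ _ _; apply.
by case: xgetP => [x -> //|/(_ e)].
Qed.

End Embedding.

Section Linearize.
Variables (F : fieldType) (A : assocAlgType F) (C : fieldType) (R : algType C).
Variables (k : {rmorphism F -> C}) (i : A -> R).
Hypothesis emb_i : alg_embedding k i.

Definition subst_letter (X : nat -> R) (j : nat) (y : R) :=
  fun l => if l == j then y else X l.

(** Putting [X_j = 0] kills exactly the words containing [j]; hence the part of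
    an identity made of the words that contain [j] is again an identity. *)
Lemma identity_filter_letter (g : seq (C * seq nat)) j :
  (forall x : nat -> A, poly_val (i \o x) g = 0) ->
  forall x : nat -> A, poly_val (i \o x) [seq m <- g | j \in m.2] = 0.
Proof.
move=> gid x; pose y l := if l == j then 0 else x l.
have := gid x; rewrite (poly_val_filter _ (fun m => j \in m.2)).
suff -> : poly_val (i \o x) [seq m <- g | predC (fun m => j \in m.2) m] = 0.
  by rewrite addr0.
rewrite -[RHS](gid y) /poly_val big_filter [RHS](bigID (fun m => j \in m.2)) /=.
rewrite [X in X + _]big1 ?add0r => [|m jm].
  apply: eq_bigr => m jm; congr (_ *: _); apply: eq_word_val => l lm /=.
  by rewrite /y (negPf (_ : l != j)) //; apply: contraNneq jm => <-.
case/splitPr: jm => u v; rewrite /word_val big_cat big_cons /= /y eqxx.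
by rewrite (emb_zero emb_i) mul0r mulr0 scaler0.
Qed.

Lemma identity_filter_letters (js : seq nat) (g : seq (C * seq nat)) :
  (forall x : nat -> A, poly_val (i \o x) g = 0) ->
  forall x : nat -> A, poly_val (i \o x) [seq m <- g | all (fun j => j \in m.2) js] = 0.
Proof.
elim: js => [|j js IH] gid x; first by rewrite filter_predT gid.
rewrite (eq_filter (a2 := predI (fun m => j \in m.2) (fun m => all (fun j => j \in m.2) js))) //.
by rewrite filter_predI; apply: identity_filter_letter; apply: IH.
Qed.

Lemma poly_val_one_letter (g : seq (C * seq nat)) (X : nat -> R) j :
  (forall m, m \in g -> uniq m.2 /\ j \in m.2) ->
  exists s : seq (R * R), forall y, poly_val (subst_letter X j y) g = mult_op s y.
Proof.
elim: g => [|[c w] g IH] hg.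
  by exists [::] => y; rewrite /poly_val big_nil mult_op_nil.
have [|s hs] := IH; first by move=> m mg; apply: hg; rewrite inE mg orbT.
have [/= uw jw] := hg (c, w) (mem_head _ _).
case/splitPr: jw uw => u v; rewrite cat_uniq /= negb_or -andbA.
move=> /and5P[_ ju _ jv _].
exists ((c *: word_val X u, word_val X v) :: s) => y.
rewrite poly_val_cons mult_op_cons hs /=; congr (_ + _).
have out (t : seq nat) : j \notin t -> word_val X t = word_val (subst_letter X j y) t.
  move=> tj; apply: eq_word_val => l lt; rewrite /subst_letter (negPf (_ : l != j)) //.
  by apply: contraNneq tj => <-.
rewrite !out // /word_val big_cat big_cons /= {2}/subst_letter eqxx.
by rewrite -!scalerAl !mulrA.
Qed.

(** One variable after the other, by linearity in that variable. *)
Lemma multilinear_extend n (g : seq (C * seq nat)) : multilinear n g ->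
  (forall r, lin_span [set i a | a in [set: A]] r) ->
  (forall x : nat -> A, poly_val (i \o x) g = 0) ->
  forall X : nat -> R, poly_val X g = 0.
Proof.
move=> [perm _ _] span gid X.
have words m : m \in g -> uniq m.2 /\ m.2 =i iota 0 n.
  by move=> mg; split; [rewrite (perm_uniq (perm _ mg)) iota_uniq|exact: perm_mem (perm _ mg)].
suff H l : (l <= n)%N -> forall X, (forall j, (l <= j)%N -> exists a, i a = X j) ->
    poly_val X g = 0.
  pose X' j := if (j < n)%N then X j else i 0.
  have <- : poly_val X' g = poly_val X g.
    apply: eq_big_seq => m mg; congr (_ *: _); apply: eq_word_val => j.
    by rewrite (words m mg).2 mem_iota /X' => /andP[_ ->].
  apply: (H n) => // j nj; exists 0; by rewrite /X' ltnNge nj.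
elim: l => [|l IH] ln {}X hX.
  have /choice[x hx] : forall j, exists a, i a = X j by move=> j; apply: hX.
  rewrite -(gid x); apply: eq_bigr => m _; congr (_ *: _).
  by apply: eq_word_val => j _; rewrite /= hx.
have [|s hs] := @poly_val_one_letter g X l.
  by move=> m mg; have [u e] := words m mg; rewrite e mem_iota.
have -> : poly_val X g = mult_op s (X l).
  rewrite -hs; apply: eq_bigr => m _; congr (_ *: _); apply: eq_word_val => j _.
  by rewrite /subst_letter; case: eqP => [->|].
have sK : subspace [set y | mult_op s y = 0].
  split; first exact: linear_at0 (mult_op_linear s).
  by move=> c x y /= hx hy; rewrite mult_op_linear hx hy scaler0 addr0.
apply: (lin_span_min sK _ (span (X l))) => _ [a _ <-] /=.
rewrite -hs; apply: IH; first exact: ltnW.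
move=> j lj; rewrite /subst_letter; case: eqP => [_|jl]; first by exists a.
by apply: hX; rewrite ltn_neqAle lj andbT eq_sym; apply/eqP.
Qed.

Lemma seq_argmax (T : eqType) (h : T -> nat) (s : seq T) : s <> [::] ->
  exists2 w, w \in s & forall x, x \in s -> (h x <= h w)%N.
Proof.
elim: s => // w [|w' s] IH _.
  by exists w; rewrite ?inE // => x; rewrite inE => /eqP ->.
have [//|x xs hx] := IH; have [le|lt] := leqP (h w) (h x).
  exists x; first by rewrite inE xs orbT.
  by move=> y; rewrite inE => /predU1P[->//|/hx].
exists w; first exact: mem_head.
move=> y; rewrite inE => /predU1P[->//|/hx le].
exact: leq_trans le (ltnW lt).
Qed.

Section Expand.
Variable w0 : seq nat.
Local Notation d := (size w0).

(** The monomials in the expansion of [w] under the substitution described at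
    [PI_multilinear]. *)
Fixpoint expand_word (w : seq nat) : seq (seq nat) :=
  if w is j :: w' then
    [seq l :: v | l <- [seq l <- iota 0 d | nth 0%N w0 l == j], v <- expand_word w']
  else [:: [::]].

Lemma mem_expand w v : (v \in expand_word w) =
  (map (nth 0%N w0) v == w) && all (fun l => l < d)%N v.
Proof.
elim: w v => [|j w IH] v; first by rewrite inE; case: v.
apply/allpairsP/idP => [[[l u] /= [+ + ->]]|].
  rewrite mem_filter mem_iota add0n /= => /andP[/eqP-> ->].
  by rewrite IH => /andP[/eqP -> ->]; rewrite eqxx.
case: v => [|l v] //= /andP[/eqP[<- ew] /andP[ld av]].
by exists (l, v); rewrite /= mem_filter eqxx mem_iota ld IH ew eqxx av.
Qed.

Lemma expand_uniq w : uniq (expand_word w).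
Proof.
elim: w => //= j w IH; apply: allpairs_uniq => //.
  by rewrite filter_uniq // iota_uniq.
by move=> [a b] [c e] _ _ /= [-> ->].
Qed.

Lemma word_val_expand (X : nat -> R) w :
  word_val (fun j => \sum_(l <- iota 0 d | nth 0%N w0 l == j) X l) w =
  \sum_(v <- expand_word w) word_val X v.
Proof.
elim: w => [|j w IH]; first by rewrite /= big_seq1 /word_val !big_nil.
rewrite /word_val big_cons -!/(word_val _ _) IH /= big_allpairs_dep big_filter.
rewrite mulr_suml; apply: eq_bigr => l _; rewrite mulr_sumr.
by apply: eq_bigr => v _; rewrite /word_val big_cons.
Qed.

End Expand.

(** Multilinearization.  Let [w0] be a longest word of the identity [f].  In the
    substitution [X_j := sum of the Y_l such that the l-th letter of w0 is j],
    the words in which all [Y_l] occur are permutations of the letters, because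
    none is longer than [w0]; they form a multilinear identity, and the
    increasing word occurs in it with the coefficient of [w0]. *)
Theorem PI_multilinear : PI_alg A ->
  (forall r, lin_span [set i a | a in [set: A]] r) ->
  exists n (g : seq (C * seq nat)), [/\ g != [::], multilinear n g
    & forall X : nat -> R, poly_val X g = 0].
Proof.
move=> [f [f0 ev fid]] span.
have [|w0 w0f long] := @seq_argmax _ (fun w : {fmonom nat} => size w) (msupp f).
  move=> e; move/eqP: f0; apply; apply/malgP => w; rewrite mcoeff0.
  apply/eqP; rewrite mcoeff_eq0; apply/negP => wf.
  by rewrite -[_ \in _]/(w \in enum_fset _) e in wf.
pose d := size w0.
pose P := [seq (k f@_w, v) | w <- msupp f, v <- expand_word w0 w].
have memP m : m \in P -> exists2 w, w \in msupp f & m.1 = k f@_w /\ m.2 \in expand_word w0 w.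
  by move=> /allpairsPdep[w [v [wf vw ->]]]; exists w.
have uP : uniq (map snd P).
  rewrite /P map_allpairs /=.
  apply: (allpairs_uniq_dep (f := fun _ v => v)) => [|w _|].
  - exact: fset_uniq.
  - exact: expand_uniq.
  - move=> p p' /allpairsPdep[w [v [_ + ->]]] /allpairsPdep[w' [v' [_ + ->]]] /=.
    rewrite !mem_expand => /andP[/eqP ew _] /andP[/eqP ew' _] evv'; subst v'.
    have -> // : w' = w by apply: val_inj; rewrite /= -ew' ew.
pose g := [seq m <- P | all (fun j => j \in m.2) (iota 0 d)].
have mg : multilinear d g.
  split=> [m|m|].
  - rewrite mem_filter => /andP[/allP alld /memP[w wf [_]]].
    rewrite mem_expand => /andP[/eqP ew /allP lt].
    have sz : (size m.2 <= size (iota 0 d))%N.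
      by rewrite size_iota -(size_map (nth 0%N w0)) ew long.
    have [um e] := uniq_min_size (iota_uniq 0 d) alld sz.
    apply: uniq_perm => //; last exact: iota_uniq.
    by rewrite (uniq_size_uniq (iota_uniq 0 d) e) um.
  - rewrite mem_filter => /andP[_ /memP[w wf [-> _]]].
    by rewrite fmorph_eq0 mcoeff_neq0.
  - by apply: subseq_uniq uP; apply/map_subseq/filter_subseq.
exists d, g; split=> //; last first.
  apply: multilinear_extend mg span _.
apply: identity_filter_letters => x.
pose v j := \sum_(l <- iota 0 d | nth 0%N w0 l == j) x l.
rewrite -(emb_zero emb_i) -(fid v) (emb_eval emb_i) // /poly_val /malg_val.
rewrite big_allpairs_dep; apply: eq_bigr => w _ /=.
rewrite -scaler_sumr -word_val_expand; congr (_ *: _); apply: eq_word_val => j _.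
by rewrite /= /v (emb_sum emb_i).
suff : (k f@_w0, iota 0 d) \in g by case: (g).
rewrite mem_filter /=; apply/andP; split; first by apply/allP.
apply/allpairsPdep; exists w0, (iota 0 d); split=> //.
rewrite mem_expand -[X in map _ X == _]/(iota 0 d) map_nth_iota0 // take_size eqxx /=.
by apply/allP => j; rewrite mem_iota.
Qed.
End Linearize.

(** * Central values of multiplication operators *)

Definition amul_op (F : fieldType) (A : assocAlgType F) (s : seq (A * A)) (x : A) : A :=
  \sum_(z <- s) amul (amul z.1 x) z.2.

Section CentralOps.
Variables (F : fieldType) (A : assocAlgType F) (C : fieldType) (R : algType C).
Variables (k : {rmorphism F -> C}) (i : A -> R).
Hypothesis emb_i : alg_embedding k i.
Hypotheses (Rprime : prime_ring R) (Rclosed : centrally_closed R).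
Hypothesis Rfd : fin_dim [set: R].
Hypothesis span : forall r : R, lin_span [set i a | a in [set: A]] r.
Hypothesis denom : forall c : C, exists I : set A, nz_ideal I /\
  forall x, I x -> exists y, c *: i x = i y.
Hypothesis pA : prime_alg A.
Hypothesis nzA : exists a : A, a <> 0.

Lemma emb_amul_op s x : i (amul_op s x) =
  mult_op [seq (i z.1, i z.2) | z <- s] (i x).
Proof.
rewrite (emb_sum emb_i) /mult_op big_map; apply: eq_bigr => z _.
by rewrite !(embM emb_i).
Qed.

Lemma mult_op_expand (s : seq (R * R)) : exists T : seq (C * A * A),
  forall x, mult_op s x = \sum_(t <- T) t.1.1 *: (i t.1.2 * x * i t.2).
Proof.
pose Rep (o : R -> R) := exists T : seq (C * A * A),
  forall x, o x = \sum_(t <- T) t.1.1 *: (i t.1.2 * x * i t.2).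
have Rep0 : Rep (fun=> 0) by exists [::] => x; rewrite big_nil.
have RepD c (o1 o2 o : R -> R) : Rep o1 -> Rep o2 ->
    (forall x, o x = c *: o1 x + o2 x) -> Rep o.
  move=> [T1 h1] [T2 h2] h; exists ([seq (c * t.1.1, t.1.2, t.2) | t <- T1] ++ T2) => x.
  rewrite h h1 h2 big_cat big_map scaler_sumr; congr (_ + _).
  by apply: eq_bigr => t _ /=; rewrite scalerA.
have RepM a b : Rep (fun x => a * x * b).
  have sl : subspace [set a | forall b, Rep (fun x => a * x * b)].
    split; first by move=> b'; have [T hT] := Rep0; exists T => x; rewrite !mul0r -hT.
    move=> c p q hp hq b'; apply: RepD (hp b') (hq b') _ => x.
    by rewrite !mulrDl -!scalerAl.
  apply: (lin_span_min sl _ (span a)) => _ [a' _ <-] {}b.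
  have sr : subspace [set b | Rep (fun x => i a' * x * b)].
    split; first by have [T hT] := Rep0; exists T => x; rewrite mulr0 -hT.
    move=> c p q hp hq; apply: RepD hp hq _ => x.
    by rewrite mulrDr -scalerAr.
  apply: (lin_span_min sr _ (span b)) => _ [b' _ <-].
  by exists [:: (1, a', b')] => x; rewrite big_seq1 scale1r.
elim: s => [|[a b] s IH].
  by have [T hT] := Rep0; exists T => x; rewrite mult_op_nil -hT.
apply: (RepD 1 _ _ _ (RepM a b) IH) => x.
by rewrite mult_op_cons scale1r.
Qed.

Lemma common_denom (cs : seq C) : exists I : set A, nz_ideal I /\
  forall c, c \in cs -> forall x, I x -> exists y, c *: i x = i y.
Proof.
elim: cs => [|c cs [J [nJ hJ]]].
  exists [set: A]; split=> //; exact: nz_idealT.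
have [I [nI hI]] := denom c; exists (I `&` J); split; first exact: nz_idealI.
by move=> d; rewrite inE => /predU1P[->|/hJ h] x [Ix Jx]; [exact: hI|exact: h].
Qed.

Lemma one_in_ideal_span (J : set A) : nz_ideal J -> lin_span [set i x | x in J] 1.
Proof.
move=> [iJ [y Jy y0]].
have [|s [_ <-]] := scalar_valued_op Rprime Rclosed Rfd (r := i y).
  by move=> e; apply: y0; apply: (embI emb_i); rewrite e (emb_zero emb_i).
have [T ->] := mult_op_expand s.
have sS := @lin_span_subspace C R [set i x | x in J].
apply: (subspace_sum sS) => t _; apply: (subspaceZ sS); apply: lin_span_gen.
exists (amul (amul t.1.2 y) t.2); last by rewrite !(embM emb_i).
case: iJ => _ _ _ iJ; have [ty _] := iJ t.1.2 y Jy.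
by have [] := iJ t.2 _ ty.
Qed.

(** An operator with scalar values on the closure becomes, after clearing
    denominators, an operator with coefficients in [A] and central values. *)
Theorem central_valued_op (I : set A) : nz_ideal I -> exists s : seq (A * A),
  (forall x, center A (amul_op s x)) /\
  exists u, [/\ I u, I (amul_op s u) & amul_op s u <> 0].
Proof.
move=> [iI [u Iu u0]].
have [|s [sC s1]] := scalar_valued_op Rprime Rclosed Rfd (r := i u).
  by move=> e; apply: u0; apply: (embI emb_i); rewrite e (emb_zero emb_i).
have [T hT] := mult_op_expand s.
have [J [nJ hJ]] := common_denom [seq t.1.1 | t <- T].
have [y [Jy hy]] : exists y, J y /\ mult_op s (i y * i u) <> 0.
  apply: contrapT => no.
  have sP : subspace [set r | mult_op s (r * i u) = 0].
    split; first by rewrite /= mul0r; apply: linear_at0 (mult_op_linear s).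
    move=> c p q /= hp hq.
    by rewrite mulrDl -scalerAl mult_op_linear hp hq scaler0 addr0.
  have : mult_op s (1 * i u) = 0.
    apply: (lin_span_min sP _ (one_in_ideal_span nJ)) => _ [y Jy <-] /=.
    by apply: contrapT => hy; apply: no; exists y.
  by move/eqP; rewrite mul1r s1 oner_eq0.
have [sA hsA] : exists sA, forall x, i (amul_op sA x) = mult_op s (i y * i x).
  under eq_exists do under eq_forall do rewrite hT.
  elim: T {hT} hJ => [|[[c a] b] T IH] hJ.
    by exists [::] => x; rewrite /amul_op !big_nil (emb_zero emb_i).
  have [|sA hsA] := IH; first by move=> d dT; apply: hJ; rewrite inE dT orbT.
  have Jay : J (amul a y) by case: nJ.1 => _ _ _ /(_ a y Jy)[].
  have [a' ha'] := hJ c (mem_head _ _) _ Jay.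
  exists ((a', b) :: sA) => x.
  rewrite /amul_op !big_cons (embD emb_i) -/(amul_op _ _) hsA; congr (_ + _).
  by rewrite !(embM emb_i) -ha' (embM emb_i) -!scalerAl !mulrA.
exists sA; split.
  move=> x a; apply: (embI emb_i); rewrite !(embM emb_i) hsA.
  by have [c ->] := sC (i y * i x); rewrite -scalerAl -scalerAr mul1r mulr1.
exists u; split=> //; last by move=> e; apply: hy; rewrite -hsA e (emb_zero emb_i).
apply: (subspace_sum (ideal_subspace iI)) => z _; case: iI => _ _ _ iI.
have [zu _] := iI z.1 u Iu.
by have [] := iI z.2 _ zu.
Qed.

End CentralOps.

(** The consequences for [A] of the finite dimension of its Martindale closure, in
    the form in which they pass to any central closure. *)
Theorem prime_PI_structure (F : fieldType) (A : assocAlgType F) :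
  [pchar F] =i pred0 -> prime_alg A -> PI_alg A ->
  (exists2 z : A, center A z & z <> 0) ->
  (forall I : set A, nz_ideal I -> exists s : seq (A * A),
    (forall x, center A (amul_op s x)) /\
    exists u, [/\ I u, I (amul_op s u) & amul_op s u <> 0]) /\
  exists (C : fieldType) (R : algType C) (k : {rmorphism F -> C}) (i : A -> R),
    [/\ alg_embedding k i, forall z, center A z -> exists c : C, i z = c%:A
    & forall s : seq (R * R), 1 <> \sum_(z <- s) (z.1 * z.2 - z.2 * z.1)].
Proof.
move=> charF pA PIA zA.
have nzA : exists a : A, a <> 0 by case: zA => z _ z0; exists z.
have [C [R [k [i [emb_i pR cR span denom]]]]] := martindale_closure pA zA.
have [n [g [g0 mg gid]]] := PI_multilinear emb_i PIA span.
have Rfd := PI_fin_dim pR cR g0 mg gid.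
split; first by move=> I nI; apply: (central_valued_op emb_i).
exists C, R, k, i; split=> //.
- move=> z zC; apply: cR; first by move/eqP; rewrite oner_eq0.
  move=> y; rewrite mul1r mulr1.
  have sP : subspace [set y | y * i z = i z * y].
    split; first by rewrite /= mul0r mulr0.
    by move=> c p q /= hp hq; rewrite mulrDl mulrDr -scalerAl -scalerAr hp hq.
  apply: (lin_span_min sP _ (span y)) => _ [a _ <-] /=.
  by rewrite -!(embM emb_i) zC.
- move=> s; apply: one_not_commutators => // p.
  by rewrite (fmorph_pchar k) charF.
Qed.

(** * Lie ideals and commutators in simple algebras *)

Section LieIdeals.
Variables (K : fieldType) (B : algType K).
Implicit Types (b c x y g : B) (L : set B).

Definition comm x y : B := x * y - y * x.

Lemma comm_gen x y : commutator_space B (comm x y).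
Proof. by apply: lin_span_gen; exists x, y. Qed.

Lemma commC x y : comm y x = - comm x y.
Proof. by rewrite /comm opprB. Qed.

Lemma commMr x y z : comm x (y * z) = comm x y * z + y * comm x z.
Proof. by rewrite /comm mulrBl mulrBr !mulrA addrA subrK. Qed.

Lemma commDr x y z : comm x (y + z) = comm x y + comm x z.
Proof. by rewrite /comm mulrDr mulrDl opprD addrACA. Qed.

Lemma comm_linear x : linear (comm x).
Proof. by move=> a y z; rewrite commDr /comm -scalerAr -scalerAl -scalerBr. Qed.

Lemma comm_linearl x : linear (comm^~ x).
Proof.
by move=> a y z; rewrite /comm mulrDl mulrDr -scalerAl -scalerAr opprD addrACA -scalerBr.
Qed.

Definition comm_sub := @lin_span_subspace K B [set c | exists x y : B, c = x * y - y * x].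

Hypothesis Bsimple : forall b, b <> 0 -> exists s : seq (B * B), mult_op s b = 1.

Lemma simple_prime : prime_ring B.
Proof.
move=> a b h; have [->|/eqP a0] := eqVneq a 0; first by left.
right; have [s hs] := Bsimple a0.
rewrite -[b]mul1r -hs /mult_op mulr_suml big1 // => z _.
by rewrite -!mulrA [a * _]mulrA h mulr0.
Qed.

Definition lie_ideal L := subspace L /\ forall b l, L l -> L (comm b l).

(** Herstein: the elements [x] with [[x, B]] inside [L] form a subalgebra [T]
    containing [L] that is a Lie ideal.  If two elements of [T] do not commute,
    their commutator generates a two-sided ideal inside [T], so [T] is everything; if
    [T] is commutative, each [l] in [L] satisfies [[l, [l, b]] = 0], and the
    derivation [[l, -]], having square zero, vanishes in characteristic not 2. *)
Theorem herstein_lie_ideal L : 2%:R != 0 :> K -> lie_ideal L ->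
  (forall l b, L l -> comm l b = 0) \/ commutator_space B `<=` L.
Proof.
move=> char2 [sL lL].
pose T := [set x | forall b, L (comm x b)].
have LT : L `<=` T by move=> l Ll b; rewrite commC; apply/(subspaceN sL)/lL.
have sT : subspace T.
  split; first by move=> b; rewrite /comm mul0r mulr0 subrr; apply: sL.1.
  by move=> a x y Tx Ty b; rewrite comm_linearl; apply: sL.2.
have TM x y : T x -> T y -> T (x * y).
  move=> Tx Ty b.
  have -> : comm (x * y) b = comm x (y * b) + comm y (b * x).
    by rewrite /comm !mulrA subrKA.
  exact: (subspaceD sL).
have [[x [y [Tx Ty xy]]]|no] := pselect (exists x y, [/\ T x, T y & comm x y <> 0]).
  right.
  have TR b : T (comm x y * b).
    have -> : comm x y * b = comm x (y * b) - y * comm x b by rewrite commMr addrK.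
    by apply: (subspaceB sT); [apply: LT|apply: TM => //; apply: LT].
  have TLR b b' : T (b' * comm x y * b).
    have -> : b' * comm x y * b = comm x y * b * b' - comm (comm x y * b) b'.
      by move: (comm x y) => c; rewrite /comm opprB addrCA subrr addr0 mulrA.
    apply: (subspaceB sT); first by rewrite -mulrA; apply: TR.
    by apply: LT; apply: TR.
  have [s hs] := Bsimple xy.
  have TT b : T b.
    rewrite -[b]mul1r -hs /mult_op mulr_suml; apply: (subspace_sum sT) => z _.
    by rewrite -(mulrA _ z.2); apply: TLR.
  by apply: (lin_span_min sL) => _ [u [v ->]]; apply: TT.
left=> l b Ll.
have Tcomm x y : T x -> T y -> comm x y = 0.
  by move=> Tx Ty; apply: contrapT => h; apply: no; exists x, y.
have dd c : comm l (comm l c) = 0.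
  by apply: (Tcomm); [apply: (LT)|apply: (LT); apply: (LT _ Ll)].
have d2 c e : comm l c * comm l e = 0.
  have := dd (c * e); rewrite commMr commDr !commMr !dd mul0r mulr0 add0r addr0.
  rewrite -mulr2n -scaler_nat => /eqP; rewrite scaler_eq0 (negPf char2) /=.
  by move/eqP.
have [c|//|//] := simple_prime (a := comm l b) (b := comm l b).
by have := d2 b (c * b); rewrite commMr mulrDr !mulrA d2 mul0r add0r.
Qed.

Hypothesis one_notin : ~ commutator_space B 1.

(** [1] is a sum of elements [p g q], and [p g q] is congruent to [g q p] modulo
    commutators. *)
Lemma commutator_nondegenerate g :
  (forall b, commutator_space B (g * b)) -> g = 0.
Proof.
move=> h; apply: contrapT => /Bsimple[s hs]; apply: one_notin.
rewrite -hs; apply: (subspace_sum comm_sub) => z _.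
rewrite -[z.1 * g * z.2](subrK (g * (z.2 * z.1))).
apply: (subspaceD comm_sub); last exact: h.
have -> : z.1 * g * z.2 - g * (z.2 * z.1) = comm z.1 (g * z.2) by rewrite /comm !mulrA.
exact: comm_gen.
Qed.

(** Modulo commutators the operator is [x |-> w x], where [w] is the sum of the
    [b_i a_i]; so [w B] is inside [K + [B, B]], and so is the ideal generated by
    [w], which is not zero because [1] is not in [[B, B]]. *)
Lemma commutator_codim1 (s : seq (B * B)) :
  (forall x, exists c : K, mult_op s x = c%:A) -> (exists x, mult_op s x <> 0) ->
  forall b, exists c : K, commutator_space B (b - c%:A).
Proof.
move=> sC [x0 hx0].
pose w := \sum_(z <- s) z.2 * z.1.
have sw x : commutator_space B (mult_op s x - w * x).
  rewrite /w mulr_suml -sumrB; apply: (subspace_sum comm_sub) => z _.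
  have -> : z.1 * x * z.2 - z.2 * z.1 * x = comm (z.1 * x) z.2 by rewrite /comm !mulrA.
  exact: comm_gen.
pose P := [set b | exists c : K, commutator_space B (b - c%:A)].
have sP : subspace P.
  split; first by exists 0; rewrite scale0r subr0; apply: comm_sub.1.
  move=> a x y [c hx] [d hy]; exists (a * c + d).
  rewrite scalerDl -scalerA opprD addrACA -scalerBr; exact: comm_sub.2.
have Pw x : P (w * x).
  have [c hc] := sC x; exists c; rewrite -opprB -hc.
  by apply: (subspaceN comm_sub); apply: sw.
have w0 : w <> 0.
  move=> w0; have [c hc] := sC x0; have := sw x0; rewrite w0 mul0r subr0 hc.
  have c0 : c != 0 by apply/eqP => c0; apply: hx0; rewrite hc c0 scale0r.
  by move=> /(subspaceZ comm_sub c^-1); rewrite scalerK.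
have [t ht] := Bsimple w0.
move=> b; suff : P b by [].
rewrite -[b]mul1r -ht /mult_op mulr_suml; apply: (subspace_sum sP) => z _.
have [c hc] := Pw (z.2 * b * z.1); exists c.
rewrite -[z.1 * w * z.2 * b](subrK (w * (z.2 * b * z.1))) -addrA.
apply: (subspaceD comm_sub) => //.
have -> : z.1 * w * z.2 * b - w * (z.2 * b * z.1) = comm z.1 (w * z.2 * b).
  by rewrite /comm !mulrA.
exact: comm_gen.
Qed.

End LieIdeals.

(** * The central closure of a prime PI algebra *)

Section CentralClosure.
Variables (F : fieldType) (A : assocAlgType F) (K : fieldType) (B : algType K).
Variable j : A -> B.
Hypothesis ccj : central_closure j.
Hypothesis zA : exists2 z : A, center A z & z <> 0.

Let jI : injective j. Proof. by case: ccj. Qed.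
Let jD a b : j (a + b) = j a + j b. Proof. by case: ccj => _ [h _] _ _ _. Qed.
Let jM a b : j (amul a b) = j a * j b. Proof. by case: ccj => _ [_ h] _ _ _. Qed.
Let j0 : j 0 = 0. Proof. by apply: (addrI (j 0)); rewrite -jD !addr0. Qed.

Lemma closure_center z : center A z -> exists k : K, j z = k%:A.
Proof. by case: ccj => _ _ h _ _; apply: h. Qed.

Lemma closure_center_neq0 z : center A z -> z <> 0 ->
  exists2 k : K, k != 0 & j z = k%:A.
Proof.
move=> zC zn0; have [k hk] := closure_center zC; exists k => //.
by apply: contra_not_neq zn0 => k0; apply: jI; rewrite hk k0 scale0r j0.
Qed.

Let jZ z (k : K) b : j z = k%:A -> j z * b = k *: b.
Proof. by move=> ->; rewrite -scalerAl mul1r. Qed.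

Lemma closure_frac_center b : exists z a (k : K),
  [/\ center A z, k != 0, j z = k%:A & k *: b = j a].
Proof.
case: ccj => _ _ _ _ /(_ b)[z [a [zC z0 e]]].
have [k k0 hk] := closure_center_neq0 zC z0; exists z, a, k; split=> //.
by rewrite -e (jZ _ hk).
Qed.

Lemma closure_frac b : exists a (k : K), k != 0 /\ k *: b = j a.
Proof. by have [z [a [k [_ k0 _ e]]]] := closure_frac_center b; exists a, k. Qed.

(** A scalar [c] of [F] acts on [B] as the fraction of the central elements [c z]
    and [z]. *)
Lemma closure_embedding : exists k : {rmorphism F -> K}, alg_embedding k j.
Proof.
have [z zC z0] := zA; have [k0 k0n hk0] := closure_center_neq0 zC z0.
have /choice[s hs] : forall c : F, exists k : K, forall a, j (c *: a) = k *: j a.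
  move=> c; have czC : center A (c *: z).
    by move=> a; rewrite amulZl amulZr zC.
  have [k1 hk1] := closure_center czC; exists (k0^-1 * k1) => a.
  apply: (scalerI k0n); rewrite scalerA mulrA divff // mul1r.
  by rewrite -(jZ _ hk0) -jM amulZr -amulZl jM (jZ _ hk1).
have jz : j z != 0 by apply/eqP => e; apply: z0; apply: jI; rewrite e j0.
have inj k k' : k *: j z = k' *: j z -> k = k'.
  move/eqP; rewrite -subr_eq0 -scalerBl scaler_eq0 (negPf jz) orbF subr_eq0.
  by move/eqP.
have sB : zmod_morphism s.
  move=> c d; apply: inj; rewrite scalerBl -!hs scalerBl.
  by apply: (addIr (j (d *: z))); rewrite -jD !subrK.
have sM : monoid_morphism s.
  split; first by apply: inj; rewrite -hs !scale1r.
  by move=> c d; apply: inj; rewrite -hs -!scalerA hs hs.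
pose sb := GRing.isZmodMorphism.Build F K s sB.
pose sm := GRing.isMonoidMorphism.Build F K s sM.
pose S : {rmorphism F -> K} := HB.pack s sb sm.
exists S; split=> // e he.
have : j z * j e = j z * 1 by rewrite -jM (he z).2 mulr1.
by rewrite hk0 -!scalerAl !mul1r => /(scalerI k0n).
Qed.

Lemma closure_central b : (forall a, b * j a = j a * b) -> exists k : K, b = k%:A.
Proof.
move=> h; have [a [k [k0 e]]] := closure_frac b.
have aC : center A a.
  by move=> x; apply: jI; rewrite !jM -e -scalerAl -scalerAr h.
have [l hl] := closure_center aC; exists (k^-1 * l).
by rewrite -scalerA -hl -e scalerA mulVf // scale1r.
Qed.

Hypotheses (charF : [pchar F] =i pred0) (pA : prime_alg A) (PIA : PI_alg A).

Lemma closure_pchar : [pchar K] =i pred0.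
Proof.
by have [k _] := closure_embedding => p; rewrite (fmorph_pchar k) charF.
Qed.

Let struct := prime_PI_structure charF pA PIA zA.

(** A nonzero ideal of [B] meets [A] in a nonzero ideal, which contains a nonzero
    central element; this element is invertible in [B]. *)
Lemma closure_simple b : b <> 0 -> exists s : seq (B * B), mult_op s b = 1.
Proof.
move=> b0; have [a [k [k0 e]]] := closure_frac b.
have a0 : a <> 0.
  move=> a0; move: e; rewrite a0 j0 => /eqP; rewrite scaler_eq0 (negPf k0) /=.
  by move/eqP.
have [s [sC [u [_ us us0]]]] := struct.1 _ (nz_principal_ideal pA a0).
have [l l0 hl] := closure_center_neq0 (sC u) us0.
have [kk emb_j] := closure_embedding.
have sP : subspace [set x | exists s : seq (B * B), mult_op s b = j x].
  split; first by exists [::]; rewrite mult_op_nil j0.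
  move=> c x y [s1 h1] [s2 h2].
  exists ([seq (kk c *: z.1, z.2) | z <- s1] ++ s2).
  rewrite mult_op_cat h2 jD (embZ emb_j) -h1; congr (_ + _).
  rewrite /mult_op big_map scaler_sumr; apply: eq_bigr => z _ /=.
  by rewrite -!scalerAl.
have [t ht] : exists t : seq (B * B), mult_op t b = j (amul_op s u).
  apply: (lin_span_min sP _ us) => _ [x [y ->]]; exists [:: (k *: j x, j y)].
  rewrite mult_op_cons mult_op_nil addr0 /= !jM -e.
  by rewrite -!scalerAl -!scalerAr -!scalerAl.
exists [seq (l^-1 *: z.1, z.2) | z <- t].
have -> : mult_op [seq (l^-1 *: z.1, z.2) | z <- t] b = l^-1 *: mult_op t b.
  rewrite /mult_op big_map scaler_sumr; apply: eq_bigr => z _ /=.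
  by rewrite -!scalerAl.
by rewrite ht hl scalerA mulVf // scale1r.
Qed.

Lemma closure_scalar_op : exists s : seq (B * B),
  (forall x, exists c : K, mult_op s x = c%:A) /\ exists x, mult_op s x <> 0.
Proof.
have nzA : exists a : A, a <> 0 by case: zA => z _ z0; exists z.
have [s [sC [u [_ _ us0]]]] := struct.1 _ (nz_idealT nzA).
have [kk emb_j] := closure_embedding.
exists [seq (j z.1, j z.2) | z <- s]; split; last first.
  by exists (j u); rewrite -(emb_amul_op emb_j) => e; apply: us0; apply: jI; rewrite e j0.
move=> b; have [a [k [k0 e]]] := closure_frac b.
have [c hc] := closure_center (sC a); exists (k^-1 * c).
rewrite -scalerA -hc (emb_amul_op emb_j) -e.
have := mult_op_linear [seq (j z.1, j z.2) | z <- s] k b 0.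
rewrite (linear_at0 (mult_op_linear _)) !addr0 => ->.
by rewrite scalerA mulVf // scale1r.
Qed.

(** Clearing denominators, [1] in [[B, B]] would give a nonzero central element
    of [A] that is a sum of commutators. *)
Lemma closure_one_notin : ~ commutator_space B 1.
Proof.
have [_ [C [R [k [i [emb_i cen ncomm]]]]]] := struct.
pose csum (s : seq (A * A)) : A := \sum_(z <- s) (amul z.1 z.2 - amul z.2 z.1).
have [kk emb_j] := closure_embedding.
have csumZ w s : center A w -> exists t, csum t = amul w (csum s).
  move=> wC; exists [seq (amul w z.1, z.2) | z <- s].
  rewrite /csum big_map.
  elim: s => [|z s IH]; first by rewrite !big_nil amul0r.
  rewrite !big_cons amulDr -IH amulBr /= !amulA; congr (_ - _ + _).
  by rewrite -amulA wC !amulA -wC !amulA.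
pose P := [set b : B | exists z k s,
  [/\ center A z, k != 0, j z = k%:A & k *: b = j (csum s)]].
have cenM z w : center A z -> center A w -> center A (amul z w).
  by move=> zC wC a; rewrite -amulA wC amulA zC amulA.
have sP : subspace P.
  split.
    have [z zC z0] := zA; have [l l0 hl] := closure_center_neq0 zC z0.
    by exists z, l, [::]; rewrite scaler0 /csum big_nil j0.
  move=> c x y [z [k1 [s [zC k10 hz hx]]]] [w [k2 [t [wC k20 hw hy]]]].
  case: ccj => _ _ _ /(_ c)[v [v' [vC v0 vC' hv]]] _.
  have [n n0 hn] := closure_center_neq0 vC v0; have [n' hn'] := closure_center vC'.
  have [s' hs'] := csumZ (amul w v') s (cenM _ _ wC vC').
  have [t' ht'] := csumZ (amul v z) t (cenM _ _ vC zC).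
  have nc : n * c = n'.
    move: hv; rewrite (jZ _ hn) hn' scalerA => /eqP.
    by rewrite -subr_eq0 -scalerBl scaler_eq0 oner_eq0 orbF subr_eq0 => /eqP.
  exists (amul (amul v z) w), (n * k1 * k2), (s' ++ t'); split.
  - by apply: (cenM) => //; apply: (cenM).
  - by rewrite !mulf_neq0.
  - by rewrite !jM -mulrA (jZ _ hn) (jZ _ hz) hw !scalerA.
  rewrite /csum big_cat -!/(csum _) hs' ht' jD !jM -hx -hy.
  rewrite -!mulrA (jZ _ hw) (jZ _ hn') (jZ _ hn) (jZ _ hz) scalerDr !scalerA -nc.
  by congr (_ *: _ + _ *: _); ring.
move=> one; have [|z [l [s [zC l0 hz]]]] := lin_span_min sP _ one.
  move=> _ [x [y ->]].
  have [z [a [k1 [zC k10 hz ha]]]] := closure_frac_center x.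
  have [w [b [k2 [wC k20 hw hb]]]] := closure_frac_center y.
  exists (amul z w), (k1 * k2), [:: (a, b)]; split.
  - exact: cenM.
  - by rewrite mulf_neq0.
  - by rewrite jM (jZ _ hz) hw scalerA.
  rewrite /csum big_seq1 /= (embB emb_j) !jM -ha -hb scalerBr.
  by rewrite -!scalerAl -!scalerAr !scalerA (mulrC k2).
rewrite -hz => /jI ez.
have [c hc] := cen z zC.
have c0 : c != 0.
  apply: contraNneq l0 => c0.
  have z0 : z = 0 by apply: (embI emb_i); rewrite hc c0 scale0r (emb_zero emb_i).
  by move: hz; rewrite z0 j0 => /esym/eqP; rewrite scaler_eq0 oner_eq0 orbF.
apply: (ncomm [seq (c^-1 *: i z.1, i z.2) | z <- s]).
have -> : 1 = c^-1 *: i z by rewrite hc scalerA mulVf // scale1r.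
rewrite ez big_map (emb_sum emb_i) scaler_sumr; apply: eq_bigr => y _ /=.
by rewrite (embB emb_i) !(embM emb_i) scalerBr scalerAl scalerAr.
Qed.

End CentralClosure.

(** * Evaluation, derivatives and cyclic derivatives *)

Section MalgVal.
Variables (F K : fieldType) (B : algType K) (k : {rmorphism F -> K}).
Variables (I : choiceType) (V : I -> B).
Implicit Types f g : {malg F[{fmonom I}]}.

Definition fmonom_eval (w : {fmonom I}) : B := word_val V w.

Fact fmonom_eval_mmorphism : mmorphism fmonom_eval.
Proof.
split=> [u v|]; rewrite /fmonom_eval /word_val; last by rewrite fm1 big_nil.
by rewrite fmM big_cat.
Qed.
HB.instance Definition _ := monalg.isMultiplicative.Build _ _ fmonom_eval fmonom_eval_mmorphism.

Local Notation ink := (GRing.in_alg B \o k).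

Lemma malg_val_mmap f : malg_val k V f = mmap ink fmonom_eval f.
Proof. by apply: eq_bigr => w _; rewrite /= -scalerAl mul1r. Qed.

Lemma malg_valB f g : malg_val k V (f - g) = malg_val k V f - malg_val k V g.
Proof. by rewrite !malg_val_mmap mmapB. Qed.

Lemma malg_val_sum (T : Type) (s : seq T) (h : T -> {malg F[{fmonom I}]}) :
  malg_val k V (\sum_(t <- s) h t) = \sum_(t <- s) malg_val k V (h t).
Proof.
rewrite malg_val_mmap raddf_sum; apply: eq_bigr => t _.
by rewrite malg_val_mmap.
Qed.

Lemma malg_valZ c f : malg_val k V (c *: f) = k c *: malg_val k V f.
Proof. by rewrite !malg_val_mmap mmapZ /= -scalerAl mul1r. Qed.

Lemma malg_valU w : malg_val k V << w >> = word_val V w.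
Proof. by rewrite malg_val_mmap mmapU /= rmorph1 scale1r mul1r. Qed.

Lemma malg_valM f g : malg_val k V (f * g) = malg_val k V f * malg_val k V g.
Proof.
rewrite !malg_val_mmap.
have comm (p : {malg F[{fmonom I}]}) m m' : GRing.comm (ink p@_m) (fmonom_eval m').
  by rewrite /GRing.comm /= -scalerAl -scalerAr mul1r mulr1.
by have [-> _] := commr_mmap_is_multiplicative comm.
Qed.

End MalgVal.

Section PolynomialPath.
Variables (K : fieldType) (B : algType K).

(** If [p] is the polynomial with vector coefficients [c], then [p(2n) - 2^N p(n)]
    has degree less than [N], and its coefficients are nonzero multiples of those
    of [p] in characteristic 0. *)
Lemma coefs_in_subspace (L : set B) N (c : nat -> B) : [pchar K] =i pred0 ->
  subspace L -> (forall n : nat, L (\sum_(m < N) n%:R ^+ m *: c m)) ->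
  forall m, (m < N)%N -> L (c m).
Proof.
move=> /pcharf0P charK sL; elim: N c => // N IH c hc.
have low m : (m < N)%N -> L (c m).
  move=> mN; pose d m : K := 2%:R ^+ m - 2%:R ^+ N.
  have d0 : d m != 0.
    rewrite subr_eq0 -!natrX; apply/eqP => e.
    have : (2 ^ N - 2 ^ m)%:R == 0 :> K.
      by rewrite natrB ?e ?subrr // leq_exp2l // ltnW.
    by rewrite charK subn_eq0 leq_exp2l // leqNgt mN.
  rewrite -[c m](scalerK d0); apply: (subspaceZ sL).
  apply: (IH (fun m => d m *: c m)) => // n.
  have := subspaceB sL (hc (2 * n)%N) (subspaceZ sL (2%:R ^+ N) (hc n)).
  rewrite !big_ord_recr /= scalerDr scaler_sumr opprD addrACA scalerA.
  rewrite natrM exprMn subrr addr0 -sumrB.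
  congr (L _); apply: eq_bigr => i _; rewrite exprMn !scalerA -scalerBl.
  by congr (_ *: _); rewrite /d; ring.
move=> m; rewrite ltnS leq_eqVlt => /predU1P[->|]; last exact: low.
have := hc 1%N; rewrite big_ord_recr /= expr1n scale1r => h.
rewrite -[c N](addKr (\sum_(i < N) 1%:R ^+ i *: c i)) addrC.
apply: (subspaceB sL) => //; apply: (subspace_sum sL) => i _.
by apply: (subspaceZ sL); apply: low.
Qed.

Variable I : eqType.
Implicit Types (V H : I -> B) (w : seq I) (l : seq (K * seq I)).

(** The coefficient of [t^m] in the value of the word [w] at [V + t H]. *)
Fixpoint path_coef V H w (m : nat) : B :=
  if w is x :: w' then
    V x * path_coef V H w' m + (if m is m'.+1 then H x * path_coef V H w' m' else 0)
  else (m == 0)%:R.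

Lemma word_val_path V H w N n : (size w < N)%N ->
  word_val (fun x => V x + n%:R *: H x) w =
  \sum_(m < N) n%:R ^+ m *: path_coef V H w m.
Proof.
elim: w N => [|x w IH] [|N] //= lt.
  rewrite /word_val big_nil big_ord_recl /= expr0 scale1r big1 ?addr0 // => i _.
  by rewrite scaler0.
rewrite /word_val big_cons -/(word_val _ w) mulrDl {1}(IH N.+1) ?(ltnW lt) //.
rewrite (IH N) // [in RHS]big_ord_recl [in LHS]big_ord_recl /= addr0.
rewrite !mulrDr -!scalerAr -addrA; congr (_ + _).
rewrite !mulr_sumr -big_split /=; apply: eq_bigr => i _.
by rewrite scalerDr -scalerAr -scalerAl -scalerAr scalerA exprS.
Qed.

Lemma path_coef0 V H w : path_coef V H w 0 = word_val V w.
Proof.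
by elim: w => [|x w IH] /=; rewrite /word_val ?big_nil // big_cons IH addr0.
Qed.

Definition word_deriv V H w := path_coef V H w 1.

Lemma word_deriv_nil V H : word_deriv V H [::] = 0. Proof. by []. Qed.

Lemma word_deriv_cons V H x w :
  word_deriv V H (x :: w) = V x * word_deriv V H w + H x * word_val V w.
Proof. by rewrite /word_deriv /= path_coef0. Qed.

Definition poly_deriv V H l := \sum_(m <- l) m.1 *: word_deriv V H m.2.

Lemma word_size_bound l : exists N, (1 < N)%N /\ forall m, m \in l -> (size m.2 < N)%N.
Proof.
elim: l => [|m l [N [N1 hN]]]; first by exists 2%N.
exists (maxn (size m.2).+1 N); split; first by rewrite leq_max N1 orbT.
by move=> m'; rewrite inE leq_max => /predU1P[->|/hN ->]; rewrite ?leqnn ?orbT.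
Qed.

Lemma poly_deriv_in (L : set B) V H l : [pchar K] =i pred0 -> subspace L ->
  (forall n : nat, L (poly_val (fun x => V x + n%:R *: H x) l)) ->
  L (poly_deriv V H l).
Proof.
move=> charK sL h; have [N [N1 hN]] := word_size_bound l.
pose c m := \sum_(t <- l) t.1 *: path_coef V H t.2 m.
apply: (coefs_in_subspace (N := N) (c := c) charK sL _ N1) => n.
rewrite [X in L X](_ : _ = poly_val (fun x => V x + n%:R *: H x) l) //.
under eq_bigr do rewrite /c scaler_sumr.
rewrite exchange_big; apply: eq_big_seq => t /hN tN /=.
rewrite (word_val_path V H n tN) scaler_sumr; apply: eq_bigr => i _.
by rewrite !scalerA mulrC.
Qed.

Lemma word_val_scale V (a : K) w :
  word_val (fun x => a *: V x) w = a ^+ size w *: word_val V w.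
Proof.
elim: w => [|x w IH]; first by rewrite /word_val !big_nil scale1r.
rewrite /word_val !big_cons -!/(word_val _ w) IH -scalerAl -scalerAr scalerA.
by rewrite exprS.
Qed.

Definition homogeneous_part d l := [seq m <- l | size m.2 == d].

Lemma sum_homogeneous (X : K * seq I -> B) l N :
  (forall m, m \in l -> (size m.2 < N)%N) ->
  \sum_(m <- l) X m = \sum_(d < N) \sum_(m <- homogeneous_part d l) X m.
Proof.
move=> hN; rewrite /homogeneous_part; under [RHS]eq_bigr do rewrite big_filter.
rewrite (exchange_big_dep predT) //=; apply: eq_big_seq => m /hN mN.
by rewrite (big_pred1 (Ordinal mN)) // => i; apply: eq_sym.
Qed.

Lemma homogeneous_part_in (L : set B) V l : [pchar K] =i pred0 -> subspace L ->
  (forall n : nat, L (poly_val (fun x => n%:R *: V x) l)) ->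
  forall d, L (poly_val V (homogeneous_part d l)).
Proof.
move=> charK sL h d; have [N [N1 hN]] := word_size_bound l.
have [dN|Nd] := ltnP d N; last first.
  rewrite /poly_val /homogeneous_part big_filter big_seq_cond big1 //; first exact: sL.1.
  by move=> m /andP[/hN lt /eqP e]; move: lt; rewrite e ltnNge Nd.
apply: (coefs_in_subspace (c := fun d => poly_val V (homogeneous_part d l)) charK sL _ dN) => n.
rewrite [X in L X](_ : _ = poly_val (fun x => n%:R *: V x) l) //.
rewrite /poly_val (sum_homogeneous _ hN); apply: eq_bigr => d' _.
rewrite scaler_sumr /= /homogeneous_part !big_filter; apply: eq_bigr => m /eqP e.
by rewrite word_val_scale e !scalerA mulrC.
Qed.

Lemma word_deriv_comm V (a : B) w :
  word_deriv V (fun x => comm a (V x)) w = comm a (word_val V w).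
Proof.
elim: w => [|x w IH].
  by rewrite word_deriv_nil /word_val big_nil /comm mulr1 mul1r subrr.
by rewrite word_deriv_cons IH /word_val big_cons commMr addrC /=.
Qed.

Lemma poly_deriv_comm V (a : B) l :
  poly_deriv V (fun x => comm a (V x)) l = comm a (poly_val V l).
Proof.
rewrite /poly_deriv /poly_val /comm mulr_sumr mulr_suml -sumrB.
apply: eq_bigr => m _.
by rewrite word_deriv_comm /comm scalerBr -scalerAr -scalerAl.
Qed.

Lemma word_derivE V H w x0 : word_deriv V H w =
  \sum_(p < size w) word_val V (take p w) * H (nth x0 w p) * word_val V (drop p.+1 w).
Proof.
elim: w => [|x w IH]; first by rewrite big_ord0.
rewrite word_deriv_cons IH big_ord_recl /= drop0 [word_val V [::]]/word_val big_nil mul1r addrC.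
congr (_ + _); rewrite mulr_sumr; apply: eq_bigr => p _.
by rewrite /word_val /= big_cons !mulrA.
Qed.

End PolynomialPath.

Section CyclicDerivative.
Variables (K : fieldType) (B : algType K) (I : eqType) (x0 : I).
Implicit Types (V H : I -> B) (w : seq I) (l : seq (K * seq I)).

(** The rotation of [w] that ends at its letter of index [p], without that
    letter. *)
Definition rot_rest p w : seq I := drop p.+1 w ++ take p w.

Lemma rot_restE p w : (p < size w)%N -> rot p.+1 w = rcons (rot_rest p w) (nth x0 w p).
Proof. by move=> lt; rewrite /rot (take_nth x0) // rcons_cat. Qed.

(** For [H = V] this is the sum over the words of all their rotations. *)
Definition cyclic_form V H l : B := \sum_(m <- l) m.1 *:
  \sum_(p < size m.2) word_val V (rot_rest p m.2) * H (nth x0 m.2 p).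

(** Modulo commutators the derivative of a polynomial in the direction [H] is
    linear in [H] with the directions moved to the right. *)
Lemma poly_deriv_cyclic V H l :
  commutator_space B (poly_deriv V H l - cyclic_form V H l).
Proof.
rewrite /poly_deriv -sumrB; apply: (subspace_sum (@comm_sub K B)) => m _.
rewrite -scalerBr; apply: (subspaceZ (@comm_sub K B)).
rewrite (word_derivE V H m.2 x0) -sumrB.
apply: (subspace_sum (@comm_sub K B)) => p _.
set u := word_val V (take p _); set v := word_val V (drop _ _); set h := H _.
have -> : u * h * v - word_val V (rot_rest p m.2) * h = comm (u * h) v.
  by rewrite /comm /rot_rest [word_val V (_ ++ _)]/word_val big_cat -!/(word_val _ _) !mulrA.
exact: comm_gen.
Qed.

(** The value at [V] of the cyclic derivative with respect to the letter [x]. *)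
Definition cyclic_coef V x l : B := \sum_(m <- l) m.1 *:
  \sum_(p < size m.2 | nth x0 m.2 p == x) word_val V (rot_rest p m.2).

Lemma cyclic_form_letters V H l (s : seq I) : uniq s ->
  (forall m x, m \in l -> x \in m.2 -> x \notin s -> H x = 0) ->
  cyclic_form V H l = \sum_(x <- s) cyclic_coef V x l * H x.
Proof.
move=> us hs; rewrite /cyclic_form.
under [RHS]eq_bigr do rewrite mulr_suml.
rewrite exchange_big; apply: eq_big_seq => m ml /=.
under [RHS]eq_bigr do rewrite -scalerAl.
rewrite -scaler_sumr; congr (_ *: _).
under [RHS]eq_bigr do rewrite mulr_suml.
rewrite (exchange_big_dep predT) //=; apply: eq_bigr => p _.
have [ps|ps] := boolP (nth x0 m.2 p \in s); last first.
  rewrite (hs m) ?mem_nth // mulr0 big_seq_cond big1 // => x /andP[xs /eqP e].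
  by rewrite e xs in ps.
rewrite big_mkcond (bigD1_seq _ ps us) /= eqxx big1 ?addr0 // => x /negPf ne.
by rewrite eq_sym ne.
Qed.

End CyclicDerivative.

(** * Values of polynomials with involution *)

(** For [f] without constant term, this is congruent to [f] modulo commutators;
    and it is a combination of the cyclic derivatives of the homogeneous parts of
    [f], multiplied by the letters, as in Euler's formula. *)
Definition cyclic_average (F : fieldType) (f : star_poly F) : star_poly F :=
  \sum_(w <- msupp f) \sum_(p < size w)
    (f@_w / (size w)%:R) *: << FMonom (rot p.+1 w) >>.

Lemma cyclic_average_equiv (F : fieldType) (f : star_poly F) :
  [pchar F] =i pred0 -> f@_(mone : {fmonom (nat + nat)%type}) = 0 ->
  cyc_equiv f (cyclic_average f).
Proof.
move=> /pcharf0P charF f1.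
pose P (h : star_poly F) := exists s : seq (star_poly F * star_poly F),
  h = \sum_(pq <- s) (pq.1 * pq.2 - pq.2 * pq.1).
have P0 : P 0 by exists [::]; rewrite big_nil.
have PD g h : P g -> P h -> P (g + h).
  by move=> [s ->] [t ->]; exists (s ++ t); rewrite big_cat.
have cU c w : c *: << w >> = << c *g w >> :> star_poly F.
  by apply/malgP => u; rewrite mcoeffZ !mcoeffU mulr_natr.
suff : P (f - cyclic_average f) by [].
have -> : f - cyclic_average f = \sum_(w <- msupp f) \sum_(p < size w)
    (f@_w / (size w)%:R) *: (<< w >> - << FMonom (rot p.+1 w) >>).
  rewrite {1}[f]monalgE /cyclic_average -sumrB; apply: eq_big_seq => w wf.
  under [RHS]eq_bigr do rewrite scalerBr.
  rewrite sumrB; congr (_ - _).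
  have w0 : (size w)%:R != 0 :> F.
    rewrite charF size_eq0; apply: contraTneq wf => e.
    have -> : w = mone by apply: val_inj; rewrite /= fm1.
    by rewrite -mcoeff_neq0 f1 eqxx.
  rewrite sumr_const card_ord -scaler_nat scalerA mulrC divfK //.
apply: (big_ind P) => // w _; apply: (big_ind P) => // p _.
set c := f@_w / (size w)%:R.
pose u := FMonom (take p.+1 w); pose v := FMonom (drop p.+1 w).
have uv : mmul u v = w by apply: val_inj; rewrite /= fmM cat_take_drop.
have vu : mmul v u = FMonom (rot p.+1 w) by apply: val_inj; rewrite /= fmM.
exists [:: (<< c *g u >>, << v >>)].
by rewrite big_seq1 !malgM_def !fgmulUU mulr1 mul1r uv vu scalerBr !cU.
Qed.

Section Star.
Variables (F : fieldType) (cj : {rmorphism F -> F}) (A : assocAlgType F).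
Variable star : A -> A.
Hypotheses (charF : [pchar F] =i pred0) (pA : prime_alg A) (PIA : PI_alg A).
Hypotheses (invol : involution_on cj star) (second : second_kind star).
Variables (K : fieldType) (B : algType K) (j : A -> B).
Hypothesis ccj : central_closure j.

Lemma star_add a b : star (a + b) = star a + star b. Proof. by case: invol. Qed.
Lemma star_mul a b : star (amul a b) = amul (star b) (star a). Proof. by case: invol. Qed.
Lemma starK a : star (star a) = a. Proof. by case: invol. Qed.
Lemma star0 : star 0 = 0.
Proof. by apply: (addrI (star 0)); rewrite -star_add !addr0. Qed.
Lemma starN a : star (- a) = - star a.
Proof. by apply: (addrI (star a)); rewrite -star_add !subrr star0. Qed.
Lemma starMn a n : star (a *+ n) = star a *+ n.
Proof. by elim: n => [|n IH]; rewrite ?star0 // !mulrS star_add IH. Qed.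

Lemma star_center z : center A z -> center A (star z).
Proof. by move=> zC a; rewrite -[a]starK -!star_mul zC. Qed.

Lemma skew_center : exists z, [/\ center A z, z <> 0 & star z = - z].
Proof.
have [z [zC zn]] := second; exists (z - star z); split.
- by move=> a; rewrite amulBl amulBr zC (star_center zC).
- by move/eqP; rewrite subr_eq0 => /eqP e; apply: zn.
- by rewrite star_add starN starK opprB addrC.
Qed.

Let zA : exists2 z : A, center A z & z <> 0.
Proof. by have [z [zC z0 _]] := skew_center; exists z. Qed.

Variable k : {rmorphism F -> K}.
Hypothesis emb_j : alg_embedding k j.

Let charK : [pchar K] =i pred0.
Proof. exact: closure_pchar ccj zA charF. Qed.

Definition star_point (a : nat -> A) (x : nat + nat) : B :=
  match x with inl n => j (a n) | inr n => j (star (a n)) end.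

Definition star_list (f : star_poly F) : seq (K * seq (nat + nat)) :=
  [seq (k f@_w, w : seq (nat + nat)) | w <- msupp f].

Lemma emb_star_eval f a : evaluable A f ->
  j (star_eval star a f) = malg_val k (star_point a) f.
Proof.
move=> ev; rewrite /star_eval (emb_eval emb_j) //.
apply: eq_bigr => w _; congr (_ *: _); apply: eq_word_val.
by case.
Qed.

Lemma star_list_val f (V : nat + nat -> B) : poly_val V (star_list f) = malg_val k V f.
Proof. by rewrite /poly_val big_map. Qed.

Lemma emb_mulrn a n : j (a *+ n) = n%:R *: j a.
Proof.
elim: n => [|n IH]; first by rewrite scale0r (emb_zero emb_j).
by rewrite mulrS (embD emb_j) IH -natr1 scalerDl scale1r addrC.
Qed.

Lemma star_point_path a h n x :
  star_point (fun i => a i + h i *+ n) x = star_point a x + n%:R *: star_point h x.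
Proof.
by case: x => i /=; rewrite ?star_add ?starMn (embD emb_j) emb_mulrn.
Qed.

Lemma star_point_scale a n x :
  star_point (fun i => a i *+ n) x = n%:R *: star_point a x.
Proof. by case: x => i /=; rewrite ?starMn emb_mulrn. Qed.

Lemma star_point_comm u a x : star u = - u ->
  star_point (fun i => amul u (a i) - amul (a i) u) x = comm (j u) (star_point a x).
Proof.
move=> su; case: x => i /=; rewrite /comm ?star_add ?starN ?star_mul ?su.
  by rewrite (embB emb_j) !(embM emb_j).
rewrite amulNr amulNl opprK addrC.
by rewrite (embB emb_j) !(embM emb_j).
Qed.

Section LieIdeal.
Variable L : set B.
Hypothesis sL : subspace L.

Lemma eq_poly_val (I : eqType) (V W : I -> B) l : V =1 W ->
  poly_val V l = poly_val W l.
Proof.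
move=> e; apply: eq_bigr => m _; congr (_ *: _); apply: eq_word_val => x _.
exact: e.
Qed.

(** Moving every variable along [[u, -]] with [u] skew is compatible with the
    involution, and moves the value of [f] along [[u, -]] as well. *)
Lemma values_comm_skew f u a : star u = - u ->
  (forall a, L (poly_val (star_point a) (star_list f))) ->
  L (comm (j u) (poly_val (star_point a) (star_list f))).
Proof.
move=> su hL; rewrite -poly_deriv_comm; apply: poly_deriv_in => // n.
have := hL (fun i => a i + (amul u (a i) - amul (a i) u) *+ n).
congr (L _); apply: eq_poly_val => x.
by rewrite star_point_path star_point_comm.
Qed.

End LieIdeal.

(** A nonzero skew central element turns symmetric elements into skew ones, and
    it is invertible in [B]. *)
Lemma skew_span (Q : set B) : subspace Q -> (forall u, star u = - u -> Q (j u)) ->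
  forall b, Q b.
Proof.
move=> sQ hQ; have [z [zC z0 zs]] := skew_center.
have [c c0 hc] := closure_center_neq0 ccj zC z0.
have sym s : star s = s -> Q (j s).
  move=> ss; rewrite -[j s](scalerK c0); apply: (subspaceZ sQ).
  have -> : c *: j s = j (amul z s) by rewrite (embM emb_j) hc -scalerAl mul1r.
  by apply: hQ; rewrite star_mul ss zs amulNr zC.
have Qj a : Q (j a).
  have two : 2%:R != 0 :> K by have /pcharf0P -> := charK.
  rewrite -[j a](scalerK two) -emb_mulrn [a *+ 2]mulr2n; apply: (subspaceZ sQ).
  have -> : a + a = (a + star a) + (a - star a) by rewrite addrACA subrr addr0.
  rewrite (embD emb_j); apply: (subspaceD sQ).
    by apply: sym; rewrite star_add starK addrC.
  by apply: hQ; rewrite star_add starN starK opprB addrC.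
move=> b; have [a [l [l0 e]]] := closure_frac ccj b.
by rewrite -[b](scalerK l0) e; apply: (subspaceZ sQ).
Qed.

Definition value_span f : set B :=
  lin_span [set poly_val (star_point a) (star_list f) | a in [set: nat -> A]].

Lemma value_span_lie f : lie_ideal (value_span f).
Proof.
have sL : subspace (value_span f) by apply: lin_span_subspace.
split=> // b l Ll.
have hL a : value_span f (poly_val (star_point a) (star_list f)).
  by apply: lin_span_gen; exists a.
pose Q := [set b | forall l, value_span f l -> value_span f (comm b l)].
suff h : Q b by apply: h.
apply: (skew_span (Q := Q)) => [|u su {}l {}Ll].
  split; first by move=> x _; rewrite /comm mul0r mulr0 subrr; apply: sL.1.
  by move=> c x y hx hy v hv; rewrite comm_linearl; apply: sL.2; [apply: hx|apply: hy].
have sP : subspace [set l | value_span f (comm (j u) l)].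
  split; first by rewrite /= /comm mul0r mulr0 subrr; apply: sL.1.
  by move=> c x y /= hx hy; rewrite comm_linear; apply: sL.2.
by apply: (lin_span_min sP _ Ll) => _ [a _ <-] /=; apply: values_comm_skew.
Qed.

Let Bsimple := closure_simple ccj zA charF pA PIA.
Let one_notin := closure_one_notin ccj zA charF pA PIA.

Section Traceless.
Variable l : seq (K * seq (nat + nat)).
Hypothesis traceless : forall a, commutator_space B (poly_val (star_point a) l).

Local Notation x0 := (inl 0%N : nat + nat).

Lemma homogeneous_traceless d a :
  commutator_space B (poly_val (star_point a) (homogeneous_part d l)).
Proof.
apply: homogeneous_part_in charK (@comm_sub K B) _ d => n.
have := traceless (fun i => a i *+ n); congr (commutator_space _ _).
by apply: eq_poly_val => x; rewrite star_point_scale.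
Qed.

(** Differentiating in the direction of one variable [X_i] gives
    [G h + G' h^* ] in [[B, B]] for all [h]; replacing [h] by [z h], where [z] is
    central and [z^*] differs from [z], separates [G] from [G']. *)
Lemma cyclic_coef_eq0 d a x : cyclic_coef x0 (star_point a) x (homogeneous_part d l) = 0.
Proof.
set ld := homogeneous_part d l; pose V := star_point a.
have sC := @comm_sub K B.
have form h : commutator_space B (cyclic_form x0 V (star_point h) ld).
  have D : commutator_space B (poly_deriv V (star_point h) ld).
    apply: poly_deriv_in charK sC _ => n.
    have := homogeneous_traceless d (fun i => a i + h i *+ n).
    congr (commutator_space _ _); apply: eq_poly_val => y.
    by rewrite star_point_path.
  rewrite -[cyclic_form _ _ _ _](subKr (poly_deriv V (star_point h) ld)).
  by apply: (subspaceB sC) => //; apply: poly_deriv_cyclic.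
pose G i := cyclic_coef x0 V (inl i) ld; pose G' i := cyclic_coef x0 V (inr i) ld.
have GG i y : commutator_space B (G i * j y + G' i * j (star y)).
  have := form (fun n => if n == i then y else 0).
  rewrite (@cyclic_form_letters _ _ _ x0 V _ _ [:: inl i; inr i]) //.
    by rewrite big_cons big_seq1 /= eqxx.
  move=> _ [] n _ _; rewrite !inE /= => ni.
    by rewrite ifN ?(emb_zero emb_j) //; apply: contra ni => /eqP ->; rewrite eqxx.
  rewrite ifN ?star0 ?(emb_zero emb_j) //.
have nondeg g : (forall y, commutator_space B (g * j y)) -> g = 0.
  move=> hg; apply: (commutator_nondegenerate Bsimple one_notin) => b.
  have [y [c [c0 e]]] := closure_frac ccj b.
  by rewrite -[b](scalerK c0) e -scalerAr; apply/(subspaceZ sC)/hg.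
have [z [zC z0 zs]] := skew_center.
have [c c0 hc] := closure_center_neq0 ccj zC z0.
have c2 : c + c != 0.
  by rewrite -mulr2n -mulr_natl mulf_neq0 //; have /pcharf0P -> := charK.
have GG' i y : commutator_space B (c *: (G i * j y - G' i * j (star y))).
  have := GG i (amul z y); rewrite star_mul zs amulNr -(zC (star y)).
  rewrite (embN emb_j) !(embM emb_j) hc -!scalerAl !mul1r.
  by rewrite -scalerN -!scalerAr mulrN -scalerDr.
have GG0 i y : commutator_space B (G i * j y) /\ commutator_space B (G' i * j (star y)).
  have hp := subspaceZ sC c (GG i y); have hm := GG' i y.
  split; rewrite -[X in commutator_space B X](scalerK c2); apply: (subspaceZ sC).
    have -> : (c + c) *: (G i * j y) =
      c *: (G i * j y + G' i * j (star y)) + c *: (G i * j y - G' i * j (star y)).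
      by rewrite scalerBr !scalerDr addrACA subrr addr0 scalerDl.
    exact: (subspaceD sC).
  have -> : (c + c) *: (G' i * j (star y)) =
    c *: (G i * j y + G' i * j (star y)) - c *: (G i * j y - G' i * j (star y)).
    rewrite -scalerBr opprB [X in X + (_ - _)]addrC addrACA subrr addr0.
    by rewrite scalerDr scalerDl.
  exact: (subspaceB sC).
case: x => i; apply: nondeg => y; first by have [] := GG0 i y.
by have [_] := GG0 i (star y); rewrite starK.
Qed.

Lemma cyclic_form_eq0 d a :
  cyclic_form x0 (star_point a) (star_point a) (homogeneous_part d l) = 0.
Proof.
pose s := undup (flatten [seq m.2 | m <- homogeneous_part d l]).
rewrite (@cyclic_form_letters _ _ _ x0 _ _ _ s) ?undup_uniq //.
  by rewrite big1 // => x _; rewrite cyclic_coef_eq0 mul0r.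
move=> m x ml xm; rewrite mem_undup => /flattenP[]; exists m.2 => //.
exact: map_f.
Qed.

End Traceless.

(** The values of the cyclic average of [f] are combinations of the values of the
    cyclic derivatives of the homogeneous parts of [f], which all vanish. *)
Theorem traceless_cyclic_identity f : evaluable A f ->
  (forall a, commutator_space B (j (star_eval star a f))) ->
  exists g : star_poly F, cyc_equiv f g /\ star_identity star g.
Proof.
move=> ev hf.
have traceless a : commutator_space B (poly_val (star_point a) (star_list f)).
  by rewrite star_list_val -emb_star_eval.
have f1 : f@_(mone : {fmonom (nat + nat)%type}) = 0.
  apply: contrapT => /eqP f1; apply: one_notin.
  have k1 : k f@_(mone : {fmonom (nat + nat)%type}) != 0 by rewrite fmorph_eq0.
  rewrite -[1](scalerK k1); apply: (subspaceZ (@comm_sub K B)).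
  have := homogeneous_traceless traceless 0 (fun=> 0).
  rewrite /poly_val /homogeneous_part big_filter big_map big_mkcond /=.
  have m1 : mone \in (msupp f : seq {fmonom (nat + nat)%type}).
    by rewrite -mcoeff_neq0.
  rewrite (bigD1_seq _ m1) ?fset_uniq //= fm1 eqxx /word_val big_nil.
  rewrite big1 ?addr0 // => w /negP w1; case: eqP => // /size0nil e.
  by case: w1; apply/eqP; apply: val_inj; rewrite /= fm1.
exists (cyclic_average f); split; first exact: cyclic_average_equiv.
have evg : evaluable A (cyclic_average f).
  right; rewrite /cyclic_average raddf_sum big1 // => w _.
  rewrite raddf_sum big1 // => p _; rewrite /= mcoeffZ mcoeffU.
  rewrite (_ : _ == _ = false) ?mulr0 //; apply/negP => /eqP.
  move=> /(congr1 (fun u : {fmonom (nat + nat)%type} => size u)).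
  by rewrite /= fm1 size_rot => e; have := ltn_ord p; rewrite [X in (_ < X)%N]e.
suff zero a : star_eval star a (cyclic_average f) = 0.
  by split=> //; apply/seteqP; split=> [_ [a _ <-]|_ ->] //; exists (fun=> 0).
apply: (embI emb_j); rewrite (emb_zero emb_j) emb_star_eval //.
rewrite /cyclic_average malg_val_sum.
have [N [_ hN]] := word_size_bound (star_list f).
pose X (m : K * seq (nat + nat)) : B := (m.1 / (size m.2)%:R) *:
  \sum_(p < size m.2) word_val (star_point a) (rot p.+1 m.2).
transitivity (\sum_(m <- star_list f) X m).
  rewrite big_map; apply: eq_bigr => w _; rewrite malg_val_sum /X scaler_sumr.
  apply: eq_bigr => p _; rewrite malg_valZ malg_valU /=.
  by rewrite fmorph_div rmorph_nat.
rewrite (sum_homogeneous X hN) big1 // => d _.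
transitivity ((d%:R)^-1 *: cyclic_form (inl 0%N) (star_point a) (star_point a)
    (homogeneous_part d (star_list f))); last first.
  by rewrite cyclic_form_eq0 // scaler0.
rewrite /cyclic_form scaler_sumr /homogeneous_part !big_filter.
apply: eq_bigr => m /eqP sm.
rewrite /X sm scalerA mulrC; congr (_ *: _).
rewrite -sm; apply: eq_bigr => p _; rewrite (rot_restE (inl 0%N)) // -cats1.
by rewrite /word_val big_cat big_seq1.
Qed.

End Star.

(** * The four possibilities *)

Lemma cyc_equiv_values (F : fieldType) (A : assocAlgType F) (star : A -> A)
    (K : fieldType) (B : algType K) (k : {rmorphism F -> K}) (j : A -> B)
    (f g : star_poly F) a :
  alg_embedding k j -> evaluable A f -> cyc_equiv f g -> star_identity star g ->
  exists s : seq (B * B),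
    j (star_eval star a f) = \sum_(z <- s) (z.1 * z.2 - z.2 * z.1).
Proof.
move=> emb_j ev [s fg] [evg g0].
have ga : star_eval star a g = 0.
  by have : image_of star g (star_eval star a g) by [exists a]; rewrite g0.
pose V := star_point star j a.
exists [seq (malg_val k V pq.1, malg_val k V pq.2) | pq <- s].
have g_val : malg_val k V g = 0.
  by rewrite -(emb_star_eval _ emb_j) // ga (emb_zero emb_j).
transitivity (malg_val k V (f - g)).
  by rewrite malg_valB g_val subr0 (emb_star_eval _ emb_j).
rewrite fg malg_val_sum big_map.
by apply: eq_bigr => pq _; rewrite malg_valB !malg_valM.
Qed.

Lemma not_identity_value (F : fieldType) (A : assocAlgType F) (star : A -> A)
    (f : star_poly F) :
  evaluable A f -> ~ star_identity star f -> exists a, star_eval star a f <> 0.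
Proof.
move=> ev nid; apply: contrapT => no; apply: nid; split=> //.
have all0 a : star_eval star a f = 0.
  by apply: contrapT => h; apply: no; exists a.
by apply/seteqP; split=> [_ [a _ <-]|_ ->]; [|exists (fun=> 0)].
Qed.

Section Cases.
Variables (F : fieldType) (cj : {rmorphism F -> F}) (A : assocAlgType F).
Variables (star : A -> A) (f : star_poly F).
Hypotheses (charF : [pchar F] =i pred0) (pA : prime_alg A) (PIA : PI_alg A).
Hypotheses (invol : involution_on cj star) (second : second_kind star).
Hypothesis ev : evaluable A f.

Let zA : exists2 z : A, center A z & z <> 0.
Proof. by have [z [zC z0 _]] := skew_center invol second; exists z. Qed.

(** A nonzero central value of [f] would be, in the Martindale closure, a nonzero
    scalar equal to a sum of commutators. *)
Lemma central_not_cyclic_identity (g : star_poly F) :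
  central_poly star f -> cyc_equiv f g -> ~ star_identity star g.
Proof.
move=> [nid cen] fg gid; have [a fa] := not_identity_value ev nid.
have [_ [C [R [k [i [emb_i cenR ncomm]]]]]] := prime_PI_structure charF pA PIA zA.
have [s hs] := cyc_equiv_values a emb_i ev fg gid.
have [c hc] : exists c : C, i (star_eval star a f) = c%:A.
  by apply: cenR; apply: cen; exists a.
have c0 : c != 0.
  apply: contra_not_neq fa => c0; apply: (embI emb_i).
  by rewrite hc c0 scale0r (emb_zero emb_i).
apply: (ncomm [seq (c^-1 *: z.1, z.2) | z <- s]).
rewrite big_map -[LHS](scalerK c0) -hc hs scaler_sumr.
by apply: eq_bigr => z _ /=; rewrite scalerBr scalerAl scalerAr.
Qed.

Variables (K : fieldType) (B : algType K) (j : A -> B).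
Hypothesis ccj : central_closure j.
Variable k : {rmorphism F -> K}.
Hypothesis emb_j : alg_embedding k j.

Local Notation L := (value_span star j k f).

Let val_in a : L (j (star_eval star a f)).
Proof.
apply: lin_span_gen; exists a => //.
by rewrite star_list_val (emb_star_eval _ emb_j).
Qed.

Let L_min (P : set B) : subspace P -> (forall a, P (j (star_eval star a f))) -> L `<=` P.
Proof.
move=> sP h; apply: (lin_span_min sP) => _ [a _ <-].
by rewrite star_list_val -(emb_star_eval _ emb_j).
Qed.

Let sL : subspace L. Proof. exact: lin_span_subspace. Qed.

(** Scalars of [F] act on [B] through [K], so taking the span over [F] first
    changes nothing. *)
Lemma tilde_value_span : tilde j (lin_span (image_of star f)) = L.
Proof.
apply/seteqP; split.
  apply: (lin_span_min sL) => _ [x hx <-].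
  have sP : subspace [set x | L (j x)].
    split; first by rewrite /= (emb_zero emb_j); apply: sL.1.
    by move=> c y z /= hy hz; rewrite (embD emb_j) (embZ emb_j); apply: sL.2.
  by apply: (lin_span_min sP _ hx) => _ [a _ <-]; apply: val_in.
apply: L_min; first exact: lin_span_subspace.
move=> a; apply: lin_span_gen; exists (star_eval star a f) => //.
by apply: lin_span_gen; exists a.
Qed.

Let herstein : (forall l b, L l -> comm l b = 0) \/ commutator_space B `<=` L.
Proof.
apply: herstein_lie_ideal.
- exact: closure_simple ccj zA charF pA PIA.
- by have /pcharf0P -> := closure_pchar ccj zA charF.
- exact: (value_span_lie charF invol second ccj emb_j f).
Qed.

Let one_notin := closure_one_notin ccj zA charF pA PIA.
Let sC := @comm_sub K B.

Lemma identity_span : star_identity star f -> L = [set 0].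
Proof.
move=> [_ f0].
have f0a a : j (star_eval star a f) = 0.
  have : image_of star f (star_eval star a f) by exists a.
  by rewrite f0 => ->; apply: emb_zero emb_j.
apply/seteqP; split; last by move=> _ ->; apply: sL.1.
by apply: L_min => //; split=> // c x y -> ->; rewrite scaler0 addr0.
Qed.

Lemma central_span : central_poly star f -> L = scalars B.
Proof.
move=> [nid cen]; have [a fa] := not_identity_value ev nid.
have cenf b : center A (star_eval star b f) by apply: cen; exists b.
apply/seteqP; split.
  apply: L_min => [|b].
    split; first by exists 0; rewrite ?scale0r.
    by move=> c _ _ [x _ <-] [y _ <-]; exists (c * x + y); rewrite // scalerDl scalerA.
  by have [c hc] := closure_center ccj (cenf b); exists c.
have [c c0 hc] := closure_center_neq0 ccj (cenf a) fa.
move=> _ [d _ <-]; have := subspaceZ sL (d / c) (val_in a).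
by rewrite hc scalerA divfK.
Qed.

(** A central [L~] inside [[B, B]] would be zero, since [1] is not in
    [[B, B]]. *)
Lemma commutator_span : L `<=` commutator_space B -> ~ star_identity star f ->
  L = commutator_space B.
Proof.
move=> LC nid; have [a fa] := not_identity_value ev nid.
apply/seteqP; split=> //; case: herstein => // cen.
have [|c hc] := @closure_central _ _ _ _ _ ccj (j (star_eval star a f)).
  by move=> b; apply/eqP; rewrite -subr_eq0; apply/eqP/cen.
have c0 : c != 0.
  apply: contra_not_neq fa => c0; apply: (embI emb_j).
  by rewrite hc c0 scale0r (emb_zero emb_j).
by case: one_notin; rewrite -[1](scalerK c0) -hc; apply/(subspaceZ sC)/LC.
Qed.

Lemma cyclic_identity_span (g : star_poly F) : cyc_equiv f g ->
  star_identity star g -> ~ star_identity star f -> L = commutator_space B.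
Proof.
move=> fg gid; apply: commutator_span; apply: L_min => // a.
have [s ->] := cyc_equiv_values a emb_j ev fg gid.
by apply: (subspace_sum sC) => z _; apply: comm_gen.
Qed.

(** [L~] contains [[B, B]] and, unless [f] is cyclically equivalent to an
    identity, an element outside it, hence also [1]. *)
Lemma full_span : ~ central_poly star f ->
  ~ (exists g, cyc_equiv f g /\ star_identity star g) -> L = [set: B].
Proof.
move=> ncen ncyc.
have nid : ~ star_identity star f.
  by move=> fid; apply: ncyc; exists f; split=> //; exists [::]; rewrite big_nil subrr.
have CL : commutator_space B `<=` L.
  case: herstein => // cen; case: ncen; split=> // _ [a _ <-] b.
  apply: (embI emb_j); rewrite !(embM emb_j); apply/eqP; rewrite -subr_eq0.
  exact/eqP/cen.
have [s [sS sn0]] := closure_scalar_op ccj zA charF pA PIA.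
have codim := commutator_codim1 (closure_simple ccj zA charF pA PIA) one_notin sS sn0.
have [LC|nLC] := pselect (L `<=` commutator_space B).
  case: ncyc; apply: (traceless_cyclic_identity charF pA PIA invol second ccj emb_j) => // a.
  exact: LC.
have [l [Ll nl]] : exists l, L l /\ ~ commutator_space B l.
  by apply: contrapT => no; apply: nLC => l Ll; apply: contrapT => h; apply: no; exists l.
have [c hc] := codim l.
have c0 : c != 0.
  by apply/eqP => c0; apply: nl; move: hc; rewrite c0 scale0r subr0.
have L1 : L 1.
  rewrite -[1](scalerK c0); apply: (subspaceZ sL).
  by rewrite -[c%:A](subKr l); apply: (subspaceB sL) => //; apply: CL.
apply/seteqP; split=> // b _; have [d hd] := codim b.
by rewrite -[b](subrK d%:A); apply: (subspaceD sL); [exact: CL|exact: subspaceZ].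
Qed.

End Cases.

Theorem theorem4p8 (F : fieldType) (cj : {rmorphism F -> F})
    (A : assocAlgType F) (star : A -> A) (f : star_poly F) :
  involutive cj ->
  [pchar F] =i pred0 ->
  noncommutative A ->
  prime_alg A ->
  PI_alg A ->
  involution_on cj star ->
  second_kind star ->
  evaluable A f ->
  let L : set A := lin_span (image_of star f) in
  let case1 := star_identity star f in
  let case2 := central_poly star f in
  let case3 := ~ star_identity star f /\
    exists g : star_poly F, cyc_equiv f g /\ star_identity star g in
  let case4 := ~ central_poly star f /\
    ~ (exists g : star_poly F, cyc_equiv f g /\ star_identity star g) in
  exactly_one4 case1 case2 case3 case4 /\
  (forall (K : fieldType) (B : algType K) (j : A -> B), central_closure j ->
    [/\ case1 -> tilde j L = [set 0],
        case2 -> tilde j L = scalars B,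
        case3 -> tilde j L = commutator_space B
      & case4 -> tilde j L = [set: B]]).
Proof.
move=> _ charF _ pA PIA invol second ev L case1 case2 case3 case4; split.
  have self : case1 -> exists g, cyc_equiv f g /\ star_identity star g.
    by move=> fid; exists f; split=> //; exists [::]; rewrite big_nil subrr.
  have clash : case2 -> ~ exists g, cyc_equiv f g /\ star_identity star g.
    move=> cen [g [fg gid]].
    exact: (central_not_cyclic_identity charF pA PIA invol second ev cen fg gid).
  have [c1|nc1] := pselect case1.
    by apply: Or41; split=> // [[]//|[]//|[_]]; apply; apply: self.
  have [c2|nc2] := pselect case2.
    by apply: Or42; split=> // [[_]|[]//]; apply: clash.
  have [g|ng] := pselect (exists g, cyc_equiv f g /\ star_identity star g).
    by apply: Or43; split=> // [[]].
  by apply: Or44; split=> // [[_]].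
move=> K B j ccj.
have zA : exists2 z : A, center A z & z <> 0.
  by have [z [zC z0 _]] := skew_center invol second; exists z.
have [k emb_j] := closure_embedding ccj zA.
rewrite (tilde_value_span star ev emb_j); split.
- exact: identity_span.
- exact: central_span.
- move=> [nid [g [fg gid]]].
  exact: (cyclic_identity_span charF pA PIA invol second ev ccj emb_j fg gid nid).
- move=> [ncen ncyc].
  exact: (full_span charF pA PIA invol second ev ccj emb_j ncen ncyc).
Qed.
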